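(* Consider the fixed-design normal linear regression model with unknown error variance. Assume that the true parameter value is $\theta_0=(\beta_0,\sigma_0^2)$, i.e. $g_i=f_{i,\theta_0}$ for all $i$, and that the prior density on $\theta=(\beta,\sigma^2)$ is continuous and positive at $\theta_0$. Take any $\alpha\ge0$. Suppose the design satisfies: (R1) for all $j,l,s\in\{1,\dots,k\}$: $\sup_{n>1}\max_{1\le i\le n}|t_{ij}|=O(1)$, $\max_{1\le i\le n}|t_{ij}||t_{il}|=O(1)$, and $\frac1n\sum_{i=1}^n|t_{ij}t_{il}t_{is}|=O(1)$; (R2) $\inf_n\big[\text{min eigenvalue of }n^{-1}(D^TD)\big]>0$ (so that $D$ has full column rank) and $\max_{1\le i\le n}\big[t_i^T(D^TD)^{-1}t_i\big]=O(n^{-1})$. Then, given any $\epsilon>0$, there exists $r>0$ such that $$\lim_{n\to\infty}P\left[\pi_n^{(\alpha)}\left(\Big\{\theta:\frac1n\sum_{i=1}^nd_1(g_i,f_{i,\theta})\ge\epsilon\Big\}\Big|\underline X_n\right)<e^{-nr}\right]=1.$$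
   Context: Let $t_i=(t_{i1},\dots,t_{ik})^T\in\mathbb R^k$, $i=1,2,\dots$, be fixed (non-random) design points and $D=[t_1,\dots,t_n]^T$ the $n\times k$ design matrix. $X_1,X_2,\dots$ are independent under the true probability $P$, $X_i$ having Lebesgue density $g_i$ on $\mathbb R$; $\underline X_n=(X_1,\dots,X_n)$. The parameter is $\theta=(\beta,\sigma^2)\in\Theta=\mathbb R^k\times(0,\infty)$, and the model density $f_{i,\theta}$ of $X_i$ is that of $N(t_i^T\beta,\sigma^2)$. The prior on $\theta$ has a density $\pi$ on $\Theta$ with total mass at most one. For $\alpha>0$, $q_{i,\theta}^{(\alpha)}(y)=\frac1\alpha(f_{i,\theta}^\alpha(y)-1)-\frac1{1+\alpha}\int f_{i,\theta}^{1+\alpha}$, and $q_{i,\theta}^{(0)}(y)=\log f_{i,\theta}(y)-1$; $q_n^{(\alpha)}(\underline x_n|\theta)=\sum_{i=1}^nq_{i,\theta}^{(\alpha)}(x_i)$. The $R^{(\alpha)}$-posterior is $\pi_n^{(\alpha)}(A|\underline x_n)=\int_A\exp(q_n^{(\alpha)}(\underline x_n|\theta))\pi(\theta)d\theta\big/\int_\Theta\exp(q_n^{(\alpha)}(\underline x_n|\theta))\pi(\theta)d\theta$ whenever the denominator is finite and positive (otherwise it may be defined arbitrarily, e.g. as $\pi(A)$). $d_1(g,f)=\int|g-f|$ is the $L_1$ distance. *)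

(* Defs.v *)
From HB Require Import structures.
From mathcomp Require Import all_boot all_order all_algebra finmap.
From mathcomp Require Import all_classical all_reals all_analysis.

Set Implicit Arguments.
Unset Strict Implicit.
Unset Printing Implicit Defensive.

Import Order.TTheory GRing.Theory Num.Theory.
Import numFieldNormedType.Exports.

Local Open Scope classical_set_scope.
Local Open Scope ring_scope.

(* Row vectors carry the sigma-algebra generated by their coordinates, as the
   library does for tuples; over the reals it is the Borel sigma-algebra. *)
Definition measure_rV_display : measure_display -> measure_display.
Proof. exact. Qed.

Section measurable_rV.
Context {d} {T : sigmaRingType d} (k : nat).

Let coord : 'I_k -> 'rV[T]_k -> T := fun j v => v ord0 j.

Let rV_set0 : g_sigma_preimage coord set0.
Proof. exact: sigma_algebra0. Qed.

Let rV_setC A : g_sigma_preimage coord A -> g_sigma_preimage coord (~` A).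
Proof. exact: sigma_algebraC. Qed.

Let rV_bigcup (F : _^nat) : (forall i, g_sigma_preimage coord (F i)) ->
  g_sigma_preimage coord (\bigcup_i (F i)).
Proof. exact: sigma_algebra_bigcup. Qed.

HB.instance Definition _ := @isMeasurable.Build (measure_rV_display d)
  'rV[T]_k (g_sigma_preimage coord) rV_set0 rV_setC rV_bigcup.

End measurable_rV.

Lemma measurable_coord d (T : sigmaRingType d) k (j : 'I_k) :
  measurable_fun [set: 'rV[T]_k] (fun v : 'rV[T]_k => v ord0 j).
Proof.
move=> _ Y mY; rewrite setTI; apply: sub_sigma_algebra => /=.
rewrite -bigcup_seq/=; exists j => /=; first by rewrite mem_index_enum.
by exists Y => //; rewrite setTI.
Qed.

Lemma measurable_fun_coordP d1 d2 (T1 : measurableType d1)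
    (T2 : measurableType d2) k (f : T1 -> 'rV[T2]_k) :
  measurable_fun [set: T1] f <->
  forall j, measurable_fun [set: T1] (fun x => f x ord0 j).
Proof.
split=> [mf j|mf].
  exact: (measurableT_comp (@measurable_coord _ T2 k j) mf).
move=> _ Y mY; rewrite setTI.
have : <<s \big[setU/set0]_(i < k)
    preimage_set_system setT (fun v : 'rV[T2]_k => v ord0 i) measurable >>
    `<=` image_set_system setT f measurable.
  apply: smallest_sub.
    exact/sigma_algebra_image/sigma_algebra_measurable.
  rewrite -bigcup_seq/=; apply: bigcup_sub => j _ A [B mB <-].
  by rewrite /image_set_system /= !setTI -[X in measurable X]setTI; exact: mf.
by move=> /(_ Y mY); rewrite /image_set_system /= setTI.
Qed.

Section lebesgue_rV.
Context {R : realType}.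
Local Notation mu := (@lebesgue_measure R).

Definition rV_cons k (xv : measurableTypeR R * 'rV[measurableTypeR R]_k) :
    'rV[measurableTypeR R]_k.+1 :=
  \row_j oapp (xv.2 ord0) xv.1 (unlift ord0 j).

Definition rV_uncons k (v : 'rV[measurableTypeR R]_k.+1) :
    measurableTypeR R * 'rV[measurableTypeR R]_k :=
  (v ord0 ord0, \row_j v ord0 (lift ord0 j)).

Lemma rV_consK k : cancel (@rV_cons k) (@rV_uncons k).
Proof.
case=> x v; rewrite /rV_uncons /rV_cons !mxE unlift_none; congr pair.
by apply/rowP => j; rewrite !mxE liftK.
Qed.

Lemma measurable_rV_cons k : measurable_fun setT (@rV_cons k).
Proof.
apply/measurable_fun_coordP => j.
rewrite /rV_cons; under eq_fun do rewrite mxE.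
case: unliftP => [i|] _ /=; last exact: measurable_fst.
exact: (measurableT_comp (@measurable_coord _ _ k i) measurable_snd).
Qed.

Lemma measurable_rV_uncons k : measurable_fun setT (@rV_uncons k).
Proof.
apply/measurable_fun_pair => /=; first exact: measurable_coord.
apply/measurable_fun_coordP => j; under eq_fun do rewrite mxE.
exact: measurable_coord.
Qed.

Section step.
Variables (k : nat)
  (m : {sigma_finite_measure set 'rV[measurableTypeR R]_k -> \bar R}).

Definition lebesgue_rV_step : set 'rV[measurableTypeR R]_k.+1 -> \bar R :=
  pushforward (mu \x m)%E (@rV_cons k).

Let step0 : lebesgue_rV_step set0 = 0%E.
Proof. by rewrite /lebesgue_rV_step /pushforward preimage_set0 measure0. Qed.

Let step_ge0 A : (0 <= lebesgue_rV_step A)%E.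
Proof. exact: (measure_ge0 (mu \x m)%E). Qed.

Let step_sigma_additive : semi_sigma_additive lebesgue_rV_step.
Proof.
exact: (@measure_semi_sigma_additive _ _ _
  (measure_function_pushforward__canonical__measure_function_Measure
    (mu \x m)%E (@measurable_rV_cons k))).
Qed.

HB.instance Definition _ := isMeasure.Build _ _ _ lebesgue_rV_step
  step0 step_ge0 step_sigma_additive.

Let step_sigma_finite : sigma_finite setT lebesgue_rV_step.
Proof.
have /sigma_finiteP[F [FT ndF Foo]] := sigma_finiteT mu.
have /sigma_finiteP[G [GT ndG Goo]] := sigma_finiteT m.
exists (fun i => @rV_uncons k @^-1` (F i `*` G i)).
  rewrite -preimage_bigcup (_ : \bigcup_i _ = setT) ?preimage_setT//.
  rewrite -subTset => -[x v] _.
  have [i _ Fix] : (\bigcup_i F i) x by rewrite -FT.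
  have [j _ Gjv] : (\bigcup_i G i) v by rewrite -GT.
  exists (maxn i j) => //; split => /=.
    by move: Fix; exact/subsetPset/ndF/leq_maxl.
  by move: Gjv; exact/subsetPset/ndG/leq_maxr.
move=> i; have [mF Fioo] := Foo i; have [mG Gioo] := Goo i; split.
  rewrite -[X in measurable X]setTI; apply: measurable_rV_uncons => //.
  exact: measurableX.
rewrite /lebesgue_rV_step /pushforward -comp_preimage.
rewrite (_ : _ \o _ = id); last by apply/funext => x /=; rewrite rV_consK.
by rewrite preimage_id product_measure1E// lte_mul_pinfty// ge0_fin_numE.
Qed.

HB.instance Definition _ :=
  Measure_isSigmaFinite.Build _ _ _ lebesgue_rV_step step_sigma_finite.

End step.

Fixpoint lebesgue_rV k :
    {sigma_finite_measure set 'rV[measurableTypeR R]_k -> \bar R} :=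
  if k is k'.+1 then lebesgue_rV_step (lebesgue_rV k') 
  else @dirac _ 'rV[measurableTypeR R]_0 (0 : 'rV[R]_0) R.

End lebesgue_rV.

Lemma lebesgue_rV_box (R : realType) k (A : 'I_k -> set (measurableTypeR R)) :
  (forall j, measurable (A j)) ->
  lebesgue_rV k [set v | forall j, A j (v ord0 j)] =
  (\prod_(j < k) lebesgue_measure (A j))%E.
Proof.
elim: k A => [|k IHk] A mA; first by
  rewrite big_ord0 /= diracE mem_set//= => -[].
rewrite big_ord_recl -IHk// -product_measure1E//; last first.
  rewrite [X in measurable X](_ : _ = \bigcap_(j in [set: 'I_k])
      (fun v : 'rV[measurableTypeR R]_k => v ord0 j) @^-1` A (lift ord0 j)).
    apply: (@fin_bigcap_measurable _ 'rV[measurableTypeR R]_k) => [|j _].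
      exact: finite_finset.
    rewrite -[X in measurable X]setTI.
    exact: (@measurable_coord _ (measurableTypeR R) k j).
  by apply/seteqP; split=> [v /= Av j _|v /= Av j]; exact: Av.
rewrite /= /lebesgue_rV_step /pushforward; congr (product_measure1 _ _ _).
apply/seteqP; split=> -[x v] /=.
  move=> Axv; split=> [|j]; first by have := Axv ord0; rewrite mxE unlift_none.
  by have := Axv (lift ord0 j); rewrite mxE liftK.
case=> Ax Av j; rewrite mxE.
by case: unliftP => [i ->|->] /=.
Qed.

Section alpha_posterior.
Context {R : realType}.
Local Notation mu := (@lebesgue_measure R).

Definition mutually_independent d (T : measurableType d) (P : probability T R)
    (X : nat -> {RV P >-> R}) : Prop :=
  forall (J : {fset nat}) (B : nat -> set R), (forall i, measurable (B i)) ->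
  P (\bigcap_(i in [set` J]) X i @^-1` B i) =
  (\prod_(i <- J) P (X i @^-1` B i))%E.

Definition has_density d (T : measurableType d) (P : probability T R)
    (X : {RV P >-> R}) (g : R -> R) : Prop :=
  forall B : set R, measurable B ->
  distribution P X B = (\int[mu]_(y in B) (g y)%:E)%E.

Definition L1_dist (g f : R -> R) : R := \int[mu]_y `|g y - f y|.

Definition q_alpha (alpha : R) (f : R -> R) (y : R) : R :=
  if alpha == 0 then ln (f y) - 1
  else alpha^-1 * (f y `^ alpha - 1)
       - (1 + alpha)^-1 * \int[mu]_z f z `^ (1 + alpha).

Section posterior.
Context d (Par : measurableType d) (nu : {measure set Par -> \bar R}).
Variables (Theta : set Par) (f : nat -> Par -> R -> R) (prior : Par -> R).

Definition q_n (alpha : R) (n : nat) (x : nat -> R) (theta : Par) : R :=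
  \sum_(i < n) q_alpha alpha (f i theta) (x i).

Definition R_weight (alpha : R) (n : nat) (x : nat -> R) (A : set Par) :
    \bar R :=
  (\int[nu]_(theta in A) (expR (q_n alpha n x theta) * prior theta)%:E)%E.

(* meant for A included in Theta *)
Definition R_posterior (alpha : R) (n : nat) (x : nat -> R) (A : set Par) :
    \bar R :=
  if (0 < R_weight alpha n x Theta < +oo)%E
  then (R_weight alpha n x A / R_weight alpha n x Theta)%E
  else (\int[nu]_(theta in A) (prior theta)%:E)%E.

Definition is_prior_density : Prop :=
  [/\ measurable_fun Theta prior,
      forall theta, Theta theta -> 0 <= prior theta &
      (\int[nu]_(theta in Theta) (prior theta)%:E <= 1)%E].

End posterior.
End alpha_posterior.

Section linear_regression.
Context {R : realType} (k : nat) (t : nat -> 'rV[R]_k).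

(* theta = (beta, sigma^2): the second component is the variance, whereas
   normal_pdf takes the standard deviation *)
Definition reg_par : set ('rV[R]_k * R) := [set theta | 0 < theta.2].

Definition reg_density (i : nat) (theta : 'rV[R]_k * R) : R -> R :=
  normal_pdf ((t i *m theta.1^T) ord0 ord0) (Num.sqrt theta.2).

Definition reg_lebesgue :
    set ('rV[measurableTypeR R]_k * measurableTypeR R) -> \bar R :=
  (lebesgue_rV k \x lebesgue_measure)%E.

HB.instance Definition _ := Measure.on reg_lebesgue.

Definition design (n : nat) : 'M[R]_(n, k) := \matrix_(i < n) t i.

Definition gram (n : nat) : 'M[R]_k := (design n)^T *m design n.

Definition min_eigenvalue m (A : 'M[R]_m) : R := inf [set a | eigenvalue A a].

(* Maxima are taken of nonnegative quantities, so that 0 may serve as the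
   value of an empty maximum. *)
Definition R1_condition : Prop := forall j l s : 'I_k,
  [/\ (ereal_sup [set (\big[Num.max/0]_(i < n) `|t i ord0 j|)%:E
                 | n in [set n | (1 < n)%N]] < +oo)%E,
      (fun n => \big[Num.max/0]_(i < n) (`|t i ord0 j| * `|t i ord0 l|) : R^o)
        =O_\oo (fun=> 1 : R^o) &
      (fun n => n%:R^-1 * \sum_(i < n) `|t i ord0 j * t i ord0 l * t i ord0 s|
                : R^o)
        =O_\oo (fun=> 1 : R^o)].

(* D^T D is singular whenever n < k, so the infimum of its smallest eigenvalue
   can only be required to be positive over n large. *)
Definition R2_condition : Prop :=
  (exists n0 : nat, 0 < inf [set min_eigenvalue (n%:R^-1 *: gram n)
                            | n in [set n | (n0 <= n)%N]]) /\
  (fun n => \big[Num.max/0]_(i < n) (t i *m invmx (gram n) *m (t i)^T) ord0 ord0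
            : R^o)
    =O_\oo (fun n => n%:R^-1 : R^o).

End linear_regression.
Arguments reg_par R k : clear implicits.
Arguments reg_lebesgue R k : clear implicits.

(* Main.v *)
(* With probability tending to one, for some dl > 0: the objective q_n(theta) is
   at most q_n(theta0) - 2 n dl wherever the average L1 distance to the truth is
   at least eps, and at least q_n(theta0) - n dl on a fixed neighbourhood of
   theta0, which has positive prior mass. Dividing the two integrals bounds the
   posterior mass of the complement of the L1 ball by a multiple of
   exp(- n dl).

   For alpha > 0 the objective averages bounded Gaussian kernels of the residuals.
   The kernel averages converge uniformly over all regression coefficients: modulo
   a mesh and a cut-off, the vectors of shifts (t_i b)_(i < n) fall into
   polynomially many classes (affine functionals shatter at most k + 1 points), so
   a Chernoff bound over representatives suffices. The limiting risk has a strict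
   maximum at the true parameters.

   For alpha = 0 the log-likelihood is quadratic in the coefficients, hence
   controlled by the empirical means of e_i^2 and e_i t_ij for the errors e_i,
   together with the coercivity of the Gram matrix given by (R2). *)
Require Import Defs.
From HB Require Import structures.
From mathcomp Require Import all_boot all_order all_algebra finmap.
From mathcomp Require Import all_classical all_reals all_analysis.
From mathcomp Require Import measurable_realfun ring lra.

Import Order.TTheory GRing.Theory Num.Theory.
Import numFieldNormedType.Exports.
Local Open Scope classical_set_scope.
Local Open Scope ring_scope.

(** The obstacle is that the parameter set is not compact. The coefficients are unbounded; for
    [alpha > 0] the kernel vanishes at infinity and the errors are tight, so two shifts beyond a
    common cut-off are interchangeable up to the few observations with large errors, and finitely
    many thresholds per observation describe every coefficient vector. The scale is confined
    separately: for a large scale the factor [peak_pow] is small, and for a small scale the mean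
    kernel is small uniformly in the shift, which makes the shifted criterion nonpositive before
    [peak_pow] can blow it up. In between, a finite grid and monotonicity of the kernel in the scale
    suffice. Strictness of the maximum in the scale is made quantitative by [expR_sub_ge], for every
    [alpha]. The crude bound of [q_n] by its value at the truth plus [n], which accompanies both
    separation results, has another purpose: it makes the normalising integral finite, so that the
    posterior is the quotient. The rate is [dl / 2] because the other half of the exponent [n dl]
    absorbs the inverse of the prior mass near the truth. *)

Set Implicit Arguments.
Unset Strict Implicit.

(** * Integration against weighted image measures *)

Section weighted_integral.
Context {R : realType} d d' (T : measurableType d) (Y : measurableType d').
Variables (m : {measure set T -> \bar R}) (nu : {measure set Y -> \bar R}).
Variables (X : T -> Y) (w : T -> R) (c : R).
Hypotheses (mX : measurable_fun setT X) (mw : measurable_fun setT w).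
Hypotheses (w0 : forall x, 0 <= w x) (c0 : 0 <= c).
Hypothesis wB : forall B, measurable B ->
  (\int[m]_x (w x * \1_B (X x))%:E = c%:E * nu B)%E.

Import HBNNSimple.

Let measurable_weighted (h : Y -> R) : measurable_fun setT h ->
  measurable_fun setT (fun x => w x * h (X x)).
Proof. by move=> mh; apply: measurable_funM => //; exact: measurableT_comp. Qed.

Let integral_weighted_nnsfun (h : {nnsfun Y >-> R}) :
  (\int[m]_x (w x * h (X x))%:E = c%:E * \int[nu]_y (h y)%:E)%E.
Proof.
pose I r : Y -> R := fun y => r * \1_(h @^-1` [set r]) y.
have I0 r y : 0 <= I r y by have := nnfun_muleindic_ge0 h r y; rewrite -EFinM lee_fin.
have mI r : measurable_fun setT (I r) by exact: measurable_funM.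
have hE y : h y = \sum_(r <- fset_set (range h)) I r y.
  by rewrite {1}fimfunE fsbig_finite.
under eq_integral do rewrite hE mulr_sumr -sumEFin.
rewrite ge0_integral_sum//; last 2 first.
- by move=> r; apply/measurable_EFinP/measurable_weighted.
- by move=> r x _; rewrite lee_fin mulr_ge0.
under [in RHS]eq_integral do rewrite hE -sumEFin.
rewrite ge0_integral_sum//; last 2 first.
- by move=> r; apply/measurable_EFinP.
- by move=> r x _; rewrite lee_fin.
rewrite ge0_sume_distrr; last by move=> r _; apply: integral_ge0 => x _; rewrite lee_fin.
rewrite !big_seq; apply: eq_bigr => r rh.
have r0 : 0 <= r by move: rh; rewrite in_fset_set// inE => -[y _ <-].
under eq_integral do rewrite mulrCA EFinM.
rewrite ge0_integralZl//; last 2 first.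
- exact/measurable_EFinP/measurable_weighted.
- by move=> x _; rewrite lee_fin mulr_ge0.
under [in RHS]eq_integral do rewrite EFinM.
rewrite ge0_integralZl//; last first.
  exact/measurable_EFinP.
by rewrite wB// integral_indic// setIT muleCA.
Qed.

(** Two uses: with [w] the product of the other factors it splits one independent variable off an
    expectation, and with [X] the identity and [w] a density it integrates against a distribution.
    The identity passes from indicators to simple functions and then to monotone limits. *)
Lemma integral_weighted (h : Y -> R) : measurable_fun setT h ->
    (forall y, 0 <= h y) ->
  (\int[m]_x (w x * h (X x))%:E = c%:E * \int[nu]_y (h y)%:E)%E.
Proof.
move=> mh h0; have mhE : measurable_fun setT (EFin \o h) by exact/measurable_EFinP.
pose g := nnsfun_approx measurableT mhE.
have gh y : (EFin \o g^~ y) n @[n --> \oo] --> (h y)%:E.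
  by apply: cvg_nnsfun_approx => // x _; rewrite lee_fin.
have ndg y a b : (a <= b)%N -> g a y <= g b y.
  by move=> ab; exact/lefP/nd_nnsfun_approx.
transitivity (limn (fun n => \int[m]_x (w x * g n (X x))%:E))%E.
  rewrite -monotone_convergence//.
  - apply: eq_integral => x _; apply/esym/cvg_lim => //.
    under eq_fun do rewrite EFinM; rewrite EFinM.
    by apply: cvgeZl => //; exact: gh.
  - by move=> n; exact/measurable_EFinP/measurable_weighted.
  - by move=> n x _; rewrite lee_fin mulr_ge0.
  - by move=> x _ a b ab; rewrite lee_fin ler_wpM2l// ndg.
under eq_fun do rewrite integral_weighted_nnsfun.
apply/cvg_lim => //; apply: cvgeZl => //.
  rewrite [X in _ --> X](_ : _ = \int[nu]_y limn (fun n => (g n y)%:E))%E; last first.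
    by apply: eq_integral => y _; apply/esym/cvg_lim => //; exact: gh.
  apply: cvg_monotone_convergence => //.
  - by move=> n; exact/measurable_EFinP.
  - by move=> n y _; rewrite lee_fin.
  - by move=> y _ a b ab; rewrite lee_fin ndg.
Qed.

End weighted_integral.

(** * Products of independent variables and the exponential Markov inequality *)

Section independence.
Context {R : realType} d (T : measurableType d) (P : probability T R).
Variable X : nat -> {RV P >-> R}.
Hypothesis indX : mutually_independent X.

Let expectation_prod_indic n (B : nat -> set R) : (forall i, measurable (B i)) ->
  (\int[P]_w (\prod_(i < n) \1_(B i) (X i w))%:E =
   \prod_(i < n) P (X i @^-1` B i))%E.
Proof.
move=> mB; pose J : {fset nat} := seq_fset tt (iota 0 n).
have JP i : (i \in J) = (i < n)%N by rewrite seq_fsetE mem_iota add0n.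
have := indX J mB.
set V := \bigcap_(i in _) _ => PV.
have mV : measurable V.
  by apply: fin_bigcap_measurable => //= i _; rewrite -[X in measurable X]setTI; exact: measurable_funP.
transitivity (\int[P]_w (\1_V w)%:E)%E.
  apply: eq_integral => w _; congr EFin.
  have [Vw|] := pselect (V w).
    rewrite indicE mem_set// big1// => i _; rewrite indicE mem_set//.
    by apply: Vw => /=; rewrite JP.
  move=> /existsNP[i /not_implyP[/= iJ Biw]].
  rewrite [RHS]indicE [in RHS]memNset; last by move=> /(_ i iJ).
  have ltin : (i < n)%N by rewrite -JP.
  by rewrite (bigD1 (Ordinal ltin))//= indicE memNset// mul0r.
rewrite integral_indic// setIT.
transitivity (P V) => //; rewrite PV.
rewrite (perm_big _ (seq_fset_perm _ _))/= undup_id ?iota_uniq//.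
by rewrite -(big_mkord xpredT (fun i => P (X i @^-1` B i)))/= /index_iota subn0.
Qed.

(** Independence is given for events only; the factors are turned from indicators into arbitrary
    functions one at a time. *)
Lemma expectation_prod n (h : nat -> R -> R) (c : nat -> R) :
    (forall i, measurable_fun setT (h i)) -> (forall i y, 0 <= h i y) ->
    (forall i, (\int[P]_w (h i (X i w))%:E = (c i)%:E)%E) ->
  (\int[P]_w (\prod_(i < n) h i (X i w))%:E = (\prod_(i < n) c i)%:E)%E.
Proof.
move=> mh h0 hc.
(* Only the factors of index below [j] are still arbitrary; the induction is on [j]. *)
suff S j : (j <= n)%N -> forall (h : nat -> R -> R) (c : nat -> R),
    (forall i, measurable_fun setT (h i)) -> (forall i y, 0 <= h i y) ->
    (forall i, (\int[P]_w (h i (X i w))%:E = (c i)%:E)%E) ->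
    (forall i, (j <= i)%N -> exists2 B, measurable B & h i = \1_B) ->
    (\int[P]_w (\prod_(i < n) h i (X i w))%:E = (\prod_(i < n) c i)%:E)%E.
  (* Indices from [n] on do not enter the product, so their factors may be replaced by the indicator
     of the whole line. *)
  pose h' i := if (i < n)%N then h i else \1_setT.
  pose c' i := if (i < n)%N then c i else 1.
  have := S n (leqnn n) h' c'.
  have -> : (fun w => (\prod_(i < n) h' i (X i w))%:E) =
            (fun w => (\prod_(i < n) h i (X i w))%:E).
    by apply/funext => w; congr EFin; apply: eq_bigr => i _; rewrite /h' ltn_ord.
  have -> : \prod_(i < n) c' i = \prod_(i < n) c i.
    by apply: eq_bigr => i _; rewrite /c' ltn_ord.
  apply.
  - by move=> i; rewrite /h'; case: ifP => // _.
  - by move=> i y; rewrite /h'; case: ifP.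
  - move=> i; rewrite /h' /c'; case: ifP => // _.
    rewrite (eq_integral (cst 1%E)); last by move=> w _; rewrite indicT.
    by rewrite integral_cst// mul1e; exact: probability_setT.
  - by move=> i ni; rewrite /h' ltnNge ni/=; exists setT.
elim: j {mh h0 hc} => [_ |j IH jn] {}h {}c mh h0 hc hB.
  have /choice[B hB'] : forall i, exists B, measurable B /\ h i = \1_B.
    by move=> i; have [B mB BE] := hB i (leq0n _); exists B.
  under eq_integral.
    move=> w _; rewrite (eq_bigr (fun i : 'I_n => \1_(B i) (X i w))); last first.
      by move=> i _; rewrite (hB' i).2.
    over.
  rewrite expectation_prod_indic; last by move=> i; exact: (hB' i).1.
  rewrite -prodEFin; apply: eq_bigr => i _; rewrite -hc (hB' i).2.
  rewrite -[RHS]/(\int[P]_w (\1_(X i @^-1` B i) w)%:E)%E integral_indic ?setIT//.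
  by rewrite -[X in measurable X]setTI; apply: measurable_funP => //; exact: (hB' i).1.
pose j' := Ordinal jn.
pose w x := \prod_(i < n | i != j') h i (X i x).
under eq_integral do rewrite (bigD1 j')//= mulrC.
rewrite (bigD1 j')//= mulrC EFinM -(hc j).
rewrite -(ge0_integral_distribution (X j) (f := EFin \o h j)); last 2 first.
- exact/measurable_EFinP.
- by move=> y; rewrite lee_fin.
have c0 i : 0 <= c i by rewrite -lee_fin -hc; apply: integral_ge0 => x _; rewrite lee_fin.
apply: (@integral_weighted _ _ _ _ _ P (distribution P (X j)) (X j) w) => //.
- rewrite (_ : w = fun x => \prod_(i < n) (if i != j' then h i (X i x) else 1)); last first.
    by apply/funext => x; rewrite /w big_mkcond.
  apply: measurable_prod => i _; have [_|_] := eqVneq i j' => //.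
  exact: measurableT_comp.
- by move=> x; apply: prodr_ge0.
(* It remains to test the factor [j] on an indicator, where the induction hypothesis applies. *)
move=> B mB.
pose h' i := if i == j then \1_B else h i.
pose c' i := if i == j then fine (P (X j @^-1` B)) else c i.
have mXB : measurable (X j @^-1` B).
  by rewrite -[X in measurable X]setTI; apply: measurable_funP.
have : (\int[P]_x (\prod_(i < n) h' i (X i x))%:E = (\prod_(i < n) c' i)%:E)%E.
  apply: IH; first exact: ltnW.
  - by move=> i; rewrite /h'; case: ifP.
  - by move=> i y; rewrite /h'; case: ifP.
  - move=> i; rewrite /h' /c'; case: eqP => [->|//].
    rewrite -[LHS]/(\int[P]_w (\1_(X j @^-1` B) w)%:E)%E integral_indic// setIT.
    by rewrite fineK// fin_num_measure.
  - move=> i ji; rewrite /h'; case: eqP => [_|/eqP ij]; first by exists B.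
    by apply: hB; rewrite ltn_neqAle eq_sym ij.
rewrite (bigD1 j')//= {1}/c' eqxx mulrC EFinM fineK ?fin_num_measure//.
rewrite [X in (X%:E * _)%E](_ : _ = \prod_(i < n | i != j') c i); last first.
  by apply: eq_bigr => i ij; rewrite /c' -[_ == _ :> nat]/(i == j') (negPf ij).
move=> <-; apply: eq_integral => x _; congr EFin.
rewrite [RHS](bigD1 j')//= {1}/h' eqxx mulrC; congr (_ * _).
by apply: eq_bigr => i ij; rewrite /h' -[_ == _ :> nat]/(i == j') (negPf ij).
Qed.

(** Markov's inequality for the exponential of the sum. The tilt and the centring are already
    contained in [z], so that one statement serves bounded, linear and quadratic terms. *)
Lemma chernoff_sum n (z : nat -> R -> R) (r : R) :
    (forall i, measurable_fun setT (z i)) ->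
    (forall i, (\int[P]_w (expR (z i (X i w)))%:E <= (expR (- r))%:E)%E) ->
  (P [set w | 0 <= \sum_(i < n) z i (X i w)]%R <= (expR (- (n%:R * r)))%:E)%E.
Proof.
move=> mz zr.
pose h i y := expR (z i y).
have mh i : measurable_fun setT (h i) by exact: measurableT_comp.
have h0 i y : 0 <= h i y by exact: expR_ge0.
have hfin i : (\int[P]_w (h i (X i w))%:E)%E \is a fin_num.
  rewrite ge0_fin_numE; first exact: le_lt_trans (zr i) (ltry _).
  by apply: integral_ge0 => w _; rewrite lee_fin.
have := @expectation_prod n h (fun i => fine (\int[P]_w (h i (X i w))%:E)%E) mh h0.
move=> /(_ (fun i => esym (fineK (hfin i)))) Eh.
have mS : measurable_fun setT (fun w => \sum_(i < n) z i (X i w)).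
  by apply: measurable_sum => i; exact: measurableT_comp.
set V := [set w | _].
have mV : measurable V.
  rewrite (_ : V = setT `&` (fun w => \sum_(i < n) z i (X i w)) @^-1` `[0, +oo[).
    exact: mS.
  by apply/seteqP; split=> w /=; rewrite in_itv/= andbT // => -[].
have -> : P V = (\int[P]_w (\1_V w)%:E)%E by rewrite integral_indic// setIT.
apply: (@le_trans _ _ (\int[P]_w (\prod_(i < n) h i (X i w))%:E)%E).
  apply: ge0_le_integral => //.
  - by apply/measurable_EFinP; exact: measurable_indic.
  - apply/measurable_EFinP; apply: measurable_prod => i _; exact: measurableT_comp.
  - move=> w _; rewrite lee_fin -expR_sum indicE.
    have [Vw|Vw] := pselect (V w).
      by rewrite mem_set//= -expR0 ler_expR.
    by rewrite memNset// expR_ge0.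
rewrite Eh lee_fin -mulrN expRM_natl -[X in _ <= _ ^+ X]card_ord -prodr_const.
apply: ler_prod => i _; apply/andP; split.
  by apply: fine_ge0; apply: integral_ge0 => w _; rewrite lee_fin.
by rewrite -lee_fin fineK//; exact: zr.
Qed.

End independence.

Lemma expectation_density {R : realType} d (T : measurableType d)
    (P : probability T R) (X : {RV P >-> R}) (g h : R -> R) :
    has_density X g -> measurable_fun setT g -> (forall y, 0 <= g y) ->
    measurable_fun setT h -> (forall y, 0 <= h y) ->
  (\int[P]_w (h (X w))%:E = \int[lebesgue_measure]_y (g y * h y)%:E)%E.
Proof.
move=> Xg mg g0 mh h0.
rewrite -(ge0_integral_distribution X (f := EFin \o h)); last 2 first.
- exact/measurable_EFinP.
- by move=> y; rewrite lee_fin.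
rewrite (@integral_weighted _ _ _ _ _ lebesgue_measure (distribution P X) id g 1)//.
  by rewrite mul1e.
move=> B mB; rewrite mul1e.
transitivity (\int[lebesgue_measure]_(y in B) (g y)%:E)%E; last exact/esym/Xg.
rewrite [RHS]integral_mkcond; apply: eq_integral => y _.
rewrite patchE indicE; by case: ifPn => _ /=; rewrite ?mulr1 ?mulr0.
Qed.

(** * Gaussian integrals *)

Section gaussian_integrals.
Context {R : realType}.
Implicit Types m s p a b y : R.
Local Notation mu := (@lebesgue_measure R).
Local Notation k2pi := (Num.sqrt (pi *+ 2) : R)^-1.

Lemma k2pi_gt0 : 0 < k2pi.
Proof. by rewrite invr_gt0 sqrtr_gt0 mulrn_wgt0// pi_gt0. Qed.

Lemma normal_peakE s : 0 < s -> normal_peak s = k2pi / s.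
Proof.
move=> s0; rewrite /normal_peak -mulrnAr sqrtrM ?sqr_ge0// sqrtr_sqr.
by rewrite ger0_norm ?ltW// invfM mulrC.
Qed.

Lemma normal_pdfE_gt0 m s y : 0 < s ->
  normal_pdf m s y = k2pi / s * expR (- ((y - m) ^+ 2 / (s ^+ 2 *+ 2))).
Proof.
by move=> s0; rewrite normal_pdfE ?gt_eqF// normal_peakE// /normal_fun mulNr.
Qed.

Lemma integral_gauss m s c : 0 < s -> 0 <= c ->
  (\int[mu]_y (c * expR (- ((y - m) ^+ 2 / (s ^+ 2 *+ 2))))%:E = (c * (s / k2pi))%:E)%E.
Proof.
move=> s0 c0.
transitivity (\int[mu]_y ((c * (s / k2pi))%:E * (normal_pdf m s y)%:E))%E.
  apply: eq_integral => y _; rewrite normal_pdfE_gt0// -EFinM; congr EFin.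
  have := k2pi_gt0; set q := k2pi => q0; set e := expR _.
  by field; rewrite !gt_eqF.
rewrite ge0_integralZl//.
- by rewrite integral_normal_pdf mule1.
- apply/measurable_EFinP; exact: measurable_normal_pdf.
- by move=> y _; rewrite lee_fin normal_pdf_ge0.
- by rewrite lee_fin mulr_ge0// divr_ge0 ?ltW// k2pi_gt0.
Qed.

(** Completing the square: the quadratic tilt adds [a] to the precision, and [p] is the standard
    deviation after the tilt. A negative [a] is allowed as long as the new precision is positive. *)
Lemma integral_normal_quadratic m s p a b : 0 < s -> 0 < p ->
    (p ^+ 2)^-1 = (s ^+ 2)^-1 + a ->
  (\int[mu]_y (normal_pdf m s y *
                expR (- (a / 2 * (y - m) ^+ 2) + b * (y - m)))%:E =
   (p / s * expR (b ^+ 2 * p ^+ 2 / 2))%:E)%E.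
Proof.
move=> s0 p0 pE; have aE : a = (p ^+ 2)^-1 - (s ^+ 2)^-1 by rewrite pE; ring.
transitivity (\int[mu]_y ((k2pi / s * expR (b ^+ 2 * p ^+ 2 / 2)) *
    expR (- ((y - (m + b * p ^+ 2)) ^+ 2 / (p ^+ 2 *+ 2))))%:E)%E.
  apply: eq_integral => y _; rewrite normal_pdfE_gt0// -!mulrA -!expRD.
  congr EFin; do 2 congr (_ * _); congr (expR _); rewrite {a pE}aE; field.
  by rewrite !gt_eqF.
rewrite integral_gauss//; last first.
  by rewrite mulr_ge0 ?expR_ge0// divr_ge0 ?ltW// k2pi_gt0.
congr EFin; have := k2pi_gt0; set q := k2pi => q0; field; by rewrite !gt_eqF.
Qed.

(** A power of a normal density is, up to a factor, normal with standard deviation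
    [s / Num.sqrt (1 + alpha)]. *)
Lemma integral_normal_pdf_powR m s alpha : 0 < s -> 0 <= alpha ->
  (\int[mu]_y (normal_pdf m s y `^ (1 + alpha))%:E =
   ((k2pi / s) `^ alpha / Num.sqrt (1 + alpha))%:E)%E.
Proof.
move=> s0 a0; have ks0 : 0 < k2pi / s by rewrite divr_gt0// k2pi_gt0.
have a1 : 0 < 1 + alpha by rewrite ltr_wpDr.
have r0 : 0 < Num.sqrt (1 + alpha) by rewrite sqrtr_gt0.
transitivity (\int[mu]_y ((k2pi / s) `^ (1 + alpha) *
   expR (- ((y - m) ^+ 2 / ((s / Num.sqrt (1 + alpha)) ^+ 2 *+ 2))))%:E)%E.
  apply: eq_integral => y _; rewrite normal_pdfE_gt0// powRM ?expR_ge0 ?ltW//.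
  rewrite -expRM; congr (_ * expR _)%:E; rewrite expr_div_n sqr_sqrtr ?ltW//.
  by field; rewrite !gt_eqF.
rewrite integral_gauss ?divr_gt0 ?powR_ge0// powRD; last first.
  by rewrite (gt_eqF ks0) implybT.
rewrite powRr1 ?ltW//; congr EFin.
set w := _ `^ _; have := k2pi_gt0; set q := k2pi => q0.
by field; rewrite !gt_eqF.
Qed.

End gaussian_integrals.

(** * Shattering and the Sauer-Shelah bound *)

Section shattering.
Local Open Scope set_scope.
Variable T : finType.
Implicit Types (F : {set {set T}}) (S A B : {set T}).

Definition shatters F S :=
  [forall (A : {set T} | A \subset S), exists B in F, B :&: S == A].

Lemma shattersP F S : reflect
  (forall A, A \subset S -> exists2 B, B \in F & B :&: S = A) (shatters F S).
Proof.
apply: (iffP forall_inP) => [FS A /FS/exists_inP[B BF /eqP]|FS A /FS[B BF BS]].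
  by exists B.
by apply/exists_inP; exists B => //; apply/eqP.
Qed.

Lemma shattersS F F' S : F \subset F' -> shatters F S -> shatters F' S.
Proof.
move=> FF' /shattersP FS; apply/shattersP => A /FS[B BF BS].
by exists B => //; exact: (fintype.subsetP FF').
Qed.

(* Pajor's strengthening of the Sauer-Shelah lemma. *)
Lemma card_le_shattered F : (#|F| <= #|[set S | shatters F S]|)%N.
Proof.
have [n] := ubnP #|F|; elim: n F => // n IH F; rewrite ltnS => Fn.
have [F1|] := leqP #|F| 1.
  have [->|[B0 B0F]] := finset.set_0Vmem F; first by rewrite cards0.
  apply: leq_trans F1 _; rewrite card_gt0; apply/set0Pn; exists finset.set0.
  rewrite inE; apply/shattersP => A; rewrite finset.subset0 => /eqP ->.
  by exists B0 => //; rewrite finset.setI0.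
move=> /card_gt1P[B1 [B2 [B1F B2F B12]]].
(* An element on which two members differ splits [F] into two strictly smaller halves. *)
have [x xB] : exists x, (x \in B1) != (x \in B2).
  apply/existsP; apply: contraNT B12; rewrite negb_exists => /forallP e.
  by apply/eqP/finset.setP => x; have := e x; rewrite negbK => /eqP.
pose G b := [set B in F | (x \in B) == b].
have GF b : G b \subset F by apply/fintype.subsetP => B; rewrite inE => /andP[].
have Glt b : (#|G b| < #|F|)%N.
  apply: proper_card; rewrite fintype.properE GF/=; apply/subsetPn.
  case: b; case: (boolP (x \in B1)) xB; case: (boolP (x \in B2)) => // x2 x1 _.
  - by exists B2 => //; rewrite inE B2F (negPf x2).
  - by exists B1 => //; rewrite inE B1F (negPf x1).
  - by exists B1 => //; rewrite inE B1F x1.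
  - by exists B2 => //; rewrite inE B2F x2.
have FE : #|F| = (#|G true| + #|G false|)%N.
  rewrite -(cardsID [set B : {set T} | x \in B] F); congr (_ + _)%N; apply: eq_card => B.
    by rewrite !inE eqb_id.
  by rewrite !inE eqbF_neg andbC.
pose sh b := [set S | shatters (G b) S].
(* A set containing [x] cannot be shattered by a half, in which membership of [x] is constant. *)
have xS b S : S \in sh b -> x \notin S.
  rewrite inE => /shattersP GS; apply/negP => xS.
  have bS : (if b then finset.set0 else S) \subset S.
    by case: b {GS} => //; exact: finset.sub0set.
  have [B] := GS _ bS; rewrite inE => /andP[_ /eqP xB'] /finset.setP/(_ x).
  by case: b {GS bS} xB' => xB'; rewrite !inE xB' xS.
have shF b : sh b \subset [set S | shatters F S].
  by apply/fintype.subsetP => S; rewrite !inE; exact: shattersS.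
(* Sets shattered by both halves would be counted once only; adding [x] to them gives new sets
   shattered by [F], one for each. *)
pose ext := [set x |: S | S in sh true :&: sh false].
have extF : ext \subset [set S | shatters F S].
  apply/fintype.subsetP => _ /imsetP[S + ->].
  rewrite finset.in_setI => /andP[S1 S0].
  have xS' := xS _ _ S1; rewrite !inE in S1 S0 *.
  apply/shattersP => A AS.
  have [] : exists2 B, B \in G (x \in A) & B :&: S = A :\ x.
    have AxS : A :\ x \subset S by rewrite subDset.
    by case: (x \in A); [exact: (shattersP _ _ S1)|exact: (shattersP _ _ S0)].
  move=> B; rewrite inE => /andP[BF /eqP BA] /finset.setP BS; exists B => //.
  apply/finset.setP => y; have := BS y; rewrite !inE.
  have [->|yx /=] := eqVneq y x; first by rewrite andbT BA.
  by [].
have disj : (sh true :|: sh false) :&: ext = finset.set0.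
  apply/finset.setP => S; rewrite finset.in_set0; apply/negP.
  rewrite finset.in_setI => /andP[+ /imsetP[S' _ SE]].
  by rewrite finset.in_setU => /orP[] /xS; rewrite SE setU11.
have extE : #|ext| = #|sh true :&: sh false|.
  rewrite card_in_imset// => S S'; rewrite !finset.in_setI => /andP[S1 _] /andP[S'1 _] SS'.
  by rewrite -(setU1K (xS _ _ S1)) SS' (setU1K (xS _ _ S'1)).
rewrite FE (leq_trans (leq_add (IH (G true) _) (IH (G false) _)))//.
- exact: leq_trans (Glt _) Fn.
- exact: leq_trans (Glt _) Fn.
rewrite -cardsUI -extE -cardsUI disj cards0 addn0 subset_leq_card//.
by rewrite !finset.subUset !shF.
Qed.

(** A set of at most [d] elements is listed in [d] slots, the empty ones filled with [None]; the
    successor in the bound counts [None]. *)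
Lemma card_small_sets d :
  (#|[set S : {set T} | (#|S| <= d)%N]| <= #|T|.+1 ^ d)%N.
Proof.
pose f (h : {ffun 'I_d -> option T}) := [set y | Some y \in codom h].
have : [set S : {set T} | (#|S| <= d)%N] \subset f @: [set: {ffun 'I_d -> option T}].
  apply/fintype.subsetP => S; rewrite inE => Sd; apply/imsetP.
  exists [ffun i : 'I_d => nth None [seq Some y | y <- enum S] i] => //.
  apply/finset.setP => y; rewrite inE; apply/idP/codomP => [yS|[i]].
    have yd : (index y (enum S) < d)%N.
      by apply: leq_trans Sd; rewrite cardE index_mem mem_enum.
    exists (Ordinal yd); rewrite ffunE/= (nth_map y) ?nth_index ?mem_enum//.
    by rewrite index_mem mem_enum.
  rewrite ffunE; have [iS|Si] := ltnP i (size (enum S)).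
    by rewrite (nth_map y)// => -[->]; rewrite -mem_enum mem_nth.
  by rewrite nth_default// size_map.
move=> /subset_leq_card/leq_trans; apply.
by rewrite (leq_trans (leq_imset_card _ _))// cardsT card_ffun card_option card_ord.
Qed.

End shattering.

(** * Patterns cut out by affine functionals *)

Section affine_patterns.
Local Open Scope set_scope.
Context {R : realType} (k : nat) (I : finType) (t : I -> 'rV[R]_k) (c : I -> R).

Definition affine_pattern (b : 'rV[R]_k) : {set I} :=
  [set i | c i <= (t i *m b^T) ord0 ord0].

Definition affine_patterns : {set {set I}} :=
  [set S | `[< exists b, affine_pattern b = S >]].

(* An affine dependency among the [(t i, c i)], [i \in S], forbids the pattern
   picking out its positive coefficients. *)
Lemma card_shattered_affine S : shatters affine_patterns S -> (#|S| <= k.+1)%N.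
Proof.
move=> /shattersP shS; rewrite leqNgt; apply/negP => Sk.
(* More than [k + 1] rows in dimension [k + 1] are linearly dependent. *)
pose M : 'M[R]_(#|S|, k + 1) :=
  \matrix_i row_mx (t (enum_val i)) (c (enum_val i))%:M.
have : kermx M != 0.
  rewrite kermx_eq0 /row_free; apply: contraTneq Sk => rM.
  by rewrite -leqNgt -rM -(addn1 k) rank_leq_col.
case/rowV0Pn => v0 /sub_kermxP v0M v00.
(* A change of sign provides a negative coefficient, which yields the strictly positive term of the
   final sum. *)
have [v vM [i0 vi0]] : exists2 v : 'rV_#|S|, v *m M = 0 & exists i, v ord0 i < 0.
  have [i vi] : exists i, v0 ord0 i != 0.
    apply/existsP; apply: contraNT v00; rewrite negb_exists => /forallP v00.
    by apply/eqP/rowP => i; rewrite mxE; have := v00 i; rewrite negbK => /eqP.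
  have [v0i|v0i|v0i] := ltgtP (v0 ord0 i) 0; last by rewrite v0i eqxx in vi.
    by exists v0 => //; exists i.
  by exists (- v0); [rewrite mulNmx v0M oppr0|exists i; rewrite mxE oppr_lt0].
pose A := [set enum_val i | i : 'I_#|S| & 0 < v ord0 i].
have [|B] := shS A.
  by apply/fintype.subsetP => _ /imsetP[i _ ->]; exact: enum_valP.
rewrite inE => /asboolP[b <-] bA.
pose u (i : 'I_#|S|) := (t (enum_val i) *m b^T) ord0 ord0 - c (enum_val i) : R.
have uA (i : 'I_#|S|) : (0 <= u i) = (0 < v ord0 i).
  rewrite subr_ge0; have /finset.setP/(_ (enum_val i)) := bA.
  rewrite !inE enum_valP andbT => ->; apply/imsetP/idP => [[j + /enum_val_inj ->]|vi].
    by rewrite inE.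
  by exists i => //; rewrite inE.
(* The dependency makes the sum vanish, whereas [uA] makes every term nonnegative and the one at
   [i0] positive. *)
have : \sum_i v ord0 i * u i = 0.
  have E : (v *m M *m col_mx b^T (-1)%:M) ord0 ord0 = 0 by rewrite vM mul0mx mxE.
  rewrite -mulmxA mxE in E; rewrite -[RHS]E; apply: eq_bigr => i _.
  congr (_ * _).
  rewrite (_ : (M *m _) i ord0 = (row i M *m col_mx b^T (-1)%:M) ord0 ord0); last first.
    by rewrite -row_mul [RHS]mxE.
  rewrite rowK mul_row_col mul_scalar_mx [RHS]mxE; congr (_ + _).
  by rewrite !mxE mulr1n mulrN1.
rewrite (bigD1 i0)//=; apply/eqP; rewrite gt_eqF// ltr_wpDr//.
  apply: sumr_ge0 => i _; have := uA i; case: (ltP 0 (v ord0 i)) => vi.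
    by move=> ui; rewrite mulr_ge0// ltW.
  by move/negbT; rewrite -ltNge => ui; rewrite mulr_le0// ltW.
have := uA i0; rewrite ltNge (ltW vi0)/= => /negbT; rewrite -ltNge => ui.
by rewrite nmulr_rgt0.
Qed.

Lemma card_affine_patterns : (#|affine_patterns| <= #|I|.+1 ^ k.+1)%N.
Proof.
apply: leq_trans (card_le_shattered _) _.
apply: leq_trans (card_small_sets I k.+1); apply: subset_leq_card.
by apply/fintype.subsetP => S; rewrite !inE; exact: card_shattered_affine.
Qed.

End affine_patterns.

(* Compactifying the line by a mesh of [-L, L] makes [b |-> (t i *m b^T)_(i < n)]
   totally bounded at a polynomial cost in [n], for arbitrarily large [b]. *)
Lemma polynomial_net {R : realType} (k : nat) (t : nat -> 'rV[R]_k) (L mesh : R) :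
    0 < mesh ->
  exists J : nat, forall n : nat, exists2 B : seq 'rV[R]_k,
    (size B <= (n * J).+1 ^ k.+1)%N &
    forall b : 'rV[R]_k, exists2 b', b' \in B & forall i : 'I_n,
      let x := (t i *m b^T) ord0 ord0 in let y := (t i *m b'^T) ord0 ord0 in
      `|x - y| <= mesh \/ (L <= `|x| /\ L <= `|y|).
Proof.
move=> mesh0.
have [J JL] : exists J : nat, L < - L + J%:R * mesh.
  exists (Num.truncn ((L + L) / mesh)).+1.
  by rewrite -ltrBlDl opprK -ltr_pdivrMr// truncnS_gt.
exists J.+1 => n.
(* One functional per observation and threshold: a pattern records which thresholds lie below each
   linear predictor. *)
pose t' (ij : 'I_n * 'I_J.+1) := t ij.1.
pose c (ij : 'I_n * 'I_J.+1) := - L + (ij.2 : nat)%:R * mesh.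
pose F := affine_patterns t' c.
pose rep (S : {set 'I_n * 'I_J.+1}) : 'rV[R]_k :=
  if pselect (exists b, affine_pattern t' c b = S) is left e then sval (cid e) else 0.
exists (map rep (enum F)).
  rewrite size_map -cardE (leq_trans (card_affine_patterns _ _))//.
  by rewrite card_prod !card_ord.
move=> b; exists (rep (affine_pattern t' c b)).
  by apply: map_f; rewrite mem_enum inE; apply/asboolP; exists b.
move=> i; rewrite /rep; case: pselect => [e|]; last by case; exists b.
case: (cid e) => b' /= bb'.
set x := (t i *m b^T) ord0 ord0; set y := (t i *m b'^T) ord0 ord0.
have xy (j : nat) : (j < J.+1)%N -> (- L + j%:R * mesh <= x) = (- L + j%:R * mesh <= y).
  by move=> jJ; have /finset.setP/(_ (i, Ordinal jJ)) := bb'; rewrite !inE.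
(* Numbers that lie above the same thresholds are in one cell of the mesh, or both beyond [L], or
   both below [- L]. *)
have main (u v : R) : (forall j : nat, (j < J.+1)%N ->
    (- L + j%:R * mesh <= u) = (- L + j%:R * mesh <= v)) -> u <= v ->
    mesh < v - u -> L <= `|u| /\ L <= `|v|.
  move=> uvj uv uvm.
  have [uL|uL] := leP L u.
    by rewrite !(le_trans _ (ler_norm _))// (le_trans uL).
  have exj : exists j : nat, u < - L + j%:R * mesh by exists J; exact: lt_trans JL.
  case: (ex_minnP exj) => -[|j] uj jmin.
    rewrite mul0r addr0 in uj.
    have := uvj 0 (ltn0Sn _); rewrite mul0r addr0 leNgt uj/= => /esym/negbT.
    rewrite -ltNge => vL; have := ler_norm (- u); have := ler_norm (- v).
    by rewrite !normrN; split; lra.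
  have jJ : (j < J)%N by apply: jmin; exact: lt_trans JL.
  have := uvj j.+1 jJ; rewrite leNgt uj/= => /esym/negbT; rewrite -ltNge => vj.
  have : ~~ (u < - L + j%:R * mesh) by apply/negP => /jmin; rewrite ltnn.
  rewrite -leNgt => ju; exfalso; move: vj uvm; rewrite -natr1 mulrDl mul1r.
  by move: ju; set w := _%:R * _; lra.
have [xym|xym] := leP `|x - y| mesh; [by left|right].
have [le_xy|lt_yx] := leP x y.
  by apply: main => //; rewrite distrC ger0_norm ?subr_ge0// in xym.
have [| | |Ly Lx] := main y x; last by split.
- by move=> j jJ; rewrite xy.
- exact: ltW.
- by rewrite gtr0_norm ?subr_gt0// in xym.
Qed.

Lemma measure_bigsetU_le {R : realType} d (T : measurableType d)
    (m : {measure set T -> \bar R}) (I : eqType) (s : seq I) (A : I -> set T) (u : R) :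
    (forall i, measurable (A i)) -> (forall i, i \in s -> (m (A i) <= u%:E)%E) ->
  (m (\big[setU/set0]_(i <- s) A i) <= ((size s)%:R * u)%:E)%E.
Proof.
move=> mA; elim: s => [|i s IH] Au; first by rewrite big_nil measure0 mul0r.
rewrite big_cons (le_trans (measureU2 _ _ _))//; first exact: bigsetU_measurable.
rewrite /= -natr1 mulrDl mul1r EFinD addeC leeD ?Au ?mem_head//.
by apply: IH => j js; apply: Au; rewrite inE js orbT.
Qed.

(** Compare with the geometric bound [1 / (1 - x)]; for [x <= 1 / 2] its remainder after the linear
    term is at most [2 x^2]. *)
Lemma expR_le_quad {R : realType} (x : R) : x <= 1 / 2 -> expR x <= 1 + x + 2 * x ^+ 2.
Proof.
move=> x2; have x1 : 0 < 1 - x by lra.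
have : expR x <= (1 - x)^-1.
  rewrite -[x]opprK expRN lef_pV2 ?posrE ?expR_gt0//; last by lra.
  by have := expR_ge1Dx (- x); rewrite opprK.
move/le_trans; apply; rewrite -div1r ler_pdivrMr//.
suff : 0 <= x ^+ 2 * (1 - 2 * x) by lra.
by rewrite mulr_ge0 ?sqr_ge0//; lra.
Qed.

Lemma cvg_expR_mulrn {R : realType} (r : R) : 0 < r ->
  expR (- (n%:R * r)) @[n --> \oo] --> 0.
Proof.
move=> r0; under eq_fun do rewrite -mulrN expRM_natl.
by apply: cvg_expr; rewrite ger0_norm ?expR_ge0// expR_lt1 oppr_lt0.
Qed.

(** Half of the rate beats the polynomial: the Taylor term of order [K + 1] of an exponential
    dominates the [K]-th power. *)
Lemma cvg_poly_expR {R : realType} (J K : nat) (r : R) : 0 < r ->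
  ((n * J).+1 ^ K)%:R * expR (- (n%:R * r)) @[n --> \oo] --> 0.
Proof.
(* Chosen so that [a (n J + 1)] is at most [n r / 2 + a]; the denominator [J.+1] is nonzero also for
   [J = 0]. *)
move=> r0; pose a : R := r / 2 / J.+1%:R.
have a0 : 0 < a by rewrite !divr_gt0.
pose C : R := K.+1`!%:R / a ^+ K.+1 * expR a.
apply: (@squeeze_cvgr _ _ _ _ (cst 0) (fun n => C * expR (- (n%:R * (r / 2))))).
- apply: nearW => n; rewrite mulr_ge0 ?expR_ge0//=.
  have -> : expR (- (n%:R * r)) = expR (- (n%:R * (r / 2))) * expR (- (n%:R * (r / 2))).
    by rewrite -expRD; congr expR; field.
  rewrite mulrA ler_wpM2r ?expR_ge0//.
  pose x : R := (n * J).+1%:R; have x1 : 1 <= x by rewrite ler1n.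
  have h : 1 + (a * x) ^+ K.+1 / K.+1`!%:R <= expR (a * x).
    by apply: expR_ge1Dxn; rewrite mulr_ge0// ltW.
  have : x ^+ K.+1 <= K.+1`!%:R / a ^+ K.+1 * expR (a * x).
    rewrite mulrAC ler_pdivlMr ?exprn_gt0// mulrC -ler_pdivrMl ?ltr0n ?fact_gt0//.
    by rewrite -exprMn mulrC (le_trans _ h)// lerDr.
  rewrite natrX -/x => xK.
  have xKK : x ^+ K <= x ^+ K.+1 by rewrite ler_weXn2l.
  apply: le_trans (ler_wpM2r (expR_ge0 _) (le_trans xKK xK)) _.
  rewrite /C; set D := _ / a ^+ _; rewrite -(mulrA D) ler_wpM2l//.
    by rewrite divr_ge0// exprn_ge0// ltW.
  rewrite -expRD ler_expR /x -natr1 mulrDr mulr1 natrM.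
  suff : a * (n%:R * J%:R) <= n%:R * (r / 2) by lra.
  rewrite mulrCA ler_wpM2l// /a mulrAC ler_pdivrMr// ler_wpM2l ?ler_nat//.
  by rewrite divr_ge0// ltW.
- exact: cvg_cst.
- rewrite -[X in _ --> X](mulr0 C); apply: cvgM; first exact: cvg_cst.
  by apply: cvg_expR_mulrn; rewrite divr_gt0.
Qed.

(** * Events of probability tending to one *)

Section with_high_probability.
Context {R : realType} d (T : measurableType d) (P : probability T R).
Implicit Types Q : nat -> set T.

(* Exceptional sets avoid any measurability requirement on the events [Q n]. *)
Definition whp Q := exists B : nat -> set T,
  [/\ forall n, measurable (B n),
      (\forall n \near \oo, forall w, ~ B n w -> Q n w) &
      P (B n) @[n --> \oo] --> 0%E].

Lemma whp_bound Q (B : nat -> set T) (u : nat -> R) :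
    (forall n, measurable (B n)) -> (forall n w, ~ B n w -> Q n w) ->
    (forall n, (P (B n) <= (u n)%:E)%E) -> u n @[n --> \oo] --> 0 -> whp Q.
Proof.
move=> mB BQ Bu u0; exists B; split => //; first by apply: nearW => n; exact: BQ.
apply: (@squeeze_cvge _ _ _ _ (cst 0%E) _ (EFin \o u)).
- by apply: nearW => n; rewrite measure_ge0 Bu.
- exact: cvg_cst.
- by apply: cvg_EFin => //; exact: nearW.
Qed.

Lemma whpS Q Q' : (\forall n \near \oo, forall w, Q n w -> Q' n w) -> whp Q -> whp Q'.
Proof.
move=> QQ' [B [mB BQ B0]]; exists B; split => //.
by apply: filterS2 BQ QQ' => n BQn QQn w /BQn; exact: QQn.
Qed.

Lemma whpI Q Q' : whp Q -> whp Q' -> whp (fun n => Q n `&` Q' n).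
Proof.
move=> [B [mB BQ B0]] [B' [mB' BQ' B0']]; exists (fun n => B n `|` B' n); split.
- by move=> n; exact: measurableU.
- apply: filterS2 BQ BQ' => n BQn BQn' w /not_orP[Bw B'w].
  by split; [exact: BQn|exact: BQn'].
- apply: (@squeeze_cvge _ _ _ _ (cst 0%E) _ (fun n => P (B n) + P (B' n))%E).
  + by apply: nearW => n; rewrite measure_ge0 measureU2.
  + exact: cvg_cst.
  + by rewrite -[X in _ --> X](adde0 0%E); apply: cvgeD.
Qed.

Lemma whpT Q : (forall n w, Q n w) -> whp Q.
Proof.
move=> QT; apply: (@whp_bound _ (fun=> set0) (cst 0)) => //.
- by move=> n; rewrite measure0.
- exact: cvg_cst.
Qed.

Lemma whp_forall (I : finType) (Q : I -> nat -> set T) :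
  (forall i, whp (Q i)) -> whp (fun n w => forall i, Q i n w).
Proof.
move=> wQ; suff : whp (fun n w => forall i, i \in enum I -> Q i n w).
  by apply: whpS; apply: nearW => n w Qw i; apply: Qw; rewrite mem_enum.
elim: (enum I) => [|i s IH]; first exact: whpT.
apply: whpS (whpI (wQ i) IH); apply: nearW => n w [Qi Qs] j.
by rewrite inE => /predU1P[->//|]; exact: Qs.
Qed.

Lemma whp_cvg1 (V : nat -> set T) :
  (forall n, measurable (V n)) -> whp V -> P (V n) @[n --> \oo] --> 1%E.
Proof.
move=> mV [B [mB BV B0]].
apply: (@squeeze_cvge _ _ _ _ (fun n => 1 - P (B n))%E _ (cst 1%E)).
- apply: filterS BV => n BVn; rewrite probability_le1// andbT -probability_setC//.
  by apply: le_measure; rewrite ?inE//; exact: measurableC.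
- rewrite -[X in _ --> X]sube0; apply: cvgeB => //; exact: cvg_cst.
- exact: cvg_cst.
Qed.

End with_high_probability.

Lemma sum_ord_const {R : realType} (n : nat) (c : R) : \sum_(i < n) c = n%:R * c.
Proof. by rewrite sumr_const card_ord mulr_natl. Qed.

Lemma integral_probability_cst {R : realType} d (T : measurableType d)
    (P : probability T R) (c : R) : (\int[P]_w c%:E = c%:E)%E.
Proof.
by rewrite integral_cst// -[RHS]mule1; congr (_ * _)%E; exact: probability_setT.
Qed.

(** * Chernoff bound for bounded variables *)

Section chernoff_bounds.
Context {R : realType} d (T : measurableType d) (P : probability T R).
Variable X : nat -> {RV P >-> R}.
Hypothesis indX : mutually_independent X.

Lemma chernoff_bounded n (y : nat -> R -> R) (c : nat -> R) (eta : R) :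
    0 < eta <= 1 -> (forall i, measurable_fun setT (y i)) ->
    (forall i x, 0 <= y i x <= 1) ->
    (forall i, (\int[P]_w (y i (X i w))%:E = (c i)%:E)%E) ->
  (P [set w | \sum_(i < n) c i + n%:R * eta <= \sum_(i < n) y i (X i w)]%R
    <= (expR (- (n%:R * (eta ^+ 2 / 8))))%:E)%E.
Proof.
move=> /andP[eta0 eta1] my y01 yc.
(* This tilt minimises the exponent [2 l^2 - l eta], with value [- eta^2 / 8]; it is small enough
   for [expR_le_quad]. *)
pose l := eta / 4; have l0 : 0 < l by rewrite divr_gt0.
have l4 : l <= 1 / 4 by rewrite ler_pM2r.
have c01 i : 0 <= c i <= 1.
  rewrite -!lee_fin -yc; apply/andP; split.
    by apply: integral_ge0 => w _; rewrite lee_fin; case/andP: (y01 i (X i w)).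
  rewrite -(integral_probability_cst P 1).
  apply: ge0_le_integral => //.
  - by move=> w _; rewrite lee_fin; case/andP: (y01 i (X i w)).
  - by apply/measurable_EFinP; exact: measurableT_comp.
  - by move=> w _; rewrite lee_fin; case/andP: (y01 i (X i w)).
pose z i x := l * (y i x - c i - eta).
have mz i : measurable_fun setT (z i).
  by apply: measurable_funM => //; apply: measurable_funB => //; exact: measurable_funB.
have zr i : (\int[P]_w (expR (z i (X i w)))%:E <= (expR (- (eta ^+ 2 / 8)))%:E)%E.
  pose a := expR (- (l * eta)).
  pose A := a * (1 + 2 * l ^+ 2 - l * c i); pose B := a * l.
  have a0 : 0 < a by exact: expR_gt0.
  have B0 : 0 <= B by rewrite mulr_ge0 ?(ltW a0) ?(ltW l0).
  have A0 : 0 <= A.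
    rewrite mulr_ge0 ?(ltW a0)//; have := sqr_ge0 l; have /andP[ci0 ci1] := c01 i.
    have : l * c i <= l * 1 by rewrite ler_wpM2l ?(ltW l0).
    by lra.
  (* The exponential is bounded by an affine function of [y], whose integral is known from [yc]. *)
  apply: (@le_trans _ _ (\int[P]_w (A%:E + B%:E * (y i (X i w))%:E))%E).
    apply: ge0_le_integral => //.
    - apply/measurable_EFinP; have mez : measurable_fun setT (fun x => expR (z i x)).
        exact: measurableT_comp.
      exact: (measurableT_comp mez).
    - apply: emeasurable_funD => //; apply: measurable_funeM.
      by apply/measurable_EFinP; exact: measurableT_comp.
    - move=> w _; rewrite -EFinM -EFinD lee_fin.
      rewrite (_ : z i _ = - (l * eta) + l * (y i (X i w) - c i)); last by rewrite /z; ring.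
      rewrite expRD -/a (_ : A + _ = a * (1 + l * (y i (X i w) - c i) + 2 * l ^+ 2)); last first.
        by rewrite /A /B; ring.
      rewrite ler_wpM2l ?(ltW a0)//.
      have /andP[y0 y1] := y01 i (X i w); have /andP[c0 c1] := c01 i.
      set u := y i (X i w) in y0 y1 *.
      have u2 : (u - c i) ^+ 2 <= 1.
        have : 0 <= (1 - (u - c i)) * (1 + (u - c i)) by rewrite mulr_ge0//; lra.
        by lra.
      apply: (le_trans (expR_le_quad _)).
        have : l * (u - c i) <= l * 1 by rewrite ler_wpM2l ?(ltW l0)//; lra.
        by lra.
      rewrite exprMn; have : l ^+ 2 * (u - c i) ^+ 2 <= l ^+ 2 * 1 by rewrite ler_wpM2l ?sqr_ge0.
      by lra.
  rewrite ge0_integralD//; last 2 first.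
  - by move=> w _; rewrite -EFinM lee_fin mulr_ge0//; case/andP: (y01 i (X i w)).
  - apply: measurable_funeM; apply/measurable_EFinP; exact: measurableT_comp.
  rewrite integral_probability_cst ge0_integralZl//; last 2 first.
  - by apply/measurable_EFinP; exact: measurableT_comp.
  - by move=> w _; rewrite lee_fin; case/andP: (y01 i (X i w)).
  rewrite yc -EFinM -EFinD lee_fin.
  rewrite (_ : A + B * c i = a * (1 + 2 * l ^+ 2)); last by rewrite /A /B; ring.
  apply: (@le_trans _ _ (a * expR (2 * l ^+ 2))).
    by rewrite ler_wpM2l ?(ltW a0)// expR_ge1Dx.
  by rewrite /a -expRD ler_expR /l; lra.
apply: le_trans (chernoff_sum indX n mz zr).
rewrite le_eqVlt; apply/orP; left; apply/eqP; congr (P _).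
apply/seteqP; split => w /=; rewrite /z -mulr_sumr pmulr_rge0//;
  rewrite !sumrB sumr_const card_ord -mulr_natl; lra.
Qed.

End chernoff_bounds.

(** * Uniform law of large numbers over all coefficients *)

Section uniform_lln.
Context {R : realType} d (T : measurableType d) (P : probability T R).
Variables (X : nat -> {RV P >-> R}) (k : nat) (t : nat -> 'rV[R]_k).
Variables (m : nat -> R) (h Psi : R -> R).
Hypothesis indX : mutually_independent X.
Hypothesis mh : measurable_fun setT h.
Hypothesis h01 : forall x, 0 <= h x <= 1.
Hypothesis h_unif : forall eta : R, 0 < eta ->
  exists2 mesh : R, 0 < mesh & forall x y, `|x - y| <= mesh -> h x <= h y + eta.
Hypothesis h_infty : forall eta : R, 0 < eta ->
  exists K : R, forall x, K <= `|x| -> h x <= eta.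
Hypothesis tight : forall eta : R, 0 < eta ->
  exists K : R, forall i, (P [set w | K <= `|X i w - m i|]%R <= eta%:E)%E.
Hypothesis hPsi : forall i u, (\int[P]_w (h (X i w - m i - u))%:E = (Psi u)%:E)%E.

Local Notation lin i b := ((t i *m b^T) ord0 ord0).

Let mhX i u : measurable_fun setT (fun w => h (X i w - m i - u)).
Proof.
apply: measurableT_comp => //; apply: measurable_funB => //.
exact: measurable_funB.
Qed.

(** The net is polynomial in size, while each representative fails with exponentially small
    probability. For shifts beyond the cut-off [h] is negligible unless the error is large, and
    large errors are counted separately. *)
Lemma uniform_lln (eta : R) : 0 < eta ->
  whp P (fun n w => forall b : 'rV[R]_k,
    \sum_(i < n) h (X i w - m i - lin i b) <= \sum_(i < n) Psi (lin i b) + n%:R * eta).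
Proof.
wlog eta1 : eta / eta <= 1.
  move=> H eta0; have [eta1|eta1] := leP eta 1; first exact: H.
  apply: whpS (H 1 (lexx _) ltr01); apply: nearW => n w Hw b.
  by apply: le_trans (Hw b) _; rewrite lerD2l ler_wpM2l// ltW.
(* The losses add up to [6 e] per observation: one [e] for the cell, two for the tail indicators,
   one for the representative and two for [Psi]. *)
move=> eta0; pose e := eta / 8.
have e0 : 0 < e by rewrite divr_gt0.
have [mesh mesh0 hmesh] := h_unif e0.
have [K1 hK1] := h_infty e0.
have [K2 hK2] := tight e0.
(* If the error is below [K2] in absolute value and the shift beyond [L], their difference exceeds
   [K1]. *)
pose L := Num.max K1 0 + Num.max K2 0 + 1.
have [J net] := polynomial_net t L mesh0.
pose tailp i := fine (P [set w | K2 <= `|X i w - m i|]).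
pose tl i x : R := \1_[set x | K2 <= `|x - m i|] x.
have mset i : measurable [set x | K2 <= `|x - m i|].
  rewrite (_ : [set _ | _] = setT `&` (fun x => `|x - m i|) @^-1` `[K2, +oo[).
    by apply: (_ : measurable_fun setT _) => //; apply: measurableT_comp => //; exact: measurable_funB.
  by apply/seteqP; split=> w /=; rewrite in_itv/= andbT // => -[].
have mtl i : measurable_fun setT (tl i) by exact: measurable_indic.
have mXset i : measurable (X i @^-1` [set x | K2 <= `|x - m i|]).
  by rewrite -[X in measurable X]setTI; apply: measurable_funP => //; exact: mset.
have Etl i : (\int[P]_w (tl i (X i w))%:E = (tailp i)%:E)%E.
  rewrite -[LHS]/(\int[P]_w (\1_(X i @^-1` [set x | K2 <= `|x - m i|]) w)%:E)%E.
  rewrite integral_indic ?setIT ?fineK ?fin_num_measure//; exact: mXset.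
have tailpe i : tailp i <= e.
  by rewrite -lee_fin fineK ?fin_num_measure//; exact: mXset.
have cell (x u v : R) : (`|u - v| <= mesh \/ (L <= `|u| /\ L <= `|v|)) ->
    h (x - u) <= h (x - v) + e + (K2 <= `|x|)%R%:R.
  case=> [uv|[Lu Lv]].
    have := hmesh (x - u) (x - v).
    rewrite (_ : x - u - (x - v) = v - u); last by ring.
    rewrite distrC => /(_ uv) huv; apply: le_trans huv _.
    by rewrite lerDl.
  have /andP[hv0 _] := h01 (x - v).
  have [K2x|xK2] := leP K2 `|x|.
    by have /andP[_] := h01 (x - u); move: e0; rewrite mulr1n; lra.
  suff : h (x - u) <= e by rewrite mulr0n; lra.
  apply: hK1; have := lerB_dist u x; rewrite distrC.
  have : K1 <= Num.max K1 0 by rewrite le_max lexx.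
  have : K2 <= Num.max K2 0 by rewrite le_max lexx.
  by move: Lu; rewrite /L; lra.
(* The limit [Psi] inherits the comparison by integration at any observation [i], on which it does
   not depend. *)
have cellP (i : nat) (u v : R) : (`|u - v| <= mesh \/ (L <= `|u| /\ L <= `|v|)) ->
    Psi u <= Psi v + 2 * e.
  move=> uv; apply: (@le_trans _ _ (Psi v + e + tailp i)); last by have := tailpe i; lra.
  rewrite -lee_fin -(hPsi i) EFinD EFinD -(hPsi i v) -Etl.
  rewrite -(integral_probability_cst P e).
  have mE z : measurable_fun setT (fun w => (h (X i w - m i - z))%:E).
    by apply/measurable_EFinP; exact: mhX.
  have hE z w : (0 <= (h (X i w - m i - z))%:E)%E.
    by rewrite lee_fin; case/andP: (h01 (X i w - m i - z)).
  have mt : measurable_fun setT (fun w => (tl i (X i w))%:E).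
    by apply/measurable_EFinP; exact: (measurableT_comp (mtl i)).
  have eE : (0 <= e%:E)%E by rewrite lee_fin ltW.
  have heE w : (0 <= (h (X i w - m i - v))%:E + e%:E)%E by rewrite adde_ge0.
  have mheE : measurable_fun setT (fun w => (h (X i w - m i - v))%:E + e%:E)%E.
    exact: emeasurable_funD.
  have -> : (\int[P]_w (h (X i w - m i - v))%:E + \int[P]_w e%:E =
      \int[P]_w ((h (X i w - m i - v))%:E + e%:E))%E by rewrite ge0_integralD.
  rewrite -ge0_integralD//; first apply: ge0_le_integral => //.
  - exact: emeasurable_funD.
  - move=> w _; rewrite -!EFinD lee_fin; apply: le_trans (cell _ _ _ uv) _.
    rewrite lerD2l /tl indicE; case: (leP K2 _) => // K2x; by rewrite mem_set.
  by move=> w _; rewrite lee_fin.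
have {}net n : exists B : seq 'rV[R]_k, (size B <= (n * J).+1 ^ k.+1)%N /\
    forall b : 'rV[R]_k, exists2 b', b' \in B & forall i : 'I_n,
      `|lin i b - lin i b'| <= mesh \/ (L <= `|lin i b| /\ L <= `|lin i b'|).
  by have [B sB bB] := net n; exists B; split => // b; exact: bB.
have /choice[B {net}Bnet] := net.
pose u n := expR (- (n%:R * (e ^+ 2 / 8))) : R.
(* [bad1] concerns the large errors and does not involve [b]; [bad2] is needed for the
   representatives only. *)
pose bad1 n : set T := [set w | \sum_(i < n) tailp i + n%:R * e <= \sum_(i < n) tl i (X i w)].
pose bad2 n (b : 'rV[R]_k) : set T := [set w | \sum_(i < n) Psi (lin i b) + n%:R * e <=
  \sum_(i < n) h (X i w - m i - lin i b)].
have mle (f : T -> R) (c : R) : measurable_fun setT f -> measurable [set w | c <= f w].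
  move=> mf; rewrite (_ : [set _ | _] = setT `&` f @^-1` `[c, +oo[); first exact: mf.
  by apply/seteqP; split=> w /=; rewrite in_itv/= andbT // => -[].
have mbad1 n : measurable (bad1 n).
  by apply: mle; apply: measurable_sum => i; exact: (measurableT_comp (mtl i)).
have mbad2 n (b : 'rV[R]_k) : measurable (bad2 n b).
  by apply: mle; apply: measurable_sum => i; exact: mhX.
have e1 : 0 < e <= 1 by rewrite e0/= /e; lra.
have Pbad1 n : (P (bad1 n) <= (u n)%:E)%E.
  apply: (chernoff_bounded indX n e1 _ _ Etl) => //.
  by move=> i x; rewrite /tl indicE; case: (_ \in _); rewrite ?ler01 ?lexx.
have Pbad2 n (b : 'rV[R]_k) : (P (bad2 n b) <= (u n)%:E)%E.
  apply: (chernoff_bounded indX n e1 (y := fun i x => h (x - m i - lin i b))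
    (c := fun i => Psi (lin i b))) => // i.
  by apply: measurableT_comp => //; apply: measurable_funB => //; exact: measurable_funB.
apply: (@whp_bound _ _ _ _ _ (fun n => bad1 n `|` \big[setU/set0]_(b <- B n) bad2 n b)
    (fun n => u n + ((n * J).+1 ^ k.+1)%:R * u n)).
- by move=> n; apply: measurableU => //; exact: bigsetU_measurable.
- move=> n w /not_orP[/negP nb1 nb2] b.
  have [_ /(_ b)[b' b'B bb']] := Bnet n.
  have nb2' : ~~ (\sum_(i < n) Psi (lin i b') + n%:R * e <=
      \sum_(i < n) h (X i w - m i - lin i b')).
    by apply/negP => b2; apply: nb2; rewrite -bigcup_seq; exists b'.
  move: nb1 nb2'; rewrite -!ltNge => nb1 nb2'.
  have s1 : \sum_(i < n) h (X i w - m i - lin i b) <=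
      \sum_(i < n) (h (X i w - m i - lin i b') + e + tl i (X i w)).
    apply: ler_sum => i _; apply: le_trans (cell _ _ _ (bb' i)) _.
    by rewrite lerD2l /tl indicE; case: (leP K2 _) => [?|/lt_geF K2x] //; rewrite mem_set.
  have s2 : \sum_(i < n) Psi (lin i b') <= \sum_(i < n) (Psi (lin i b) + 2 * e).
    apply: ler_sum => i _; apply: (cellP i); have := bb' i; rewrite distrC.
    by case=> [|[]]; [left|right].
  have s3 : \sum_(i < n) tailp i <= \sum_(i < n) e by apply: ler_sum.
  have ne0 : 0 <= n%:R * e by rewrite mulr_ge0// ltW.
  move: s1 s2 s3; rewrite !big_split/= !sum_ord_const => s1 s2 s3.
  by rewrite (_ : eta = 8 * e); [clear - s1 s2 s3 nb1 nb2' ne0; lra|rewrite /e; field].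
- move=> n; rewrite (le_trans (measureU2 _ _ _))//; first exact: bigsetU_measurable.
  rewrite EFinD leeD ?Pbad1//.
  have := @measure_bigsetU_le _ _ _ P _ (B n) (bad2 n) (u n) (mbad2 n) (fun b _ => Pbad2 n b).
  move=> /le_trans; apply; rewrite lee_fin ler_wpM2r ?expR_ge0// ler_nat; exact: (Bnet n).1.
- have r0 : 0 < e ^+ 2 / 8 by rewrite divr_gt0// exprn_gt0.
  rewrite -[X in _ --> X](addr0 0); apply: cvgD; first exact: cvg_expR_mulrn.
  exact: cvg_poly_expR.
Qed.

End uniform_lln.

(** The left side is the moment generating function of a squared standard normal variable; taking
    out its mean leaves a quadratic exponent. *)
Lemma inv_sqrt_le_expR {R : realType} (l : R) : `|l| <= 1 / 4 ->
  (Num.sqrt (1 - 2 * l))^-1 <= expR (l + 4 * l ^+ 2).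
Proof.
rewrite ler_norml => /andP[l1 l2].
rewrite -[leRHS]invrK -expRN lef_pV2 ?posrE ?expR_gt0 ?sqrtr_gt0; last by lra.
rewrite -[leLHS]ger0_norm ?expR_ge0// -sqrtr_sqr ler_sqrt; last by lra.
rewrite -expRM_natr mulNr expRN -div1r ler_pdivrMr ?expR_gt0//.
set y := (l + _) * _.
apply: (@le_trans _ _ ((1 - 2 * l) * (1 + y))); last first.
  by rewrite ler_wpM2l ?expR_ge1Dx//; lra.
suff : 0 <= l ^+ 2 * (1 - 4 * l) by rewrite /y; lra.
by rewrite mulr_ge0 ?sqr_ge0//; lra.
by lra.
Qed.

(** * Gaussian errors: concentration, tightness and kernel means *)

Section gaussian_errors.
Context {R : realType} d (T : measurableType d) (P : probability T R).
Variables (X : nat -> {RV P >-> R}) (m : nat -> R) (s0 : R).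
Hypothesis indX : mutually_independent X.
Hypothesis s0_gt0 : 0 < s0.
Hypothesis Xm : forall i, has_density (X i) (normal_pdf (m i) s0).

Lemma chernoff_whp (z : nat -> R -> R) (r : R) : 0 < r ->
    (forall i, measurable_fun setT (z i)) ->
    (forall i, (\int[P]_w (expR (z i (X i w)))%:E <= (expR (- r))%:E)%E) ->
  whp P (fun n w => \sum_(i < n) z i (X i w) < 0).
Proof.
move=> r0 mz zr.
apply: (@whp_bound _ _ _ _ _ (fun n => [set w | 0 <= \sum_(i < n) z i (X i w)])
  (fun n => expR (- (n%:R * r)))).
- move=> n; have mS : measurable_fun setT (fun w => \sum_(i < n) z i (X i w)).
    by apply: measurable_sum => i; exact: measurableT_comp.
  rewrite (_ : [set _ | _] = setT `&` (fun w => \sum_(i < n) z i (X i w)) @^-1` `[0, +oo[).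
    exact: mS.
  by apply/seteqP; split=> w /=; rewrite in_itv/= andbT // => -[].
- by move=> n w /negP; rewrite -ltNge.
- by move=> n; exact: (chernoff_sum indX n mz zr).
- exact: cvg_expR_mulrn.
Qed.

Let measurable_quadratic i (a b c : R) :
  measurable_fun setT (fun y : R => - (a / 2 * (y - m i) ^+ 2) + b * (y - m i) + c).
Proof.
apply: measurable_funD => //; apply: measurable_funD.
  apply: measurableT_comp => //; apply: measurable_funM => //.
  by apply: measurable_funX; exact: measurable_funB.
by apply: measurable_funM => //; exact: measurable_funB.
Qed.

Lemma gaussian_mgf i (p a b c : R) : 0 < p -> (p ^+ 2)^-1 = (s0 ^+ 2)^-1 + a ->
  (\int[P]_w (expR (- (a / 2 * (X i w - m i) ^+ 2) + b * (X i w - m i) + c))%:E =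
   (p / s0 * expR (b ^+ 2 * p ^+ 2 / 2 + c))%:E)%E.
Proof.
move=> p0 pE; pose h y := expR (- (a / 2 * (y - m i) ^+ 2) + b * (y - m i) + c).
have mh : measurable_fun setT h by exact: measurableT_comp.
rewrite (@expectation_density _ _ _ P (X i) _ h (Xm i))//; last 3 first.
- exact: measurable_normal_pdf.
- by move=> y; exact: normal_pdf_ge0.
- by move=> y; exact: expR_ge0.
rewrite expRD mulrA mulrC EFinM -(integral_normal_quadratic (m i) b s0_gt0 p0 pE).
rewrite -ge0_integralZl//; last 2 first.
- apply/measurable_EFinP; apply: measurable_funM; first exact: measurable_normal_pdf.
  apply: measurableT_comp => //.
  have := measurable_quadratic i a b 0.
  by apply: eq_measurable_fun => y _; rewrite addr0.
- by move=> y _; rewrite lee_fin mulr_ge0 ?expR_ge0 ?normal_pdf_ge0.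
by apply: eq_integral => y _; rewrite -EFinM /h expRD; congr EFin; ring.
Qed.

Lemma gaussian_mgf_sqr i (l c : R) : `|l| <= 1 / 4 ->
  (\int[P]_w (expR (l * ((X i w - m i) ^+ 2 / s0 ^+ 2 - 1) + c))%:E <=
   (expR (4 * l ^+ 2 + c))%:E)%E.
Proof.
move=> l4; have := l4; rewrite ler_norml => /andP[l1 l2].
have q0 : 0 < Num.sqrt (1 - 2 * l) by rewrite sqrtr_gt0; lra.
have p0 : 0 < s0 / Num.sqrt (1 - 2 * l) by rewrite divr_gt0.
(* The tilt multiplies the precision by [1 - 2 l]. *)
have pE : ((s0 / Num.sqrt (1 - 2 * l)) ^+ 2)^-1 = (s0 ^+ 2)^-1 + (- (2 * l) / s0 ^+ 2).
  rewrite expr_div_n sqr_sqrtr; last by lra.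
  by field; rewrite gt_eqF//; lra.
under eq_integral.
  move=> w _; rewrite (_ : _ + c = - (- (2 * l) / s0 ^+ 2 / 2 * (X i w - m i) ^+ 2)
    + 0 * (X i w - m i) + (c - l)); last by field; rewrite gt_eqF.
  over.
rewrite (gaussian_mgf i 0 _ p0 pE) lee_fin expr0n/= mul0r mul0r add0r.
have -> : s0 / Num.sqrt (1 - 2 * l) / s0 = (Num.sqrt (1 - 2 * l))^-1.
  by field; rewrite !gt_eqF.
apply: (@le_trans _ _ (expR (l + 4 * l ^+ 2) * expR (c - l))).
  by rewrite ler_wpM2r ?expR_ge0//; exact: inv_sqrt_le_expR.
by rewrite -expRD ler_expR; lra.
Qed.

Lemma whp_mean_sqr_error (eta : R) : 0 < eta ->
  whp P (fun n w =>
    `|\sum_(i < n) (X i w - m i) ^+ 2 - n%:R * s0 ^+ 2| <= n%:R * (eta * s0 ^+ 2)).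
Proof.
wlog eta1 : eta / eta <= 1.
  move=> H eta0; have [eta1|eta1] := leP eta 1; first exact: H.
  apply: whpS (H 1 (lexx _) ltr01); apply: nearW => n w /le_trans; apply.
  by rewrite ler_wpM2l// ler_wpM2r ?sqr_ge0// ltW.
move=> eta0; have r0 : 0 < eta ^+ 2 / 16 by rewrite divr_gt0// exprn_gt0.
(* With tilt [eta / 8] in either direction the exponent is at most
   [4 (eta / 8)^2 - eta^2 / 8 = - eta^2 / 16]. *)
have side (sg : R) : `|sg| = 1 -> whp P (fun n w => \sum_(i < n)
    (sg * (eta / 8) * ((X i w - m i) ^+ 2 / s0 ^+ 2 - 1) - eta ^+ 2 / 8) < 0).
  move=> sg1.
  pose z i y := sg * (eta / 8) * ((y - m i) ^+ 2 / s0 ^+ 2 - 1) - eta ^+ 2 / 8.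
  apply: (@chernoff_whp z _ r0) => i.
    apply: measurable_funB => //; apply: measurable_funM => //.
    apply: measurable_funB => //; apply: measurable_funM => //.
    by apply: measurable_funX; exact: measurable_funB.
  have le4 : `|sg * (eta / 8)| <= 1 / 4.
    by rewrite normrM sg1 mul1r ger0_norm; lra.
  apply: le_trans (gaussian_mgf_sqr i _ le4) _.
  rewrite lee_fin ler_expR exprMn -(real_normK (num_real sg)) sg1; lra.
have sN : `|-1 : R| = 1 by rewrite normrN normr1.
apply: whpS (whpI (side 1 (normr1 _)) (side _ sN)); apply: nearW => n w [].
rewrite !sumrB -!mulr_sumr !sumrB -!mulr_suml !sum_ord_const mulr1.
set S := \sum_(i < n) _ => u1 u2.
have e8 : 0 < eta / 8 by rewrite divr_gt0.
have s2 : 0 < s0 ^+ 2 by rewrite exprn_gt0.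
have SE : S = S / s0 ^+ 2 * s0 ^+ 2 by rewrite divfK// gt_eqF.
rewrite SE -mulrBl normrM (gtr0_norm s2) mulrA ler_pM2r// ler_norml.
set Q := S / s0 ^+ 2 in u1 u2 *.
apply/andP; split; rewrite -(ler_pM2l e8); lra.
Qed.

Lemma whp_mean_linear_error (c : nat -> R) (M eta : R) : 0 < eta ->
    (forall i, `|c i| <= M) ->
  whp P (fun n w => `|\sum_(i < n) c i * (X i w - m i)| <= n%:R * eta).
Proof.
(* [V] bounds the variance of each term, and [M + 1] keeps it positive when all coefficients vanish.
   The tilt [eta / V] is optimal for that variance. *)
move=> eta0 cM; pose V := (M + 1) ^+ 2 * s0 ^+ 2.
have M1 : 0 < M + 1 by have := cM 0%N; have := normr_ge0 (c 0%N); lra.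
have V0 : 0 < V by rewrite mulr_gt0 ?exprn_gt0.
have [l lE] : exists l, l = eta / V by exists (eta / V).
have l0 : 0 < l by rewrite lE divr_gt0.
have r0 : 0 < eta ^+ 2 / (2 * V) by rewrite divr_gt0 ?exprn_gt0// mulr_gt0.
have side (sg : R) : sg ^+ 2 = 1 -> whp P (fun n w => \sum_(i < n)
    (l * (sg * (c i * (X i w - m i))) - l * eta) < 0).
  move=> sg1; pose z i y := l * (sg * (c i * (y - m i))) - l * eta.
  apply: (@chernoff_whp z _ r0) => i.
    apply: measurable_funB => //; do 3 apply: measurable_funM => //.
    exact: measurable_funB.
  under eq_integral.
    move=> w _; rewrite (_ : z i _ = - (0 / 2 * (X i w - m i) ^+ 2)
      + (l * (sg * c i)) * (X i w - m i) + - (l * eta)); last by rewrite /z; ring.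
    over.
  rewrite (@gaussian_mgf i s0) ?addr0// divff ?gt_eqF// mul1r lee_fin ler_expR.
  rewrite !exprMn sg1 mul1r.
  have c2 : c i ^+ 2 <= (M + 1) ^+ 2.
    rewrite -(real_normK (num_real (c i))) ler_pXn2r ?nnegrE//; first by have := cM i; lra.
    exact: ltW.
  have : l ^+ 2 * c i ^+ 2 * s0 ^+ 2 <= l ^+ 2 * V.
    by rewrite -mulrA ler_wpM2l ?sqr_ge0// ler_wpM2r ?sqr_ge0.
  rewrite (_ : l ^+ 2 * V = 2 * (eta ^+ 2 / (2 * V))); last first.
    by rewrite lE; field; rewrite gt_eqF.
  rewrite (_ : l * eta = 2 * (eta ^+ 2 / (2 * V))); last first.
    by rewrite lE; field; rewrite gt_eqF.
  by lra.
have sN : (-1 : R) ^+ 2 = 1 by rewrite sqrrN expr1n.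
apply: whpS (whpI (side 1 (expr1n _ _)) (side _ sN)); apply: nearW => n w [].
rewrite !sumrB -!mulr_sumr !sum_ord_const; set S := \sum_(i < n) _ => u1 u2.
by rewrite ler_norml; apply/andP; split; rewrite -(ler_pM2l l0); lra.
Qed.

Lemma gaussian_tight (eta : R) : 0 < eta ->
  exists K : R, forall i, (P [set w | K <= `|X i w - m i|]%R <= eta%:E)%E.
Proof.
(* Markov's inequality for the exponential of the squared error over [4 s0^2], whose mean is
   [Num.sqrt 2]. At [K] the exponent is [2 / eta], and [exp (- 2 / eta) <= eta / 2]. *)
move=> eta0; pose K := Num.sqrt (8 * s0 ^+ 2 / eta).
have K2 : K ^+ 2 = 8 * s0 ^+ 2 / eta.
  by rewrite sqr_sqrtr// divr_ge0 ?mulr_ge0 ?sqr_ge0// ltW.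
exists K => i; set V := [set w | _].
have mV : measurable V.
  have mf : measurable_fun setT (fun w => `|X i w - m i|).
    by apply: measurableT_comp => //; exact: measurable_funB.
  rewrite (_ : V = setT `&` (fun w => `|X i w - m i|) @^-1` `[K, +oo[); first exact: mf.
  by apply/seteqP; split=> w /=; rewrite in_itv/= andbT // => -[].
have -> : P V = (\int[P]_w (\1_V w)%:E)%E by rewrite integral_indic// setIT.
have s2 : 0 < Num.sqrt 2 :> R by rewrite sqrtr_gt0.
have p0 : 0 < s0 * Num.sqrt 2 by rewrite mulr_gt0.
have pE : ((s0 * Num.sqrt 2) ^+ 2)^-1 = (s0 ^+ 2)^-1 + (- (1 / 2) / s0 ^+ 2).
  by rewrite exprMn sqr_sqrtr//; field; rewrite gt_eqF.
apply: (@le_trans _ _ (\int[P]_w (expR (- (- (1 / 2) / s0 ^+ 2 / 2 * (X i w - m i) ^+ 2) +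
    0 * (X i w - m i) + - (2 / eta)))%:E)%E).
  apply: ge0_le_integral => //.
  - by apply/measurable_EFinP; exact: measurable_indic.
  - apply/measurable_EFinP; apply: measurableT_comp => //.
    by apply: (measurableT_comp (measurable_quadratic i _ _ _)).
  move=> w _; rewrite lee_fin indicE; case: (boolP (w \in V)) => [|_]; last exact: expR_ge0.
  rewrite inE /V/= => Kw; rewrite -[leLHS]expR0 ler_expR mul0r addr0.
  have : K ^+ 2 <= (X i w - m i) ^+ 2.
    by rewrite -(real_normK (num_real (_ - _))) ler_pXn2r// nnegrE sqrtr_ge0.
  rewrite K2 -(ler_pM2r (_ : 0 < (4 * s0 ^+ 2)^-1)); last by rewrite invr_gt0 mulr_gt0// exprn_gt0.
  rewrite (_ : 8 * _ / _ / _ = 2 / eta); last by field; rewrite !gt_eqF.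
  rewrite (_ : - (- _ / _ / 2 * _) = (X i w - m i) ^+ 2 / (4 * s0 ^+ 2)); first by lra.
  by field; rewrite gt_eqF.
rewrite (gaussian_mgf i 0 _ p0 pE) lee_fin expr0n/= mul0r mul0r add0r.
have -> : s0 * Num.sqrt 2 / s0 = Num.sqrt 2 by field; rewrite gt_eqF.
have e2 : expR (- (2 / eta)) <= eta / 2.
  rewrite expRN -[leRHS]invrK lef_pV2 ?posrE ?expR_gt0 ?invr_gt0 ?divr_gt0//.
  by rewrite invf_div; apply: le_trans (expR_ge1Dx _); rewrite lerDr.
have s22 : Num.sqrt 2 <= 2 :> R.
  rewrite -[leRHS]ger0_norm// -sqrtr_sqr ler_sqrt; lra.
apply: (@le_trans _ _ (2 * (eta / 2))); last by lra.
by rewrite ler_pM// ?expR_ge0// ltW.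
Qed.

(** A convolution of Gaussians: the kernel acts as one of variance [s^2 / alpha], to which the error
    variance [s0^2] adds. *)
Lemma gaussian_kernel_mean i (alpha s u : R) : 0 <= alpha -> 0 < s ->
  (\int[P]_w (expR (- (alpha * (X i w - m i - u) ^+ 2 / (s ^+ 2 *+ 2))))%:E =
   (s / Num.sqrt (s ^+ 2 + alpha * s0 ^+ 2) *
    expR (- (alpha * u ^+ 2 / ((s ^+ 2 + alpha * s0 ^+ 2) *+ 2))))%:E)%E.
Proof.
move=> a0 sgt0; set D := s ^+ 2 + _.
have D0 : 0 < D by rewrite ltr_wpDr ?exprn_gt0// mulr_ge0 ?sqr_ge0.
have q0 : 0 < Num.sqrt D by rewrite sqrtr_gt0.
have p0 : 0 < s0 * s / Num.sqrt D by rewrite divr_gt0 ?mulr_gt0.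
have pE : ((s0 * s / Num.sqrt D) ^+ 2)^-1 = (s0 ^+ 2)^-1 + alpha / s ^+ 2.
  rewrite expr_div_n exprMn sqr_sqrtr ?(ltW D0)// /D; field.
  by rewrite -/D !gt_eqF.
under eq_integral.
  move=> w _; rewrite (_ : - _ = - (alpha / s ^+ 2 / 2 * (X i w - m i) ^+ 2)
    + (alpha * u / s ^+ 2) * (X i w - m i) + - (alpha * u ^+ 2 / (s ^+ 2 *+ 2))); last first.
    by field; rewrite gt_eqF.
  over.
rewrite (gaussian_mgf i _ _ p0 pE); congr (_ * expR _)%:E.
  by field; rewrite !gt_eqF.
rewrite expr_div_n exprMn (_ : (_ / _) ^+ 2 = s0 ^+ 2 * s ^+ 2 / D); last first.
  by rewrite expr_div_n exprMn sqr_sqrtr ?(ltW D0).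
have aE : alpha = (D - s ^+ 2) / s0 ^+ 2 by rewrite /D; field; rewrite gt_eqF.
rewrite /D; field; rewrite -/D !gt_eqF//.
Qed.

End gaussian_errors.

(** * The expected power divergence criterion and its strict maximum *)

Section power_divergence.
Context {R : realType}.
Implicit Types x y z s u rho : R.
Local Notation k2pi := ((Num.sqrt (pi *+ 2) : R)^-1).

(** Quantitative strict convexity of the exponential, the source of the gaps in the scale. For
    [x >= -2] square [1 + x / 2 <= exp (x / 2)]; below, [- 1 - x] alone exceeds [1]. *)
Lemma expR_sub_ge x : Num.min (x ^+ 2 / 4) 1 <= expR x - 1 - x.
Proof.
rewrite ge_min; have [x2|x2] := leP (- 2) x; apply/orP; [left|right].
  rewrite (_ : x = x / 2 * 2%:R) ?expRM_natr; last by field.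
  have h : 1 + x / 2 <= expR (x / 2) by exact: expR_ge1Dx.
  have : (1 + x / 2) ^+ 2 <= expR (x / 2) ^+ 2.
    by rewrite ler_pXn2r ?nnegrE ?expR_ge0//; lra.
  by lra.
by have := expR_gt0 x; lra.
Qed.

Lemma norm_expRB1_le z : `|z| <= 1 / 2 -> `|expR z - 1| <= 2 * `|z|.
Proof.
move=> z2; have zle : z <= 1 / 2 by exact: le_trans (ler_norm _) z2.
have := expR_le_quad zle; have := expR_ge1Dx z.
have zz : z ^+ 2 <= `|z| / 2.
  rewrite -(real_normK (num_real z)) expr2.
  by have := ler_wpM2l (normr_ge0 z) z2; lra.
have z1 := ler_norm z; have z3 := ler_norm (- z); rewrite normrN in z3.
by move=> h1 h2; rewrite ler_norml; apply/andP; split; lra.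
Qed.

Variables (alpha s0 : R).
Hypotheses (alpha_gt0 : 0 < alpha) (s0_gt0 : 0 < s0).

(** The [alpha]-th power of a centred normal density, divided by its peak value [peak_pow]. *)
Definition gkern s x := expR (- (alpha * x ^+ 2 / (s ^+ 2 *+ 2))).

Definition gkern_mean s u := s / Num.sqrt (s ^+ 2 + alpha * s0 ^+ 2) *
  expR (- (alpha * u ^+ 2 / ((s ^+ 2 + alpha * s0 ^+ 2) *+ 2))).

(** Multiplied by [peak_pow s], this is the integral term of the criterion. *)
Definition dpd_const : R := (1 + alpha)^-1 / Num.sqrt (1 + alpha).

Definition peak_pow s : R := (k2pi / s) `^ alpha.

(* Expected objective plus [1 / alpha], for one observation whose regression
   function is off by [u] *)
Definition dpd_risk s u := peak_pow s * (gkern_mean s u / alpha - dpd_const).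

Definition dpd_risk0 := peak_pow s0 * (dpd_const / alpha).

Lemma alpha1_gt0 : 0 < 1 + alpha. Proof. by rewrite addr_gt0. Qed.

Lemma dpd_const_gt0 : 0 < dpd_const.
Proof. by rewrite divr_gt0 ?invr_gt0 ?sqrtr_gt0 ?alpha1_gt0. Qed.

Lemma peak_pow_gt0 s : 0 < s -> 0 < peak_pow s.
Proof. by move=> sgt0; rewrite powR_gt0// divr_gt0// k2pi_gt0. Qed.

Lemma peak_pow_le s s' : 0 < s -> s <= s' -> peak_pow s' <= peak_pow s.
Proof.
move=> sgt0 ss'; have s'0 : 0 < s' by exact: lt_le_trans ss'.
have k0 := @k2pi_gt0 R.
rewrite ge0_ler_powR ?nnegrE ?(ltW alpha_gt0)//.
- by rewrite divr_ge0 ?(ltW k0) ?(ltW s'0).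
- by rewrite divr_ge0 ?(ltW k0) ?(ltW sgt0).
- by rewrite ler_pM2l// lef_pV2.
Qed.

Lemma dpd_risk0_gt0 : 0 < dpd_risk0.
Proof. by rewrite mulr_gt0 ?peak_pow_gt0// divr_gt0 ?dpd_const_gt0. Qed.

Let ax_ge0 x : 0 <= alpha * x ^+ 2.
Proof. by rewrite mulr_ge0 ?(ltW alpha_gt0)// sqr_ge0. Qed.

Let s2_gt0 s : 0 < s -> 0 < s ^+ 2 *+ 2.
Proof. by move=> sgt0; rewrite mulrn_wgt0// exprn_gt0. Qed.

Lemma gkern01 s x : 0 <= gkern s x <= 1.
Proof.
by rewrite expR_ge0 expR_le1 oppr_le0 divr_ge0// mulrn_wge0// sqr_ge0.
Qed.

Lemma gkern_le s s' x : 0 < s -> s <= s' -> gkern s x <= gkern s' x.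
Proof.
move=> sgt0 ss'; have s'0 : 0 < s' by exact: lt_le_trans ss'.
rewrite ler_expR lerN2 ler_wpM2l// lef_pV2 ?posrE ?s2_gt0// lerMn2r/=.
by rewrite ler_pXn2r ?nnegrE ?(ltW sgt0) ?(ltW s'0).
Qed.

(** Follows from [y exp (- y) <= 1]. It compares a scale with a nearby grid point, uniformly in the
    residual. *)
Lemma gkern_scale_le s s' l x : 0 < s -> 0 < s' -> s' <= l * s -> 1 <= l ->
  gkern s' x <= gkern s x + (l ^+ 2 - 1).
Proof.
move=> sgt0 s'0 ss' l1; have l0 : 0 < l by exact: lt_le_trans l1.
have ls0 : 0 < l * s by rewrite mulr_gt0.
pose y := alpha * x ^+ 2 / ((l * s) ^+ 2 *+ 2).
apply: (le_trans (gkern_le x s'0 ss')).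
have y0 : 0 <= y by rewrite divr_ge0// ltW// s2_gt0.
rewrite {1}/gkern -/y (_ : gkern s x = expR (- y) * expR (- ((l ^+ 2 - 1) * y))); last first.
  by rewrite -expRD; congr expR; rewrite /y; field; rewrite !gt_eqF.
have l21 : 0 <= l ^+ 2 - 1 by rewrite subr_ge0 expr_ge1// ltW.
have h1 := expR_ge1Dx (- ((l ^+ 2 - 1) * y)).
have h2 : y * expR (- y) <= 1.
  rewrite expRN ler_pdivrMr ?expR_gt0// mul1r; have := expR_ge1Dx y; lra.
have e0 := expR_gt0 (- y).
have h3 := ler_wpM2l (ltW e0) h1.
have h4 := ler_wpM2l l21 h2.
lra.
Qed.

Let gkernE s : 0 < s ->
  exists2 a, 0 < a & forall x, gkern s x = expR (- (a * x ^+ 2)).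
Proof.
move=> sgt0; exists (alpha / (s ^+ 2 *+ 2)); first by rewrite divr_gt0// s2_gt0.
by move=> x; congr expR; field; rewrite gt_eqF.
Qed.

Lemma gkern_unif s (eta : R) : 0 < s -> 0 < eta ->
  exists2 mesh, 0 < mesh & forall x y, `|x - y| <= mesh -> gkern s x <= gkern s y + eta.
Proof.
move=> sgt0 eta0; have [a a0 kE] := gkernE sgt0.
(* By [a x^2 exp (- a x^2) <= 1] the difference of the kernels is at most [a d + d + a d^2], hence
   at most [d (2 a + 1)]. *)
pose d := Num.min 1 (eta / (2 * a + 1)).
have a21 : 0 < 2 * a + 1 by rewrite addr_gt0// mulr_gt0.
have d0 : 0 < d by rewrite lt_min ltr01 divr_gt0.
have d1 : d <= 1 by rewrite ge_min lexx.
have d2 : d * (2 * a + 1) <= eta by rewrite -ler_pdivlMr// ge_min lexx orbT.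
exists d => // x y xy; rewrite !kE; clearbody d.
set E := expR (- (a * x ^+ 2)).
have E0 : 0 < E by exact: expR_gt0.
have E1 : E <= 1 by rewrite expR_le1 oppr_le0 mulr_ge0 ?sqr_ge0// ltW.
have aE : a * x ^+ 2 * E <= 1.
  rewrite /E expRN ler_pdivrMr ?expR_gt0// mul1r.
  by have := expR_ge1Dx (a * x ^+ 2); lra.
have yE : E * (1 + a * (x ^+ 2 - y ^+ 2)) <= expR (- (a * y ^+ 2)).
  rewrite (_ : - (a * y ^+ 2) = - (a * x ^+ 2) + a * (x ^+ 2 - y ^+ 2)); last by ring.
  by rewrite expRD ler_pM2l// expR_ge1Dx.
have yx : y ^+ 2 - x ^+ 2 <= d * (1 + x ^+ 2) + d ^+ 2.
  have -> : y ^+ 2 - x ^+ 2 = 2 * (x * (y - x)) + (y - x) ^+ 2 by ring.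
  rewrite distrC in xy.
  have h1 : (y - x) ^+ 2 <= d ^+ 2.
    by rewrite -(real_normK (num_real (y - x))) ler_pXn2r ?nnegrE ?(ltW d0).
  have h2 : x * (y - x) <= `|x| * d.
    by apply: le_trans (ler_norm _) _; rewrite normrM ler_wpM2l.
  have h3 : 2 * `|x| <= 1 + x ^+ 2.
    rewrite -(real_normK (num_real x)).
    by have := sqr_ge0 (`|x| - 1); lra.
  have h4 := ler_wpM2r (ltW d0) h3.
  by lra.
have h5 := ler_wpM2l (ltW a0) (ler_wpM2l (ltW E0) yx).
have h6 := ler_wpM2l (ltW d0) aE.
have aE1 : a * E <= a by rewrite ler_piMr// ltW.
have dd : d ^+ 2 <= d by rewrite expr2 ler_piMr// ltW.
have aE0 : 0 <= a * E by rewrite mulr_ge0// ltW.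
have h7 := ler_wpM2l aE0 dd; have h8 := ler_wpM2r (ltW d0) aE1.
by lra.
Qed.

Lemma gkern_infty s (eta : R) : 0 < s -> 0 < eta ->
  exists K, forall x, K <= `|x| -> gkern s x <= eta.
Proof.
move=> sgt0 eta0; have [a a0 kE] := gkernE sgt0.
exists (Num.sqrt (eta^-1 / a)) => x xK.
have {}xK : eta^-1 <= a * x ^+ 2.
  rewrite mulrC -ler_pdivrMr// -(real_normK (num_real x)).
  rewrite -[leLHS]sqr_sqrtr ?divr_ge0 ?invr_ge0 ?(ltW eta0) ?(ltW a0)//.
  by rewrite ler_pXn2r ?nnegrE ?sqrtr_ge0.
rewrite kE expRN -[leRHS]invrK lef_pV2 ?posrE ?invr_gt0 ?expR_gt0//.
by have := expR_ge1Dx (a * x ^+ 2); lra.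
Qed.

Let D_gt0 s : 0 < s -> 0 < s ^+ 2 + alpha * s0 ^+ 2.
Proof. by move=> sgt0; rewrite addr_gt0 ?exprn_gt0// mulr_gt0// exprn_gt0. Qed.

(** Uniform in the shift and vanishing with [s]; this rules out small scales. *)
Lemma gkern_mean_le s u : 0 < s -> gkern_mean s u <= s / (Num.sqrt alpha * s0).
Proof.
move=> sgt0; rewrite /gkern_mean -[leRHS]mulr1.
have q0 : 0 < Num.sqrt alpha * s0 by rewrite mulr_gt0 ?sqrtr_gt0.
rewrite ler_pM ?expR_ge0//; first by rewrite divr_ge0 ?sqrtr_ge0// ltW.
- rewrite ler_pM2l// lef_pV2 ?posrE ?sqrtr_gt0 ?D_gt0//.
  have -> : Num.sqrt alpha * s0 = Num.sqrt (alpha * s0 ^+ 2).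
    by rewrite sqrtrM ?(ltW alpha_gt0)// sqrtr_sqr gtr0_norm.
  by rewrite ler_sqrt ?lerDr ?sqr_ge0// ltW// D_gt0.
- by rewrite expR_le1 oppr_le0 divr_ge0// mulrn_wge0// ltW// D_gt0.
Qed.

Lemma dpd_risk_at0 : dpd_risk s0 0 = dpd_risk0.
Proof.
rewrite /dpd_risk /dpd_risk0; congr (_ * _).
rewrite /gkern_mean expr0n/= mulr0 mul0r oppr0 expR0 mulr1.
have a1 := alpha1_gt0; have q0 : 0 < Num.sqrt (1 + alpha) by rewrite sqrtr_gt0.
rewrite (_ : s0 ^+ 2 + _ = (1 + alpha) * s0 ^+ 2); last by ring.
rewrite sqrtrM ?(ltW a1)// sqrtr_sqr ger0_norm ?(ltW s0_gt0)// /dpd_const.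
by field; rewrite !gt_eqF.
Qed.

(** After division by [exp y], the tangent bound for [exp (alpha y)] and the sharpened one for
    [exp (- y)] cancel to first order. *)
Let weighted_amgm y :
  (1 + alpha) * expR y + expR y * (alpha * Num.min (y ^+ 2 / 4) 1) <=
  expR ((1 + alpha) * y) + alpha.
Proof.
have e0 := expR_gt0 y.
have -> : expR ((1 + alpha) * y) = expR y * expR (alpha * y).
  by rewrite mulrDl mul1r expRD.
have h1 := expR_ge1Dx (alpha * y).
have := expR_sub_ge (- y); rewrite sqrrN => h2.
have h3 := ler_wpM2l (ltW alpha_gt0) h2.
have h4 : alpha = expR y * (alpha * expR (- y)).
  by rewrite mulrCA -expRD subrr expR0 mulr1.
have h5 := ler_wpM2l (ltW e0) h3.
have h6 := ler_wpM2l (ltW e0) h1.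
by rewrite [X in _ <= _ + X]h4; lra.
Qed.

(* With [s / s0 = expR z], two applications of weighted AM-GM. *)
Lemma dpd_risk_gap_scale z : dpd_risk (s0 * expR z) 0 +
  dpd_risk0 * (expR (- (alpha * z)) * expR (alpha * z / (1 + alpha)) *
    (alpha * Num.min ((alpha * z / (1 + alpha)) ^+ 2 / 4) 1)) <= dpd_risk0.
Proof.
have a1 := alpha1_gt0; set q := alpha * z / (1 + alpha); set g := Num.min _ _.
have q1 : 0 < Num.sqrt (1 + alpha) by rewrite sqrtr_gt0.
pose m := expR q / Num.sqrt (1 + alpha).
(* First application, to the term [exp (2 z) + alpha] under the root; its gain is discarded. *)
have mean_le : gkern_mean (s0 * expR z) 0 <= m.
  rewrite /gkern_mean expr0n/= mulr0 mul0r oppr0 expR0 mulr1.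
  have -> : (s0 * expR z) ^+ 2 + alpha * s0 ^+ 2 = s0 ^+ 2 * (expR (2 * z) + alpha).
    by rewrite exprMn -expRM_natr (mulrC z); ring.
  have D0 : 0 < expR (2 * z) + alpha by rewrite addr_gt0 ?expR_gt0.
  rewrite sqrtrM ?sqr_ge0// sqrtr_sqr gtr0_norm//.
  have -> : s0 * expR z / (s0 * Num.sqrt (expR (2 * z) + alpha)) =
            expR z / Num.sqrt (expR (2 * z) + alpha).
    by field; rewrite !gt_eqF ?sqrtr_gt0.
  rewrite ler_pdivrMr ?sqrtr_gt0// /m mulrAC ler_pdivlMr//.
  have e2 (x : R) : expR x = Num.sqrt (expR (2 * x)).
    by rewrite mulrC expRM_natr sqrtr_sqr ger0_norm// expR_ge0.
  rewrite (e2 z) (e2 q) -!sqrtrM ?expR_ge0// ler_sqrt; last first.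
    by rewrite mulr_ge0 ?expR_ge0// ltW.
  have := weighted_amgm (2 * z / (1 + alpha)).
  rewrite (_ : (1 + alpha) * (2 * z / _) = 2 * z); last by field; rewrite gt_eqF.
  set y := 2 * z / _; set g' := Num.min _ _ => h.
  have g'0 : 0 <= g' by rewrite le_min ler01 divr_ge0// sqr_ge0.
  have {}h : (1 + alpha) * expR y <= expR (2 * z) + alpha.
    apply: le_trans h; rewrite lerDl mulr_ge0 ?expR_ge0// mulr_ge0//; exact: ltW.
  rewrite (_ : 2 * z = 2 * q + y) ?expRD; last by rewrite /q /y; field; rewrite gt_eqF.
  have := ler_wpM2l (expR_ge0 (2 * q)) h.
  rewrite (_ : 2 * z = 2 * q + y) ?expRD; last by rewrite /q /y; field; rewrite gt_eqF.
  lra.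
have c0 := dpd_const_gt0.
have pE : peak_pow (s0 * expR z) = peak_pow s0 * expR (- (alpha * z)).
  rewrite /peak_pow invfM mulrA powRM ?divr_ge0 ?invr_ge0 ?expR_ge0 ?(ltW s0_gt0)//.
  by rewrite -expRN -expRM mulNr (mulrC z).
have mE : m = dpd_const * ((1 + alpha) * expR q).
  by rewrite /m /dpd_const; field; rewrite !gt_eqF.
(* Second application, at [q], whose gain is kept. *)
have h := weighted_amgm q; rewrite -/g (_ : (1 + alpha) * q = alpha * z) in h; last first.
  by rewrite /q; field; rewrite gt_eqF.
have h1 := ler_wpM2l (ltW c0) h.
have e0 := expR_gt0 (- (alpha * z)).
have h2 : gkern_mean (s0 * expR z) 0 <= dpd_const * ((1 + alpha) * expR q) by rewrite -mE.
have h3 : gkern_mean (s0 * expR z) 0 - alpha * dpd_const + dpd_const * (expR q * (alpha * g))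
    <= dpd_const * expR (alpha * z) by lra.
have h4 := ler_wpM2l (ltW e0) h3.
have e1 : expR (- (alpha * z)) * expR (alpha * z) = 1 by rewrite -expRD addNr expR0.
rewrite (mulrCA _ dpd_const) e1 mulr1 in h4.
have p0 : 0 <= peak_pow s0 / alpha by rewrite divr_ge0 ?ltW ?peak_pow_gt0.
have h5 := ler_wpM2l p0 h4.
rewrite /dpd_risk /dpd_risk0 pE.
move: h5; set M := gkern_mean _ _; set c := dpd_const; set pp := peak_pow s0 => h5.
apply: (le_trans (le_trans _ h5)); rewrite le_eqVlt; apply/orP; left; apply/eqP;
  by field; rewrite gt_eqF.
Qed.

Lemma gkern_mean_le0 s u : 0 < s -> gkern_mean s u <= gkern_mean s 0.
Proof.
move=> sgt0; rewrite /gkern_mean ler_wpM2l ?divr_ge0 ?sqrtr_ge0 ?(ltW sgt0)//.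
rewrite ler_expR lerN2 expr0n/= mulr0 mul0r divr_ge0// ltW// mulrn_wgt0//.
exact: D_gt0.
Qed.

Lemma dpd_risk_le s u : 0 < s -> dpd_risk s u <= dpd_risk0.
Proof.
move=> sgt0; have pa : 0 <= peak_pow s / alpha by rewrite divr_ge0 ?ltW ?peak_pow_gt0.
apply: (@le_trans _ _ (dpd_risk s 0)).
  have := ler_wpM2l (ltW (peak_pow_gt0 sgt0)); rewrite /dpd_risk; apply.
  by rewrite lerD2r ler_pM2r ?invr_gt0// gkern_mean_le0.
have := dpd_risk_gap_scale (ln (s / s0)); rewrite lnK ?posrE ?divr_gt0// mulrC divfK ?gt_eqF//.
set g := Num.min _ _.
have g0 : 0 <= g by rewrite le_min ler01 divr_ge0// sqr_ge0.
apply: le_trans; rewrite lerDl mulr_ge0 ?(ltW dpd_risk0_gt0)// mulr_ge0//.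
by rewrite mulr_ge0// ltW.
Qed.

(** The gap is uniform because the scales stay in a compact interval of positive numbers, while the
    shift may be unbounded: the risk only decreases as [|u|] grows. *)
Lemma dpd_risk_gap rho s1 s2 : 0 < rho -> 0 < s1 ->
  exists2 delta : R, 0 < delta & forall s u, s1 <= s <= s2 ->
    rho <= `|u| \/ rho <= `|s - s0| -> dpd_risk s u <= dpd_risk0 - delta.
Proof.
move=> rho0 s10; have [s12|s21] := leP s1 s2; last first.
  exists 1 => // s u /andP[h1 h2]; have := le_trans h1 h2.
  by rewrite leNgt s21.
have s20 : 0 < s2 by exact: lt_le_trans s12.
have a1 := alpha1_gt0.
(* [d1] is the risk lost by a shift of at least [rho], [d2] below by a change
   of scale of at least [rho]. *)
pose E := expR (- (alpha * rho ^+ 2 / ((s2 ^+ 2 + alpha * s0 ^+ 2) *+ 2))).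
have E1 : E < 1.
  by rewrite expR_lt1 oppr_lt0 divr_gt0 ?mulr_gt0 ?exprn_gt0 ?mulrn_wgt0 ?D_gt0.
pose q1 := s1 / Num.sqrt (s2 ^+ 2 + alpha * s0 ^+ 2).
have q10 : 0 < q1 by rewrite divr_gt0 ?sqrtr_gt0 ?D_gt0.
pose d1 := peak_pow s2 * (q1 * (1 - E) / alpha).
have d10 : 0 < d1 by rewrite mulr_gt0 ?peak_pow_gt0// divr_gt0// mulr_gt0// subr_gt0.
(* A change of scale of at least [rho] forces [|ln (s / s0)| >= zeta], since [|exp z - 1| <= 2 |z|]
   for [|z| <= 1 / 2]; [Z] bounds the same logarithm from above. *)
pose zeta := Num.min (1 / 2) (rho / (2 * s0)).
have zeta0 : 0 < zeta by rewrite lt_min !divr_gt0// mulr_gt0.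
pose Z := Num.max `|ln (s1 / s0)| `|ln (s2 / s0)|.
pose g := alpha * Num.min ((alpha * zeta / (1 + alpha)) ^+ 2 / 4) 1.
have g0 : 0 < g.
  by rewrite mulr_gt0// lt_min ltr01 divr_gt0// exprn_gt0// divr_gt0 ?mulr_gt0.
pose e := expR (- (alpha * Z)) * expR (- (alpha * Z / (1 + alpha))).
have e0 : 0 < e by rewrite mulr_gt0 ?expR_gt0.
pose d2 := dpd_risk0 * (e * g).
have d20 : 0 < d2 by rewrite mulr_gt0 ?dpd_risk0_gt0// mulr_gt0.
exists (Num.min d1 d2); first by rewrite lt_min d10.
move=> s u /andP[s1s ss2]; have sgt0 : 0 < s by exact: lt_le_trans s1s.
case=> [ru|rs].
  suff : dpd_risk s u <= dpd_risk s 0 - d1.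
    have := dpd_risk_le 0 sgt0; have : Num.min d1 d2 <= d1 by rewrite ge_min lexx.
    lra.
  have mean_u : gkern_mean s u <= gkern_mean s 0 - q1 * (1 - E).
    rewrite /gkern_mean expr0n/= mulr0 mul0r oppr0 expR0 mulr1.
    set q := s / _; set F := expR _.
    have qq1 : q1 <= q.
      rewrite /q1 /q ler_pM ?(ltW s10) ?invr_ge0 ?sqrtr_ge0//.
      rewrite lef_pV2 ?posrE ?sqrtr_gt0 ?D_gt0// ler_sqrt ?(ltW (D_gt0 _))//.
      by rewrite lerD2r ler_pXn2r ?nnegrE ?(ltW sgt0) ?(ltW s20).
    have FE : F <= E.
      rewrite ler_expR lerN2 ler_pM ?invr_ge0 ?mulrn_wge0 ?(ltW (D_gt0 _))//.
        rewrite ler_wpM2l ?(ltW alpha_gt0)// -(real_normK (num_real u)).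
        by rewrite ler_pXn2r ?nnegrE ?(ltW rho0).
      rewrite lef_pV2 ?posrE ?mulrn_wgt0 ?D_gt0// lerMn2r/= lerD2r.
      by rewrite ler_pXn2r ?nnegrE ?(ltW sgt0) ?(ltW s20).
    have : q1 * (1 - E) <= q * (1 - F).
      by rewrite ler_pM ?(ltW q10) ?subr_ge0 ?(ltW E1)// lerD2l lerN2.
    lra.
  have ps := peak_pow_le sgt0 ss2; have p2 := peak_pow_gt0 s20.
  have w0 : 0 <= q1 * (1 - E) / alpha.
    by rewrite divr_ge0 ?(ltW alpha_gt0)// mulr_ge0 ?(ltW q10)// subr_ge0 ltW.
  have h1 : d1 <= peak_pow s * (q1 * (1 - E) / alpha) by rewrite ler_wpM2r.
  have := ler_wpM2l (ltW (peak_pow_gt0 sgt0)) (ler_wpM2r (_ : 0 <= alpha^-1) mean_u).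
  rewrite invr_ge0 => /(_ (ltW alpha_gt0)); rewrite /dpd_risk.
  lra.
pose z := ln (s / s0).
have sz : s = s0 * expR z by rewrite lnK ?posrE ?divr_gt0// mulrC divfK// gt_eqF.
have zz : zeta <= `|z|.
  rewrite leNgt; apply/negP; rewrite lt_min => /andP[z1 z2].
  have := norm_expRB1_le (ltW z1); apply/negP; rewrite -ltNge.
  apply: (@lt_le_trans _ _ (rho / s0)).
    by rewrite (_ : rho / s0 = 2 * (rho / (2 * s0))) ?ltr_pM2l//; field; rewrite gt_eqF.
  rewrite ler_pdivrMr// -[X in _ * X](gtr0_norm s0_gt0) -normrM.
  by rewrite mulrBl mul1r mulrC -sz.
have zZ : `|z| <= Z.
  have z1 : ln (s1 / s0) <= z by rewrite ler_ln ?posrE ?divr_gt0// ler_pM2r ?invr_gt0.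
  have z2 : z <= ln (s2 / s0) by rewrite ler_ln ?posrE ?divr_gt0// ler_pM2r ?invr_gt0.
  have h1 : `|ln (s1 / s0)| <= Z by rewrite le_max lexx.
  have h2 : `|ln (s2 / s0)| <= Z by rewrite le_max lexx orbT.
  have := ler_norm (- ln (s1 / s0)); have := ler_norm (ln (s2 / s0)); rewrite normrN.
  by move=> h3 h4; rewrite ler_norml; apply/andP; split; lra.
have riskz := dpd_risk_le u sgt0.
apply: (@le_trans _ _ (dpd_risk0 - d2)); last first.
  by rewrite lerD2l lerN2 ge_min lexx orbT.
apply: (@le_trans _ _ (dpd_risk s 0)).
  have := ler_wpM2l (ltW (peak_pow_gt0 sgt0)); rewrite /dpd_risk; apply.
  by rewrite lerD2r ler_pM2r ?invr_gt0// gkern_mean_le0.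
rewrite lerBrDr sz; apply: le_trans (dpd_risk_gap_scale z); rewrite lerD2l.
rewrite /d2 ler_pM2l ?dpd_risk0_gt0//.
have zn := ler_norm z; have zn' := ler_norm (- z); rewrite normrN in zn'.
rewrite ler_pM ?(ltW e0) ?(ltW g0)//.
  rewrite /e ler_pM ?expR_ge0// ler_expR.
    by rewrite lerN2 ler_wpM2l ?(ltW alpha_gt0)//; lra.
  rewrite -mulNr ler_wpM2r ?invr_ge0 ?(ltW a1)// -mulrN ler_wpM2l ?(ltW alpha_gt0)//; lra.
rewrite /g ler_wpM2l ?(ltW alpha_gt0)//.
have h : (alpha * zeta / (1 + alpha)) ^+ 2 <= (alpha * z / (1 + alpha)) ^+ 2.
  rewrite -[leRHS](real_normK (num_real _)) ler_pXn2r ?nnegrE//; last first.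
    by rewrite divr_ge0 ?(ltW a1)// mulr_ge0 ?(ltW zeta0)// ltW.
  rewrite !normrM (gtr0_norm alpha_gt0) normfV (gtr0_norm a1).
  by rewrite ler_wpM2r ?invr_ge0 ?(ltW a1)// ler_wpM2l// ltW.
rewrite le_min [X in _ && X]ge_min lexx orbT andbT ge_min.
by apply/orP; left; rewrite ler_pM2r.
Qed.

End power_divergence.

(** * L1 distance between normal densities *)

Section L1_between_normals.
Context {R : realType}.
Implicit Types m u s x y kap : R.
Local Notation mu := (@lebesgue_measure R).
Local Notation k2pi := ((Num.sqrt (pi *+ 2) : R)^-1).

Lemma L1_le (g f : R -> R) (c : R) :
  (\int[mu]_y (`|g y - f y|)%:E <= c%:E)%E -> L1_dist g f <= c.
Proof.
move=> gfc; rewrite /L1_dist /Rintegral -lee_fin fineK// ge0_fin_numE.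
  exact: le_lt_trans gfc (ltry _).
by apply: integral_ge0 => y _; rewrite lee_fin.
Qed.

Lemma measurable_abs_diff m s m' s' :
  measurable_fun setT (fun y => (`|normal_pdf m s y - normal_pdf m' s' y|)%:E).
Proof.
apply/measurable_EFinP; apply: measurableT_comp => //.
by apply: measurable_funB; exact: measurable_normal_pdf.
Qed.

Lemma integral_two_pdf m s m' s' :
  (\int[mu]_y (normal_pdf m s y + normal_pdf m' s' y)%:E = 2%:E)%E.
Proof.
under eq_integral do rewrite EFinD.
rewrite ge0_integralD//.
- by rewrite !integral_normal_pdf -EFinD.
- by move=> y _; rewrite lee_fin normal_pdf_ge0.
- by apply/measurable_EFinP; exact: measurable_normal_pdf.
- by move=> y _; rewrite lee_fin normal_pdf_ge0.
- by apply/measurable_EFinP; exact: measurable_normal_pdf.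
Qed.

Lemma L1_dist_normal_le2 m s m' s' :
  L1_dist (normal_pdf m s) (normal_pdf m' s') <= 2.
Proof.
apply: L1_le; rewrite -(integral_two_pdf m s m' s').
apply: ge0_le_integral => //.
- exact: measurable_abs_diff.
- apply/measurable_EFinP; apply: measurable_funD; exact: measurable_normal_pdf.
- move=> y _; rewrite lee_fin (le_trans (ler_normB _ _))//.
  by rewrite !ger0_norm ?normal_pdf_ge0.
Qed.

(** With [h] the geometric mean, [(g - f)^2 = (g + f - 2 h) (g + f + 2 h)], and this product is
    split by AM-GM with weight [kap]. The bound is linear in [g], [f] and [h], so it can be
    integrated, which turns [h] into the Hellinger affinity. *)
Lemma abs_diff_le (g f h kap : R) : 0 < kap -> 0 <= g -> 0 <= f -> 0 <= h ->
  h ^+ 2 = g * f -> `|g - f| + h / kap <= (1 / (2 * kap) + kap) * (g + f).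
Proof.
move=> k0 g0 f0 h0 hgf.
have gf2 : (g + f) ^+ 2 - (2 * h) ^+ 2 = (g - f) ^+ 2.
  by rewrite exprMn hgf; ring.
have h2 : 2 * h <= g + f.
  rewrite -(ler_pXn2r (n := 2)) ?nnegrE ?mulr_ge0 ?addr_ge0//.
  by have := sqr_ge0 (g - f); lra.
set x := g + f - 2 * h; have x0 : 0 <= x by rewrite subr_ge0.
have S0 : 0 <= g + f by rewrite addr_ge0.
have y0 : 0 <= x / (2 * kap) + kap * (g + f).
  by rewrite addr_ge0 ?divr_ge0 ?mulr_ge0// ltW.
suff : `|g - f| <= x / (2 * kap) + kap * (g + f).
  rewrite (_ : x / (2 * kap) = (g + f) / (2 * kap) - h / kap); first by lra.
  by rewrite /x; field; rewrite gt_eqF.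
rewrite -(ler_pXn2r (n := 2)) ?nnegrE// real_normK ?num_real// -gf2.
have -> : (g + f) ^+ 2 - (2 * h) ^+ 2 = x * (g + f + 2 * h) by rewrite /x; ring.
apply: (@le_trans _ _ (x * (2 * (g + f)))); first by rewrite ler_wpM2l//; lra.
have -> : x * (2 * (g + f)) = 4 * (x / (2 * kap) * (kap * (g + f))).
  by field; rewrite gt_eqF.
by have := sqr_ge0 (x / (2 * kap) - kap * (g + f)); lra.
Qed.

Lemma L1_dist_normal_near s0 (eps : R) : 0 < s0 -> 0 < eps ->
  exists2 rho, 0 < rho & forall m u s, 0 < s -> `|u| < rho -> `|s - s0| < rho ->
    L1_dist (normal_pdf m s0) (normal_pdf (m + u) s) < eps.
Proof.
move=> s0gt0 eps0.
(* The final bound is [eps / 2 + (4 / eps) (1 - A)] with [1 - A <= 2 (rho / s0)^2]; the fraction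
   [1 / 5] makes the second term at most [8 eps / 25]. *)
pose rho := s0 * Num.min (1 / 2) (eps / 5).
have rho0 : 0 < rho by rewrite mulr_gt0// lt_min !divr_gt0.
have rho1 : rho <= s0 / 2.
  by rewrite ler_pM2l// ge_min div1r lexx.
have rho2 : rho <= s0 * (eps / 5) by rewrite ler_pM2l// ge_min lexx orbT.
exists rho => // m u s sgt0 urho srho; clearbody rho.
pose D := s ^+ 2 + s0 ^+ 2.
have D0 : 0 < D by rewrite addr_gt0 ?exprn_gt0.
pose p := Num.sqrt 2 * s * s0 / Num.sqrt D.
have p0 : 0 < p by rewrite divr_gt0 ?mulr_gt0 ?sqrtr_gt0.
have p2 : p ^+ 2 = 2 * s ^+ 2 * s0 ^+ 2 / D.
  by rewrite expr_div_n !exprMn !sqr_sqrtr ?(ltW D0).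
pose a := (2 * s ^+ 2)^-1 - (2 * s0 ^+ 2)^-1.
have pE : (p ^+ 2)^-1 = (s0 ^+ 2)^-1 + a.
  by rewrite p2 /a /D; field; rewrite -/D !gt_eqF.
pose b := u / (2 * s ^+ 2); pose c := - (u ^+ 2 / (4 * s ^+ 2)).
(* [w g e] is the geometric mean of [g] and [f], written as a quadratic tilt of [g] so that its
   integral, the affinity [A], is explicit. *)
pose w := Num.sqrt (s0 / s) * expR c.
have w0 : 0 <= w by rewrite mulr_ge0 ?sqrtr_ge0 ?expR_ge0.
pose g y := normal_pdf m s0 y; pose f y := normal_pdf (m + u) s y.
pose e y := expR (- (a / 2 * (y - m) ^+ 2) + b * (y - m)).
pose h y := w * (g y * e y).
have g0 y : 0 <= g y by exact: normal_pdf_ge0.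
have f0 y : 0 <= f y by exact: normal_pdf_ge0.
have h0 y : 0 <= h y by rewrite mulr_ge0// mulr_ge0 ?expR_ge0.
have hE y : h y ^+ 2 = g y * f y.
  rewrite /h /w /e !exprMn sqr_sqrtr; last by rewrite divr_ge0 ?(ltW sgt0) ?(ltW s0gt0).
  rewrite -!expRM_natr /f normal_pdfE_gt0// /g normal_pdfE_gt0//.
  set k := k2pi.
  have -> : expR (- ((y - (m + u)) ^+ 2 / (s ^+ 2 *+ 2))) =
    expR (- ((y - m) ^+ 2 / (s0 ^+ 2 *+ 2))) * expR (c * 2%:R) *
    expR ((- (a / 2 * (y - m) ^+ 2) + b * (y - m)) * 2%:R).
    rewrite -!expRD; congr expR; rewrite /a /b /c; field.
    by rewrite !gt_eqF.
  by field; rewrite !gt_eqF.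
have mgy : measurable_fun setT g by exact: measurable_normal_pdf.
have mfy : measurable_fun setT f by exact: measurable_normal_pdf.
have me : measurable_fun setT e.
  apply: measurableT_comp => //; apply: measurable_funD.
    apply: measurableT_comp => //; apply: measurable_funM => //.
    by apply: measurable_funX; exact: measurable_funB.
  by apply: measurable_funM => //; exact: measurable_funB.
have mge : measurable_fun setT (fun y => g y * e y) by exact: measurable_funM.
pose A := w * (p / s0 * expR (b ^+ 2 * p ^+ 2 / 2)).
have Ah : (\int[mu]_y (h y)%:E = A%:E)%E.
  rewrite /A EFinM -(integral_normal_quadratic m b s0gt0 p0 pE) -ge0_integralZl//.
  - exact/measurable_EFinP.
  - by move=> y _; rewrite lee_fin mulr_ge0 ?expR_ge0.
have [kap kapE] : exists kap, kap = eps / 4 by eexists.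
have kap0 : 0 < kap by rewrite kapE divr_gt0.
have bound : L1_dist g f <= 2 * (1 / (2 * kap) + kap) - A / kap.
  apply: L1_le; rewrite EFinB leeBrDr//.
  have -> : (A / kap)%:E = (\int[mu]_y (h y / kap)%:E)%E.
    rewrite mulrC EFinM -Ah -ge0_integralZl//.
    + by apply: eq_integral => y _; rewrite -EFinM mulrC.
    + by apply/measurable_EFinP; exact: measurable_funM.
    + by move=> y _; rewrite lee_fin.
    + by rewrite lee_fin invr_ge0 ltW.
  have mh : measurable_fun setT (fun y => (h y / kap)%:E).
    by apply/measurable_EFinP; apply: measurable_funM => //; exact: measurable_funM.
  have hk0 y : (0 <= (h y / kap)%:E)%E by rewrite lee_fin divr_ge0// ltW.
  have mgf : measurable_fun setT (fun y => (g y + f y)%:E).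
    by apply/measurable_EFinP; exact: measurable_funD.
  rewrite -ge0_integralD//; last exact: measurable_abs_diff.
  rewrite mulrC EFinM -(integral_two_pdf m s0 (m + u) s) -ge0_integralZl//; last 2 first.
  - by move=> y _; rewrite lee_fin addr_ge0.
  - by rewrite lee_fin addr_ge0 ?divr_ge0 ?mulr_ge0// ltW.
  apply: ge0_le_integral => //.
  - by move=> y _; apply: adde_ge0; [rewrite lee_fin|exact: hk0].
  - by apply: emeasurable_funD => //; exact: measurable_abs_diff.
  - exact: measurable_funeM.
  - by move=> y _; rewrite -EFinD -EFinM lee_fin; exact: abs_diff_le.
apply: (le_lt_trans bound).
pose r := rho ^+ 2 / s0 ^+ 2.
have s02 : 0 < s0 ^+ 2 by rewrite exprn_gt0.
have r4 : r <= 1 / 4.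
  rewrite /r ler_pdivrMr//; have : rho ^+ 2 <= (s0 / 2) ^+ 2.
    by rewrite ler_pXn2r ?nnegrE ?divr_ge0 ?(ltW rho0) ?(ltW s0gt0).
  by rewrite expr_div_n; clear; lra.
have r25 : r <= eps ^+ 2 / 25.
  rewrite /r ler_pdivrMr//; have : rho ^+ 2 <= (s0 * (eps / 5)) ^+ 2.
    by rewrite ler_pXn2r ?nnegrE ?mulr_ge0 ?divr_ge0 ?(ltW rho0) ?(ltW s0gt0) ?(ltW eps0).
  by rewrite exprMn expr_div_n; clear; lra.
have ss0 : s0 / 2 <= s by move: srho; rewrite ltr_norml => /andP[]; clear - rho1; lra.
have A1 : 1 - 2 * r <= A.
  (* [A] is the square root of [B] times two exponentials; the one involving [b] is at least [1],
     and the other two factors are at least [1 - r] each. *)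
  pose B := 2 * s * s0 / D.
  have AB : Num.sqrt (s0 / s) * (p / s0) = Num.sqrt B.
    have ps0 : 0 <= p / s0 by apply: divr_ge0; apply: ltW.
    have -> : p / s0 = Num.sqrt ((p / s0) ^+ 2) by rewrite sqrtr_sqr ger0_norm.
    rewrite -sqrtrM.
      by congr Num.sqrt; rewrite expr_div_n p2 /B; field; rewrite !gt_eqF.
    by rewrite divr_ge0 ?(ltW sgt0) ?(ltW s0gt0).
  have B0 : 0 <= B by rewrite divr_ge0 ?mulr_ge0 ?(ltW sgt0) ?(ltW s0gt0) ?(ltW D0).
  have BE : B = 1 - (s - s0) ^+ 2 / D by rewrite /B /D; field; rewrite gt_eqF.
  have B1 : B <= 1 by rewrite BE lerBlDr lerDl divr_ge0 ?sqr_ge0 ?(ltW D0).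
  have Br : 1 - r <= B.
    rewrite BE lerD2l lerN2 /r ler_pM ?sqr_ge0 ?invr_ge0 ?(ltW D0)//.
      rewrite -(real_normK (num_real (s - s0))) ler_pXn2r ?nnegrE ?(ltW rho0)//.
      exact: ltW.
    by rewrite lef_pV2 ?posrE// /D lerDr sqr_ge0.
  have sB : B <= Num.sqrt B.
    have BB : B = Num.sqrt (B ^+ 2) by rewrite sqrtr_sqr ger0_norm.
    by rewrite [leLHS]BB ler_sqrt// expr2 ler_piMr.
  have cr : 1 - r <= expR c.
    apply: le_trans (expR_ge1Dx _); rewrite lerD2l /c lerN2 /r.
    rewrite ler_pM ?sqr_ge0 ?invr_ge0 ?mulr_ge0 ?sqr_ge0 ?(ltW sgt0)//.
      rewrite -(real_normK (num_real u)) ler_pXn2r ?nnegrE ?(ltW rho0)//.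
      exact: ltW.
    rewrite lef_pV2 ?posrE ?mulr_gt0 ?exprn_gt0//.
    have : (s0 / 2) ^+ 2 <= s ^+ 2.
      by rewrite ler_pXn2r ?nnegrE ?divr_ge0 ?(ltW sgt0) ?(ltW s0gt0).
    by rewrite expr_div_n; clear; lra.
  have eb : 1 <= expR (b ^+ 2 * p ^+ 2 / 2).
    by rewrite -expR0 ler_expR divr_ge0// mulr_ge0// sqr_ge0.
  have -> : A = Num.sqrt B * expR c * expR (b ^+ 2 * p ^+ 2 / 2).
    by rewrite -AB /A /w; ring.
  apply: (@le_trans _ _ ((1 - r) * (1 - r) * 1)).
    by have := sqr_ge0 r; clear; lra.
  have r1 : 0 <= 1 - r by clear - r4; lra.
  by rewrite !ler_pM ?mulr_ge0 ?ler01// (le_trans Br).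
rewrite kapE.
have k1 : 0 < 1 / (eps / 4) by rewrite divr_gt0// divr_gt0.
have -> : 2 * (1 / (2 * (eps / 4)) + eps / 4) - A / (eps / 4) =
  eps / 2 + 4 / eps * (1 - A) by field; rewrite gt_eqF.
have e4 : 0 < 4 / eps by rewrite divr_gt0.
have h1 : 4 / eps * (1 - A) <= 4 / eps * (2 * (eps ^+ 2 / 25)).
  by rewrite ler_pM2l//; clear - A1 r25; lra.
rewrite (_ : 4 / eps * (2 * _) = 8 / 25 * eps) in h1; last by field; rewrite gt_eqF.
clear - h1 eps0; lra.
Qed.

End L1_between_normals.

(** * The criterion for [alpha > 0]: separation from the truth *)

Section dpd_regression.
Context {R : realType} d (T : measurableType d) (P : probability T R).
Variables (X : nat -> {RV P >-> R}) (k : nat) (t : nat -> 'rV[R]_k).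
Variables (theta0 : 'rV[R]_k * R) (alpha : R).
Hypothesis indX : mutually_independent X.
Hypothesis theta0_gt0 : 0 < theta0.2.
Hypothesis Xdens : forall i, has_density (X i) (reg_density t i theta0).
Hypothesis alpha_gt0 : 0 < alpha.
Implicit Types (theta : 'rV[R]_k * R) (b : 'rV[R]_k).

Local Notation s0 := (Num.sqrt theta0.2).
Local Notation lin i b := ((t i *m b^T) ord0 ord0).
Let m i : R := lin i theta0.1.

Let s0_gt0 : 0 < s0. Proof. by rewrite sqrtr_gt0. Qed.

Let Xm i : has_density (X i) (normal_pdf (m i) s0). Proof. exact: Xdens. Qed.

Local Notation kern := (gkern alpha).
Local Notation mean := (gkern_mean alpha s0).
Local Notation pp := (peak_pow alpha).
Local Notation cst3 := (dpd_const alpha).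
Local Notation risk := (dpd_risk alpha s0).
Local Notation risk0 := (dpd_risk0 alpha s0).

Lemma lin_sub i theta : lin i theta.1 = m i + lin i (theta.1 - theta0.1).
Proof. by rewrite linearB/= mulmxBr !mxE /m mxE addrCA subrr addr0. Qed.

Lemma q_alphaE i theta y : 0 < theta.2 ->
  q_alpha alpha (reg_density t i theta) y =
  pp (Num.sqrt theta.2) *
    (kern (Num.sqrt theta.2) (y - lin i theta.1) / alpha - cst3) - alpha^-1.
Proof.
move=> v0; rewrite /q_alpha gt_eqF// /reg_density.
set s := Num.sqrt theta.2; have sgt0 : 0 < s by rewrite sqrtr_gt0.
rewrite /Rintegral integral_normal_pdf_powR ?(ltW alpha_gt0)//=.
rewrite normal_pdfE_gt0// powRM ?expR_ge0//; last by rewrite divr_ge0 ?ltW ?k2pi_gt0.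
rewrite -expRM -/(peak_pow alpha s) /cst3 /gkern.
have -> : - ((y - lin i theta.1) ^+ 2 / (s ^+ 2 *+ 2)) * alpha =
          - (alpha * (y - lin i theta.1) ^+ 2 / (s ^+ 2 *+ 2)).
  by field; rewrite gt_eqF.
have a1 := alpha1_gt0 alpha_gt0.
by field; rewrite !gt_eqF// sqrtr_gt0.
Qed.

Lemma q_nE n (x : nat -> R) theta : 0 < theta.2 ->
  q_n (reg_density t) alpha n x theta = pp (Num.sqrt theta.2) *
   ((\sum_(i < n) kern (Num.sqrt theta.2) (x i - m i - lin i (theta.1 - theta0.1))) / alpha
     - n%:R * cst3) - n%:R / alpha.
Proof.
move=> v0; rewrite /q_n (eq_bigr _ (fun (i : 'I_n) _ => q_alphaE i (x i) v0)).
rewrite sumrB sum_ord_const -mulr_sumr sumrB -mulr_suml sum_ord_const.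
set A := \sum_(i < n) _; set B := \sum_(i < n) _; suff -> : A = B by [].
by apply: eq_bigr => i _; rewrite lin_sub opprD addrA.
Qed.

Let kern_llnP s (eta : R) : 0 < s -> 0 < eta ->
  whp P (fun n w => forall b, \sum_(i < n) kern s (X i w - m i - lin i b) <=
                              \sum_(i < n) mean s (lin i b) + n%:R * eta).
Proof.
move=> sgt0 eta0; apply: uniform_lln => //.
- apply: measurableT_comp => //; apply: measurableT_comp => //.
  by apply: measurable_funM => //; apply: measurable_funM => //; exact: measurable_funX.
- by move=> x; exact: gkern01.
- by move=> e e0; exact: gkern_unif.
- by move=> e e0; exact: gkern_infty.
- by move=> e e0; exact: (gaussian_tight s0_gt0 Xm e0).
- by move=> i u; exact: (gaussian_kernel_mean s0_gt0 Xm i u (ltW alpha_gt0) sgt0).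
Qed.

(** A lower bound at the truth alone, so the Chernoff bound for [1 - kern] suffices. *)
Let kern_lln0 (eta : R) : 0 < eta ->
  whp P (fun n w => n%:R * (mean s0 0 - eta) <= \sum_(i < n) kern s0 (X i w - m i)).
Proof.
wlog eta1 : eta / eta <= 1.
  move=> H eta0; have [eta1|eta1] := leP eta 1; first exact: H.
  apply: whpS (H 1 (lexx _) ltr01); apply: nearW => n w; apply: le_trans.
  by rewrite ler_wpM2l// lerD2l lerN2 ltW.
move=> eta0.
pose y (i : nat) x : R := 1 - kern s0 (x - m i).
have mk : measurable_fun setT (kern s0).
  apply: measurableT_comp => //; apply: measurableT_comp => //.
  by apply: measurable_funM => //; apply: measurable_funM => //; exact: measurable_funX.
have my i : measurable_fun setT (y i).
  apply: measurable_funB => //; apply: (measurableT_comp mk).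
  exact: measurable_funB.
have y01 i x : 0 <= y i x <= 1.
  by have := gkern01 alpha_gt0 s0 (x - m i); rewrite /y; lra.
have yE i : (\int[P]_w (y i (X i w))%:E = (1 - mean s0 0)%:E)%E.
  have mX (f : R -> R) : measurable_fun setT f ->
      measurable_fun setT (fun w => (f (X i w))%:E).
    by move=> mf; apply/measurable_EFinP; exact: measurableT_comp.
  have h : (\int[P]_w (y i (X i w))%:E + \int[P]_w (kern s0 (X i w - m i))%:E = 1%:E)%E.
    rewrite -ge0_integralD//.
    - rewrite -(integral_probability_cst P 1); apply: eq_integral => w _.
      by rewrite -EFinD /y subrK.
    - by move=> w _; rewrite lee_fin; case/andP: (y01 i (X i w)).
    - exact: mX.
    - by move=> w _; rewrite lee_fin expR_ge0.
    - apply: (mX (fun x => kern s0 (x - m i))); apply: (measurableT_comp mk).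
      exact: measurable_funB.
  have h2 : (\int[P]_w (kern s0 (X i w - m i))%:E = (mean s0 0)%:E)%E.
    rewrite -(gaussian_kernel_mean s0_gt0 Xm i 0 (ltW alpha_gt0) s0_gt0).
    by apply: eq_integral => w _; rewrite subr0.
  move: h; rewrite h2 => /(congr1 (fun z => z - (mean s0 0)%:E)%E).
  by rewrite addeK// EFinB.
pose bad n := [set w | \sum_(i < n) (1 - mean s0 0) + n%:R * eta <= \sum_(i < n) y i (X i w)].
apply: (@whp_bound _ _ _ _ _ bad (fun n => expR (- (n%:R * (eta ^+ 2 / 8))))).
- move=> n; have mS : measurable_fun setT (fun w => \sum_(i < n) y i (X i w)).
    by apply: measurable_sum => i; exact: (measurableT_comp (my i)).
  rewrite (_ : bad n = setT `&` (fun w => \sum_(i < n) y i (X i w)) @^-1` `[\sum_(i < n) (1 - mean s0 0) + n%:R * eta, +oo[).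
    exact: mS.
  by apply/seteqP; split=> w /=; rewrite in_itv/= andbT // => -[].
- move=> n w /negP; rewrite -ltNge /y !sumrB !sum_ord_const; lra.
- by move=> n; apply: (chernoff_bounded indX n _ my y01 yE); rewrite eta0.
- by apply: cvg_expR_mulrn; rewrite divr_gt0 ?exprn_gt0.
Qed.

(** Adding [n / alpha] removes the constant term of the criterion, which leaves [peak_pow] times a
    bracket whose sign decides. *)
Local Notation Qn n w theta :=
  (q_n (reg_density t) alpha n (fun i => X i w) theta + n%:R / alpha).

Let QnE n w theta : 0 < theta.2 -> Qn n w theta = pp (Num.sqrt theta.2) *
   ((\sum_(i < n) kern (Num.sqrt theta.2) (X i w - m i - lin i (theta.1 - theta0.1))) / alpha
     - n%:R * cst3).
Proof. by move=> v0; rewrite q_nE// subrK. Qed.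

Let c3_gt0 : 0 < cst3. Proof. exact: dpd_const_gt0. Qed.

Let risk0_gt0 : 0 < risk0. Proof. exact: dpd_risk0_gt0. Qed.

Let kern_sum_le n (x : nat -> R) s s' : 0 < s -> s <= s' ->
  \sum_(i < n) kern s (x i) <= \sum_(i < n) kern s' (x i).
Proof. by move=> sgt0 ss'; apply: ler_sum => i _; exact: gkern_le. Qed.

(** Kernels are at most [1], so the shifted criterion is at most [n peak_pow / alpha], which is
    small for large scales whatever the sample. *)
Let large_scale : exists2 smax, 0 < smax & forall n w theta, 0 < theta.2 ->
  smax <= Num.sqrt theta.2 -> Qn n w theta <= n%:R * (risk0 / 2).
Proof.
pose c := alpha * risk0 / 2; have c0 : 0 < c by rewrite divr_gt0// mulr_gt0.
have k0 := @k2pi_gt0 R.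
(* The solution of [peak_pow smax = alpha risk0 / 2]. *)
pose smax : R := (Num.sqrt (pi *+ 2))^-1 / (c `^ alpha^-1).
have smax0 : 0 < smax by rewrite divr_gt0// powR_gt0.
have ppmax : pp smax = c.
  rewrite /peak_pow /smax invf_div mulrCA divff ?gt_eqF// mulr1.
  by rewrite -powRrM mulVf ?gt_eqF// powRr1// ltW.
exists smax => // n w theta v0 hs; rewrite QnE//.
set s := Num.sqrt theta.2 in hs *; have sgt0 : 0 < s by exact: lt_le_trans hs.
have pps : pp s <= c by rewrite -ppmax; exact: peak_pow_le.
have pps0 := peak_pow_gt0 alpha sgt0.
have K1 : \sum_(i < n) kern s (X i w - m i - lin i (theta.1 - theta0.1)) <= n%:R.
  rewrite -[leRHS]mulr1 -sum_ord_const; apply: ler_sum => i _.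
  by case/andP: (gkern01 alpha_gt0 s (X i w - m i - lin i (theta.1 - theta0.1))).
set K := \sum_(i < n) _ in K1 *.
have nc : 0 <= n%:R * cst3 by rewrite mulr_ge0// ltW.
apply: (@le_trans _ _ (pp s * (n%:R / alpha))).
  rewrite ler_pM2l// lerBlDr (le_trans (_ : _ <= n%:R / alpha)) ?lerDl//.
  by rewrite ler_pM2r ?invr_gt0.
apply: (@le_trans _ _ (c * (n%:R / alpha))).
  by rewrite ler_wpM2r// divr_ge0// ltW.
by rewrite le_eqVlt; apply/orP; left; apply/eqP; rewrite /c; field; rewrite gt_eqF.
Qed.

(** Here [peak_pow] is unbounded, so the bracket has to be nonpositive. Monotonicity in the scale
    reduces all small scales to [smin], where the mean kernel is at most half of [alpha cst3]; the
    other half allows for the deviation. *)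
Let small_scale : exists2 smin, 0 < smin & whp P (fun n w => forall theta,
  0 < theta.2 -> Num.sqrt theta.2 <= smin -> Qn n w theta <= n%:R * (risk0 / 2)).
Proof.
pose e := alpha * cst3 / 2; have e0 : 0 < e by rewrite divr_gt0// mulr_gt0.
have a0 : 0 < Num.sqrt alpha * s0 by rewrite mulr_gt0// sqrtr_gt0.
exists (e * (Num.sqrt alpha * s0)); first by rewrite mulr_gt0.
set smin := e * _; have smin0 : 0 < smin by rewrite mulr_gt0.
apply: whpS (kern_llnP smin0 e0); apply: nearW => n w lln theta v0 hs.
rewrite QnE//; set s := Num.sqrt theta.2 in hs *; have sgt0 : 0 < s by rewrite sqrtr_gt0.
apply: (@le_trans _ _ 0); last by rewrite mulr_ge0// divr_ge0// ltW.
rewrite pmulr_rle0 ?peak_pow_gt0// subr_le0 ler_pdivrMr//.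
apply: le_trans (kern_sum_le n
  (fun i => X i w - m i - lin i (theta.1 - theta0.1)) sgt0 hs) _.
apply: le_trans (lln _) _.
have : \sum_(i < n) mean smin (lin i (theta.1 - theta0.1)) <= \sum_(i < n) e.
  apply: ler_sum => i _; apply: le_trans (gkern_mean_le alpha_gt0 s0_gt0 _ smin0) _.
  by rewrite /smin mulfK// gt_eqF.
by rewrite sum_ord_const /e; lra.
Qed.

(** [smin] and [smax] precede [dl]: the gap of the risk depends on the range of scales, and [dl] is
    chosen from that gap. Between the two, a finite grid reduces the claim to the law for a fixed
    scale. *)
Let dpd_upper : exists smin smax, 0 < smin /\ forall dl, 0 < dl ->
  whp P (fun n w => forall theta, 0 < theta.2 ->
    Qn n w theta <= n%:R * (risk0 / 2) \/
    (smin <= Num.sqrt theta.2 <= smax /\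
     Qn n w theta <=
       \sum_(i < n) risk (Num.sqrt theta.2) (lin i (theta.1 - theta0.1)) + n%:R * dl)).
Proof.
have [smax smax0 hmax] := large_scale; have [smin smin0 hmin] := small_scale.
exists smin, smax; split => // dl dl0.
have pmin := peak_pow_gt0 alpha smin0.
(* [eta] is lost twice, in the law at a grid point and in returning from it to [s], and each loss is
   multiplied by at most [peak_pow smin / alpha]. *)
have [eta etaE] : exists eta, eta = alpha * dl / (2 * pp smin) by eexists.
have eta0 : 0 < eta by rewrite etaE divr_gt0 ?mulr_gt0.
have [l lE] : exists l, l = Num.sqrt (1 + eta) by eexists.
have l2 : l ^+ 2 - 1 = eta.
  by rewrite lE sqr_sqrtr ?addr_ge0 ?ltW//; ring.
have l0 : 0 <= l by rewrite lE sqrtr_ge0.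
have l1 : 1 < l by have := sqr_ge0 (l - 1); nra.
(* With this step the first grid point above [s] is at most [l s], and [l^2 - 1 = eta] is the loss
   in [gkern_scale_le]. *)
pose h := smin * (l - 1); have h0 : 0 < h by rewrite mulr_gt0// subr_gt0.
have [J hJ] : exists J : nat, smax < smin + J%:R * h.
  exists (Num.truncn (smax / h)).+1.
  have : smax / h < (Num.truncn (smax / h)).+1%:R by rewrite truncnS_gt.
  by rewrite ltr_pdivrMr//; lra.
pose sg (j : nat) := smin + j%:R * h.
have sg0 j : 0 < sg j by rewrite ltr_wpDr// mulr_ge0// ltW.
have grid : whp P (fun n w => forall j : 'I_J.+1, forall b,
    \sum_(i < n) kern (sg j) (X i w - m i - lin i b) <=
    \sum_(i < n) mean (sg j) (lin i b) + n%:R * eta).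
  by apply: whp_forall => j; exact: kern_llnP.
apply: whpS (whpI hmin grid); apply: nearW => n w [hmin' lln] theta v0.
set s := Num.sqrt theta.2; have sgt0 : 0 < s by rewrite sqrtr_gt0.
have [sm|ms] := leP s smin; first by left; exact: hmin'.
have [Ms|sM] := leP smax s; first by left; exact: hmax.
right; split; first by rewrite (ltW ms) (ltW sM).
have exj : exists j : nat, s <= sg j by exists J; rewrite ltW// (lt_trans sM).
case: (ex_minnP exj) => j sj jmin.
have jJ : (j < J.+1)%N by rewrite ltnS jmin// ltW// (lt_trans sM).
have sjl : sg j <= l * s.
  have lh : smin * l <= s * l by rewrite ler_wpM2r// ltW.
  case: j sj jmin {jJ} => [|j] sj jmin.
    have : smin <= smin * l by rewrite ler_peMr// ltW.
    by rewrite /sg mul0r addr0; lra.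
  have : ~~ (s <= sg j) by apply/negP => /jmin; rewrite ltnn.
  rewrite -ltNge /sg -natr1 mulrDl mul1r /h => sj'.
  have : (s - smin) * (l - 1) >= 0 by rewrite mulr_ge0// subr_ge0 ltW.
  move: sj'; set u := _%:R * _; lra.
have := lln (Ordinal jJ) (theta.1 - theta0.1); rewrite /= => llnj.
rewrite QnE// -/s; set b := theta.1 - theta0.1 in llnj *.
have K1 := le_trans (kern_sum_le n (fun i => X i w - m i - lin i b) sgt0 sj) llnj.
have mean_l u : mean (sg j) u <= mean s u + eta.
  have mk z : measurable_fun setT (fun w => (kern z (X 0%N w - m 0%N - u))%:E).
    apply/measurable_EFinP; apply: (measurableT_comp (f := kern z)).
      apply: measurableT_comp => //; apply: measurableT_comp => //.
      by apply: measurable_funM => //; apply: measurable_funM => //; exact: measurable_funX.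
    by apply: measurable_funB => //; exact: measurable_funB.
  rewrite -lee_fin EFinD.
  rewrite -(gaussian_kernel_mean s0_gt0 Xm 0%N u (ltW alpha_gt0) (sg0 j)).
  rewrite -(gaussian_kernel_mean s0_gt0 Xm 0%N u (ltW alpha_gt0) sgt0).
  rewrite -(integral_probability_cst P eta) -ge0_integralD//; last 2 first.
  - exact: mk.
  - by move=> x _; rewrite lee_fin ltW.
  apply: ge0_le_integral => //.
  - exact: mk.
  - by apply: emeasurable_funD => //; exact: mk.
  - move=> x _; rewrite -EFinD lee_fin -l2.
    exact: (gkern_scale_le alpha_gt0 _ sgt0 (sg0 j) sjl (ltW l1)).
have K2 : \sum_(i < n) mean (sg j) (lin i b) <= \sum_(i < n) (mean s (lin i b) + eta).
  by apply: ler_sum => i _; exact: mean_l.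
rewrite big_split/= sum_ord_const in K2.
rewrite /dpd_risk -mulr_sumr sumrB -mulr_suml sum_ord_const.
have pps := peak_pow_gt0 alpha sgt0.
have ppsm : pp s <= pp smin by apply: peak_pow_le => //; exact: ltW.
set A := \sum_(i < n) kern s _ in K1 *; set B := \sum_(i < n) mean s _ in K2 *.
have K3 : A / alpha <= (B + 2 * (n%:R * eta)) / alpha.
  by rewrite ler_pM2r ?invr_gt0//; lra.
apply: (@le_trans _ _ (pp s * ((B + 2 * (n%:R * eta)) / alpha - n%:R * cst3))).
  by rewrite ler_pM2l// lerD2r.
rewrite (_ : pp s * (_ - _) =
   pp s * (B / alpha - n%:R * cst3) + n%:R * (pp s * (2 * eta / alpha))); last first.
  by field; rewrite gt_eqF.
rewrite lerD2l ler_wpM2l//.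
apply: (@le_trans _ _ (pp smin * (2 * eta / alpha))).
  by rewrite ler_wpM2r// divr_ge0 ?mulr_ge0// ltW.
by rewrite le_eqVlt; apply/orP; left; apply/eqP; rewrite etaE; field; rewrite !gt_eqF.
Qed.

(** Linear in the distance, because only its average over the observations is controlled. For
    distances up to [eps] the bound [risk0] is enough; beyond, there is a fixed gap, and no distance
    exceeds [2], whence the slope. *)
Let risk_L1 eps smin smax : 0 < eps -> 0 < smin ->
  exists2 dl, 0 < dl & forall s u mm, smin <= s <= smax ->
    risk s u <= risk0 - dl * (L1_dist (normal_pdf mm s0) (normal_pdf (mm + u) s) - eps).
Proof.
move=> eps0 smin0; have [rho rho0 near0] := L1_dist_normal_near s0_gt0 eps0.
have [dl dl0 gap] := dpd_risk_gap alpha_gt0 s0_gt0 smax rho0 smin0.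
exists (dl / 2); first by rewrite divr_gt0.
move=> s u mm hs; have sgt0 : 0 < s by case/andP: hs => h _; exact: lt_le_trans h.
set D := L1_dist _ _.
have [De|De] := leP D eps.
  have := dpd_risk_le alpha_gt0 s0_gt0 u sgt0.
  have : dl / 2 * (D - eps) <= 0 by rewrite pmulr_rle0 ?divr_gt0// subr_le0.
  lra.
have far : rho <= `|u| \/ rho <= `|s - s0|.
  have [h1|h1] := leP rho `|u|; first by left.
  have [h2|h2] := leP rho `|s - s0|; first by right.
  by have := near0 mm u s sgt0 h1 h2; rewrite -/D ltNge (ltW De).
have := gap s u hs far; have := L1_dist_normal_le2 mm s0 (mm + u) s.
rewrite -/D => D2.
have : dl / 2 * (D - eps) <= dl / 2 * 2 by rewrite ler_pM2l ?divr_gt0//; lra.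
lra.
Qed.

Let arith1 (N q1 q0 na r D : R) : q1 + na <= N * (r / 2) -> N * (r - D) <= q0 + na ->
  0 <= N * D -> N * D <= N * (r / 8) -> 0 <= N * r -> N * D <= N * (1 / 2) ->
  q1 <= q0 + N /\ q1 <= q0 - N * (2 * D).
Proof. by move=> *; split; lra. Qed.

Let arith2 (N q1 q0 na r D Rs : R) : q1 + na <= Rs + N * D -> Rs <= N * r ->
  N * (r - D) <= q0 + na -> N * D <= N * (1 / 2) -> q1 <= q0 + N.
Proof. by move=> *; lra. Qed.

Let arith3 (N q1 q0 na r D Rs g L e : R) : q1 + na <= Rs + N * D ->
  Rs <= N * r - g * (L - N * (e / 2)) -> g * (N * (e / 2)) <= g * (L - N * (e / 2)) ->
  N * D <= N * (g * (e / 2) / 4) -> N * (r - D) <= q0 + na -> q1 <= q0 - N * (2 * D).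
Proof. by move=> *; lra. Qed.

Let arith4 (N e L : R) : N * e <= L -> N * (e / 2) <= L - N * (e / 2).
Proof. by move=> *; lra. Qed.

Lemma dpd_separation (eps : R) : 0 < eps ->
  exists dl, 0 < dl /\ whp P (fun n w => forall theta, 0 < theta.2 ->
    q_n (reg_density t) alpha n (fun i => X i w) theta <=
      q_n (reg_density t) alpha n (fun i => X i w) theta0 + n%:R /\
    (n%:R * eps <= \sum_(i < n) L1_dist (reg_density t i theta0) (reg_density t i theta) ->
     q_n (reg_density t) alpha n (fun i => X i w) theta <=
      q_n (reg_density t) alpha n (fun i => X i w) theta0 - n%:R * (2 * dl))).
Proof.
move=> eps0; have [smin [smax [smin0 upper]]] := dpd_upper.
have e20 : 0 < eps / 2 by rewrite divr_gt0.
have [gap gap0 hgap] := risk_L1 smax e20 smin0.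
(* Far from the truth the loss is at least [4 n D]: one part for the law, one for the lower bound at
   the truth, two for the claim. The bound [1 / 2] serves the crude estimate with [n]. *)
have [D DE] : exists D, D = Num.min (gap * (eps / 2) / 4) (Num.min (risk0 / 8) (1 / 2)) by eexists.
have D0 : 0 < D by rewrite DE !lt_min !divr_gt0// mulr_gt0.
have D1 : D <= gap * (eps / 2) / 4 by rewrite DE ge_min lexx.
have D2 : D <= risk0 / 8 by rewrite DE !ge_min lexx orbT.
have D3 : D <= 1 / 2 by rewrite DE !ge_min lexx !orbT.
exists D; split => //.
have pps0 := peak_pow_gt0 alpha s0_gt0.
have eta0 : 0 < D * alpha / pp s0 by rewrite divr_gt0// mulr_gt0.
apply: whpS (whpI (upper D D0) (kern_lln0 eta0)); apply: nearW => n w [up low] theta v0.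
have low' : n%:R * (risk0 - D) <= Qn n w theta0.
  rewrite QnE// -(dpd_risk_at0 alpha_gt0 s0_gt0) /dpd_risk.
  have -> : \sum_(i < n) kern s0 (X i w - m i - lin i (theta0.1 - theta0.1)) =
            \sum_(i < n) kern s0 (X i w - m i).
    by apply: eq_bigr => i _; rewrite subrr linear0 mulmx0 mxE subr0.
  set K := \sum_(i < n) _ in low *.
  apply: (@le_trans _ _ (pp s0 * (n%:R * (mean s0 0 - D * alpha / pp s0) / alpha - n%:R * cst3))).
    by rewrite le_eqVlt; apply/orP; left; apply/eqP; field; rewrite !gt_eqF.
  by rewrite ler_pM2l// lerD2r ler_pM2r ?invr_gt0.
have nD : 0 <= n%:R * D by rewrite mulr_ge0// ltW.
have nD1 : n%:R * D <= n%:R * (gap * (eps / 2) / 4) by rewrite ler_wpM2l.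
have nD2 : n%:R * D <= n%:R * (risk0 / 8) by rewrite ler_wpM2l.
have nD3 : n%:R * D <= n%:R * (1 / 2) by rewrite ler_wpM2l.
have nr : 0 <= n%:R * risk0 by rewrite mulr_ge0// ltW.
have [u1|[hs u2]] := up theta v0.
  have [h1 h2] := arith1 u1 low' nD nD2 nr nD3.
  by split => [|_].
set s := Num.sqrt theta.2 in hs u2.
have risk_sum : \sum_(i < n) risk s (lin i (theta.1 - theta0.1)) <= n%:R * risk0 -
    gap * (\sum_(i < n) L1_dist (reg_density t i theta0) (reg_density t i theta) - n%:R * (eps / 2)).
  rewrite -!sum_ord_const -sumrB mulr_sumr -sumrB; apply: ler_sum => i _.
  have := hgap s (lin i (theta.1 - theta0.1)) (m i) hs.
  by rewrite /reg_density (lin_sub i theta).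
have risk_sum0 : \sum_(i < n) risk s (lin i (theta.1 - theta0.1)) <= n%:R * risk0.
  rewrite -sum_ord_const; apply: ler_sum => i _; apply: dpd_risk_le => //.
  by rewrite sqrtr_gt0.
split => [|L1n]; first exact: arith2 u2 risk_sum0 low' nD3.
have g1 : gap * (n%:R * (eps / 2)) <= gap * (\sum_(i < n)
    L1_dist (reg_density t i theta0) (reg_density t i theta) - n%:R * (eps / 2)).
  by rewrite ler_pM2l//; exact: arith4.
exact: arith3 u2 risk_sum g1 nD1 low'.
Qed.

End dpd_regression.

(** * Continuity of logarithm, scale and predictors; boundedness of the design *)

Section continuity_near_the_truth.
Context {R : realType}.
Implicit Types (rho s v x : R).

Lemma ln_le_subr1 x : 0 < x -> ln x <= x - 1.
Proof. by move=> x0; have := expR_ge1Dx (ln x); rewrite lnK ?posrE//; lra. Qed.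

Lemma ln_1B_ge x : 0 <= x -> x <= 1 / 2 -> - (2 * x) <= ln (1 - x).
Proof.
move=> x0 x12; have x1 : 0 < 1 - x by lra.
have := ln_le_subr1 (divr_gt0 ltr01 x1); rewrite ln_div ?posrE// ln1 sub0r => h.
have : 1 / (1 - x) - 1 <= 2 * x; last by clear - h; lra.
rewrite lerBlDr ler_pdivrMr//; have := ler_wpM2l x0 x12; clear - x0; lra.
Qed.

Lemma ln_ratio_le s0 s : 0 < s0 -> 0 < s -> `|s - s0| <= s0 / 2 ->
  `|ln (s / s0)| <= 2 * `|s - s0| / s0.
Proof.
move=> s00 sgt0 ss0.
have h1 := ln_le_subr1 (divr_gt0 sgt0 s00); have h2 := ln_le_subr1 (divr_gt0 s00 sgt0).
have lnN : ln (s0 / s) = - ln (s / s0) by rewrite -lnV ?posrE ?divr_gt0// invf_div.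
rewrite lnN in h2.
have n1 := ler_norm (s - s0); have n2 := ler_norm (- (s - s0)); rewrite normrN in n2.
have s2 : s0 / 2 <= s by lra.
have e1 : s / s0 - 1 <= `|s - s0| / s0.
  by rewrite ler_pdivlMr// mulrBl mul1r divfK ?gt_eqF.
have e2 : s0 / s - 1 <= 2 * `|s - s0| / s0.
  rewrite ler_pdivlMr// mulrBl mul1r mulrAC lerBlDr ler_pdivrMr//.
  have : (s - s0) * s0 + `|s - s0| * s0 >= 0.
    by rewrite -mulrDl mulr_ge0 ?(ltW s00)//; lra.
  have : `|s - s0| * s0 <= `|s - s0| * (2 * s) by rewrite ler_wpM2l//; lra.
  lra.
have e3 : 0 <= `|s - s0| / s0 by rewrite divr_ge0// ltW.
by rewrite ler_norml; apply/andP; split; lra.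
Qed.

Lemma sqrt_near (v0 rho : R) : 0 < v0 -> 0 < rho ->
  exists2 rho', 0 < rho' & forall v, 0 < v -> `|v - v0| < rho' ->
    `|Num.sqrt v - Num.sqrt v0| < rho.
Proof.
move=> v00 rho0; have q0 : 0 < Num.sqrt v0 by rewrite sqrtr_gt0.
exists (rho * Num.sqrt v0); first by rewrite mulr_gt0.
move=> v vgt0 vv; have q1 : 0 < Num.sqrt v by rewrite sqrtr_gt0.
rewrite -(ltr_pM2r q0); apply: le_lt_trans vv.
have -> : v - v0 = (Num.sqrt v - Num.sqrt v0) * (Num.sqrt v + Num.sqrt v0).
  by rewrite -subr_sqr !sqr_sqrtr ?ltW.
by rewrite normrM ler_wpM2l// ger0_norm ?lerDr ?(ltW q1)// addr_ge0 ?(ltW q1) ?(ltW q0).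
Qed.

Lemma lin_near (k : nat) (t : nat -> 'rV[R]_k) (M rho : R) : 0 <= M -> 0 < rho ->
    (forall i j, `|t i ord0 j| <= M) ->
  exists2 rho', 0 < rho' & forall b : 'rV[R]_k, (forall j, `|b ord0 j| < rho') ->
    forall i, `|(t i *m b^T) ord0 ord0| < rho.
Proof.
move=> M0 rho0 tM; have D0 : 0 < M * k%:R + 1 by rewrite ltr_wpDl// mulr_ge0.
exists (rho / (M * k%:R + 1)); first by rewrite divr_gt0.
move=> b hb i; set rho' := rho / _ in hb.
have r0 : 0 < rho' by rewrite divr_gt0.
apply: (@le_lt_trans _ _ (\sum_(j < k) M * rho')).
  rewrite mxE; apply: le_trans (ler_norm_sum _ _ _) _; apply: ler_sum => j _.
  by rewrite mxE normrM ler_pM// ltW.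
rewrite sum_ord_const; have -> : rho = rho' * (M * k%:R + 1).
  by rewrite /rho' divfK// gt_eqF.
by rewrite mulrDr mulr1; move: r0; set z := rho'; lra.
Qed.

Lemma bounded_design (k : nat) (t : nat -> 'rV[R]_k) : R1_condition t ->
  exists2 M, 0 <= M & forall i j, `|t i ord0 j| <= M.
Proof.
move=> R1.
have Mj j : exists M, forall i, `|t i ord0 j| <= M.
  have [+ _ _] := R1 j j j; set S := ereal_sup _ => Slt.
  have Sge n : (1 < n)%N -> ((\big[Num.max/0]_(i < n) `|t i ord0 j|)%:E <= S)%E.
    by move=> n1; apply: ereal_sup_ubound; exists n.
  have Sfin : S \is a fin_num.
    rewrite ge0_fin_numE//; apply: le_trans (Sge 2%N _) => //.
    by rewrite lee_fin; apply: bigmax_ge_id.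
  exists (fine S) => i; rewrite -lee_fin fineK//.
  (* The supremum is over [n > 1]; [i.+2] exceeds both [1] and [i]. *)
  apply: le_trans (Sge i.+2 _) => //; rewrite lee_fin.
  have lti : (i < i.+2)%N by [].
  exact: (le_bigmax _ (fun i : 'I_(_) => `|t i ord0 j|) (Ordinal lti)).
have /choice[M HM] := Mj.
exists (\sum_j `|M j|); first exact: sumr_ge0.
move=> i j; apply: le_trans (HM j i) _; rewrite (bigD1 j)//=.
by rewrite (le_trans (ler_norm _))// lerDl sumr_ge0.
Qed.

End continuity_near_the_truth.

(** * The criterion for [alpha > 0] near the truth *)

Section dpd_near.
Context {R : realType} (alpha s0 : R).
Hypotheses (alpha_gt0 : 0 < alpha) (s0_gt0 : 0 < s0).
Local Notation kern := (gkern alpha).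
Local Notation pp := (peak_pow alpha).
Local Notation cst3 := (dpd_const alpha).

Lemma peak_powE s : 0 < s -> pp s = pp s0 * expR (- (alpha * ln (s / s0))).
Proof.
move=> sgt0; have sE : s = s0 * expR (ln (s / s0)).
  by rewrite lnK ?posrE ?divr_gt0// mulrC divfK// gt_eqF.
rewrite {1}sE /peak_pow invfM mulrA powRM ?divr_ge0 ?invr_ge0 ?expR_ge0 ?(ltW s0_gt0)//.
by rewrite -expRN -expRM mulNr (mulrC (ln _)).
Qed.

(** The bound is uniform in the residual [e], as kernels are bounded and uniformly continuous; hence
    no exceptional event is involved. *)
Lemma dpd_obs_near (dl : R) : 0 < dl ->
  exists2 rho, 0 < rho & forall u s e, 0 < s -> `|u| < rho -> `|s - s0| < rho ->
    pp s0 * (kern s0 e / alpha - cst3) - dl <= pp s * (kern s (e - u) / alpha - cst3).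
Proof.
move=> dl0; have p0 := peak_pow_gt0 alpha s0_gt0.
have c0 : 0 < cst3 by exact: dpd_const_gt0.
have ia : 0 < alpha^-1 by rewrite invr_gt0.
have [B BE] : exists B, B = alpha^-1 + cst3 by eexists.
have B0 : 0 < B by rewrite BE addr_gt0.
(* [dl] is halved: [e1] bounds the relative change of the peak, and [e2] the change of the kernel,
   itself halved between shift and scale. *)
have [e1 e1E] : exists e1, e1 = Num.min 1 (dl / (2 * pp s0 * B)) by eexists.
have e10 : 0 < e1 by rewrite e1E lt_min ltr01 divr_gt0// !mulr_gt0.
have e11 : e1 <= 1 by rewrite e1E ge_min lexx.
have e1d : e1 * (2 * pp s0 * B) <= dl.
  by rewrite -ler_pdivlMr ?mulr_gt0// e1E ge_min lexx orbT.
have [e2 e2E] : exists e2, e2 = dl * alpha / (4 * pp s0) by eexists.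
have e20 : 0 < e2 by rewrite e2E divr_gt0 ?mulr_gt0.
have [mesh mesh0 hmesh] := gkern_unif alpha_gt0 s0_gt0 (divr_gt0 e20 (ltr0Sn R 1)).
have [z ze] : exists z, z = Num.min (Num.min (1 / 4) (e2 / 8)) (e1 / 2 / alpha) by eexists.
have z0 : 0 < z by rewrite ze !lt_min !divr_gt0.
have z1 : z <= 1 / 4 by rewrite ze !ge_min lexx.
have z2 : z <= e2 / 8 by rewrite ze !ge_min lexx orbT.
have z3 : alpha * z <= e1 / 2 by rewrite mulrC -ler_pdivlMr// ze !ge_min lexx orbT.
exists (Num.min mesh (Num.min (s0 / 2) (z * s0 / 2))).
  by rewrite !lt_min mesh0 !divr_gt0// mulr_gt0.
move=> u s e sgt0; rewrite !lt_min => /andP[um _] /andP[_ /andP[ss0 ssz]].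
pose y := ln (s / s0).
have yz : `|y| <= z.
  apply: le_trans (ln_ratio_le s0_gt0 sgt0 (ltW ss0)) _.
  by rewrite ler_pdivrMr//; clear - alpha_gt0 s0_gt0 ssz; lra.
have ay : `|- (alpha * y)| <= e1 / 2.
  by rewrite normrN normrM gtr0_norm// (le_trans _ z3)// ler_pM2l.
have E1 : `|expR (- (alpha * y)) - 1| <= e1.
  by apply: le_trans (norm_expRB1_le _) _; clear - alpha_gt0 s0_gt0 ay e11; lra.
have ppsE : pp s = pp s0 * expR (- (alpha * y)) by exact: peak_powE.
move: E1; set E := expR _ in ppsE *; rewrite ler_norml => /andP[E1 E2].
have Kle : kern s0 e <= kern s (e - u) + e2.
  apply: (@le_trans _ _ (kern s0 (e - u) + e2 / 2)).
    by apply: hmesh; rewrite opprB addrC subrK ltW.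
  have sl : s0 <= expR `|y| * s.
    have -> : s0 = expR (- y) * s.
      by rewrite expRN lnK ?posrE ?divr_gt0// invf_div divfK// gt_eqF.
    by rewrite ler_pM2r// ler_expR -normrN ler_norm.
  have l1 : 1 <= expR `|y| by rewrite -expR0 ler_expR.
  have := gkern_scale_le alpha_gt0 (e - u) sgt0 s0_gt0 sl l1.
  have : expR `|y| ^+ 2 - 1 <= e2 / 2.
    rewrite -expRM_natr; apply: le_trans (ler_norm _) _.
    have y2 : `| `|y| * 2%:R| = `|y| * 2 by rewrite ger0_norm// mulr_ge0.
    apply: le_trans (norm_expRB1_le _) _; rewrite y2; first by clear - alpha_gt0 s0_gt0 yz z1; lra.
    by clear - alpha_gt0 s0_gt0 yz z2; lra.
  by clear - alpha_gt0 s0_gt0; lra.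
have /andP[K0 K1] := gkern01 alpha_gt0 s0 e.
set K := kern s0 e in Kle K0 K1 *; set K' := kern s (e - u) in Kle *.
have q0 : 0 < pp s by exact: peak_pow_gt0.
have h1 := ler_wpM2l (ltW q0) (ler_wpM2r (ltW ia) Kle).
have h2 : pp s0 * (1 - e1) <= pp s by rewrite ppsE ler_pM2l//; clear - alpha_gt0 s0_gt0 E1; lra.
have h3 : pp s <= pp s0 * (1 + e1) by rewrite ppsE ler_pM2l//; clear - alpha_gt0 s0_gt0 E2; lra.
have h4 := ler_wpM2r (mulr_ge0 K0 (ltW ia)) h2.
have h5 := ler_wpM2r (ltW c0) h3.
have h6 : pp s * (e2 / alpha) <= pp s0 * 2 * (e2 / alpha).
  by rewrite ler_wpM2r ?divr_ge0 ?(ltW e20) ?(ltW alpha_gt0)// (le_trans h3)// ler_pM2l//; clear - alpha_gt0 s0_gt0 e11; lra.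
have h7 : pp s0 * 2 * (e2 / alpha) = dl / 2.
  by rewrite e2E; field; rewrite !gt_eqF.
have h8 : pp s0 * e1 * (K * alpha^-1) <= pp s0 * e1 * (1 * alpha^-1).
  by rewrite ler_wpM2l ?mulr_ge0 ?(ltW p0) ?(ltW e10)// ler_wpM2r ?(ltW ia).
have h9 : e1 * (2 * pp s0 * B) = 2 * (pp s0 * e1 * (1 * alpha^-1)) + 2 * (pp s0 * e1 * cst3).
  by rewrite BE; ring.
rewrite h9 in e1d.
move: h1 h4 h5 h6 h7 h8 e1d.
set a1 := alpha^-1; set c := cst3; set p := pp s; set p' := pp s0.
by clear - alpha_gt0 s0_gt0; lra.
Qed.

End dpd_near.

(** * Quadratic forms and the smallest eigenvalue *)

Section rayleigh.
Context {R : realType} (k : nat).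
Implicit Types b v : 'rV[R]_k.

Let continuous_sumr (T : topologicalType) (I : Type) (s : seq I) (f : I -> T -> R) :
  (forall i, continuous (f i)) -> continuous (fun x => \sum_(i <- s) f i x : R).
Proof.
move=> cf; elim: s => [|i s IH] x.
  by under eq_fun do rewrite big_nil; exact: cvg_cst.
have -> : (fun x => \sum_(i0 <- i :: s) f i0 x) = (fun x => f i x + \sum_(i0 <- s) f i0 x).
  by apply/funext => y; rewrite big_cons.
by apply: cvgD; [exact: cf|exact: IH].
Qed.

Let bil (A : 'M[R]_k) b v : R := (b *m A *m v^T) ord0 ord0.

Let bilDl A b b' v : bil A (b + b') v = bil A b v + bil A b' v.
Proof. by rewrite /bil !mulmxDl [LHS]mxE. Qed.

Let bilZl A z b v : bil A (z *: b) v = z * bil A b v.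
Proof. by rewrite /bil -!scalemxAl [LHS]mxE. Qed.

Let bilC A b v : A^T = A -> bil A b v = bil A v b.
Proof.
move=> AT; rewrite /bil -[in RHS](trmxK (v *m A *m b^T)) [RHS]mxE.
by rewrite !trmx_mul trmxK AT mulmxA.
Qed.

Let bilDr A b v v' : bil A b (v + v') = bil A b v + bil A b v'.
Proof. by rewrite /bil linearD/= mulmxDr [LHS]mxE. Qed.

Let bilZr A z b v : bil A b (z *: v) = z * bil A b v.
Proof. by rewrite /bil linearZ/= -scalemxAr [LHS]mxE. Qed.

Let qform (A : 'M[R]_k) b : R := (b *m A *m b^T) ord0 ord0.

Let sqn b : R := (b *m b^T) ord0 ord0.

Let sqnE b : sqn b = \sum_j b ord0 j ^+ 2.
Proof. by rewrite /sqn mxE; apply: eq_bigr => j _; rewrite mxE expr2. Qed.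

Let sqn_ge0 b : 0 <= sqn b.
Proof. by rewrite sqnE sumr_ge0// => j _; rewrite sqr_ge0. Qed.

Let sqn_eq0 b : sqn b = 0 -> b = 0.
Proof.
rewrite sqnE => /psumr_eq0P b0; apply/rowP => j; rewrite mxE.
by apply/eqP; rewrite -sqrf_eq0; apply/eqP; apply: b0 => // i _; rewrite sqr_ge0.
Qed.

Let continuous_qform A : continuous (qform A).
Proof.
have qE : qform A = fun b => \sum_j (\sum_i b ord0 i * A i j) * b ord0 j.
  by apply/funext => b; rewrite /qform mxE; apply: eq_bigr => j _; rewrite !mxE.
have cj j : continuous (fun b : 'rV[R]_k => b ord0 j) by exact: coord_continuous.
have cA j : continuous (fun b : 'rV[R]_k => \sum_i b ord0 i * A i j).
  apply: continuous_sumr => i b; apply: (@continuousM _ _ (fun b : 'rV[R]_k => b ord0 i) (fun=> A i j)).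
    exact: cj.
  exact: cst_continuous.
by rewrite qE; apply: continuous_sumr => j b; exact: (@continuousM _ _ _ (fun b : 'rV[R]_k => b ord0 j) _ (cA j b) (cj j b)).
Qed.

(* The minimum of the quadratic form on the unit sphere is an eigenvalue. *)
Lemma qform_ge_eigenvalue (A : 'M[R]_k) (c : R) : A^T = A ->
    (forall a, eigenvalue A a -> c <= a) ->
  forall b, c * \sum_j b ord0 j ^+ 2 <= (b *m A *m b^T) ord0 ord0.
Proof.
move=> AT Ac b; rewrite -sqnE -/(qform A b).
have [->|b0] := eqVneq b 0.
  by rewrite /sqn /qform !mul0mx mxE mulr0.
have qZ z v : qform A (z *: v) = z ^+ 2 * qform A v.
  by rewrite /qform -!scalemxAl linearZ/= -scalemxAr !mxE mulrA expr2.
have sZ z v : sqn (z *: v) = z ^+ 2 * sqn v.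
  by rewrite /sqn -!scalemxAl linearZ/= -scalemxAr !mxE mulrA expr2.
have sgt0 v : v != 0 -> 0 < sqn v.
  move=> v0; rewrite lt_neqAle sqn_ge0 andbT eq_sym; apply: contra_neq v0; exact: sqn_eq0.
pose S := [set v | sqn v = 1].
have unit v : v != 0 -> S ((Num.sqrt (sqn v))^-1 *: v).
  move=> v0; have v1 := sgt0 _ v0; rewrite /S/= sZ exprVn sqr_sqrtr ?mulVf ?gt_eqF//.
have cS : compact S.
  have cbox : compact [set v : 'rV[R]_k | forall i, `[(-1), 1]%classic (v ord0 i)].
    apply: (@rV_compact R^o k (fun=> `[(-1), 1]%classic)) => i.
    exact: segment_compact.
  apply: (subclosed_compact _ cbox) => [|v Sv i].
    rewrite (_ : S = sqn @^-1` [set 1]); last by [].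
    apply: preimage_closed; last exact: closed_eq.
    move=> v _; have <- : qform 1%:M = sqn by apply/funext => u; rewrite /qform mulmx1.
    exact: continuous_qform.
  rewrite /= in_itv/= -ler_norml -(@ler_pXn2r _ 2) ?nnegrE// expr1n real_normK ?num_real//.
  by rewrite -Sv sqnE (bigD1 i)//= lerDl sumr_ge0// => j _; rewrite sqr_ge0.
have S0 : S !=set0 by exists ((Num.sqrt (sqn b))^-1 *: b); exact: unit.
have [u /set_mem Su minu] := compact_EVT_min S0 cS (continuous_subspaceT (@continuous_qform A)).
pose l := qform A u.
have lmin v : l * sqn v <= qform A v.
  have [->|v0] := eqVneq v 0; first by rewrite /sqn /qform !mul0mx mxE mulr0.
  have v1 := sgt0 _ v0; have := minu _ (mem_set (unit _ v0)).
  rewrite qZ exprVn sqr_sqrtr ?(ltW v1)// -/l.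
  by rewrite mulrC ler_pdivlMr.
suff le : eigenvalue A l.
  apply: le_trans (lmin b); rewrite ler_wpM2r//; exact: Ac.
pose w := u *m A - l *: u.
suff w0 : w = 0.
  apply/eigenvalueP; exists u; first by apply/eqP; rewrite -subr_eq0 -/w w0.
  apply/eqP => u0; move: Su; rewrite /S/= u0 /sqn mul0mx mxE => /eqP.
  by rewrite eq_sym oner_eq0.
apply: sqn_eq0.
(* [D] is nonnegative and vanishes at [u]; along [u + z w] its linear term is [2 z sqn w], so a
   small negative [z] would make it negative unless [w = 0]. *)
pose D v := qform A v - l * sqn v.
have D0 v : 0 <= D v by rewrite subr_ge0.
have Du0 : D u = 0 by rewrite /D -/l Su mulr1 subrr.
have Dexp z v : D (u + z *: v) =
    z ^+ 2 * D v + z * (2 * (bil A u v - l * bil 1%:M u v)).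
  have sE x : sqn x = bil 1%:M x x by rewrite /bil mulmx1.
  have qE x : qform A x = bil A x x by [].
  rewrite /D !sE !qE !bilDl !bilDr !bilZl !bilZr.
  rewrite (bilC v u AT) (bilC v u (trmx1 _ _)).
  by move: Du0; rewrite /D sE qE => h; lra.
have Du z : D (u + z *: w) = z ^+ 2 * D w + z * (2 * sqn w).
  rewrite Dexp; suff -> : bil A u w - l * bil 1%:M u w = sqn w by [].
  by rewrite /sqn [in RHS]/w mulmxBl -scalemxAl /bil mulmx1 !mxE.
have w1 := sqn_ge0 w; apply/eqP; rewrite eq_le w1 andbT leNgt; apply/negP => w2.
(* [D w] alone may vanish, hence the added [1]. *)
pose z := - sqn w / (D w + 1).
have Dw1 : 0 < D w + 1 by rewrite ltr_wpDl.
have := D0 (u + z *: w); rewrite Du; apply/negP; rewrite -ltNge.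
have -> : z ^+ 2 * D w + z * (2 * sqn w) = - (sqn w / (D w + 1)) ^+ 2 * (D w + 2).
  by rewrite /z; field; rewrite gt_eqF.
by rewrite mulNr oppr_lt0 mulr_gt0 ?exprn_gt0 ?divr_gt0// ltr_wpDl.
Qed.

End rayleigh.

(** * Coercivity of the Gram matrix *)

Section gram_matrix.
Context {R : realType} (k : nat) (t : nat -> 'rV[R]_k).

Lemma gram_qform n (b : 'rV[R]_k) :
  (b *m gram t n *m b^T) ord0 ord0 = \sum_(i < n) (t i *m b^T) ord0 ord0 ^+ 2.
Proof.
rewrite /gram mulmxA -mulmxA mxE; apply: eq_bigr => i _.
have dE : (design t n *m b^T) i ord0 = (t i *m b^T) ord0 ord0.
  by rewrite !mxE; apply: eq_bigr => j _; rewrite !mxE.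
have dE' : (b *m (design t n)^T) ord0 i = (t i *m b^T) ord0 ord0.
  by rewrite !mxE; apply: eq_bigr => j _; rewrite !mxE mulrC.
by rewrite dE dE' expr2.
Qed.

Lemma R2_gram_lower_bound : R2_condition t ->
  exists2 c, 0 < c & exists n0, forall n, (n0 <= n)%N -> forall b : 'rV[R]_k,
    n%:R * (c * \sum_j b ord0 j ^+ 2) <= \sum_(i < n) (t i *m b^T) ord0 ord0 ^+ 2.
Proof.
move=> [[n0 infn] _]; set S := [set _ | _ in _] in infn.
(* [inf] is [0] on a set without lower bound, so a positive infimum provides one; the same argument
   serves the eigenvalues below. *)
have lbS : has_lbound S.
  by apply: contrapT => nlb; move: infn; rewrite inf_out ?ltxx// => -[].
(* The successor excludes [n = 0], so that the factor [n%:R^-1] can be cleared. *)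
exists (inf S) => //; exists n0.+1 => n nn0 b.
have n_gt0 : 0 < n%:R :> R by rewrite ltr0n (leq_trans _ nn0).
pose A := n%:R^-1 *: gram t n.
have Sn : S (min_eigenvalue A) by exists n => //=; exact: ltnW.
have mA : inf S <= min_eigenvalue A by exact: ge_inf.
have AT : A^T = A by rewrite /A linearZ/= /gram trmx_mul trmxK.
have lbA : has_lbound [set a | eigenvalue A a].
  apply: contrapT => nlb; have := lt_le_trans infn mA.
  by rewrite /min_eigenvalue inf_out ?ltxx// => -[].
have Ac a : eigenvalue A a -> inf S <= a.
  by move=> Aa; apply: le_trans mA _; exact: ge_inf.
have := qform_ge_eigenvalue AT Ac b.
rewrite /A -scalemxAr -scalemxAl mxE gram_qform => h.
by rewrite -ler_pdivlMl.
Qed.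

End gram_matrix.

Section dpd_near_truth.
Context {R : realType} (k : nat) (t : nat -> 'rV[R]_k).
Variables (theta0 : 'rV[R]_k * R) (alpha M : R).
Hypothesis theta0_gt0 : 0 < theta0.2.
Hypothesis alpha_gt0 : 0 < alpha.
Hypothesis M_ge0 : 0 <= M.
Hypothesis tM : forall i j, `|t i ord0 j| <= M.

Lemma dpd_near_truth (dl : R) : 0 < dl -> exists2 rho, 0 < rho &
  forall n (x : nat -> R) (theta : 'rV[R]_k * R), 0 < theta.2 ->
    (forall j, `|(theta.1 - theta0.1) ord0 j| < rho) -> `|theta.2 - theta0.2| < rho ->
    q_n (reg_density t) alpha n x theta0 - n%:R * dl <=
    q_n (reg_density t) alpha n x theta.
Proof.
move=> dl0; have s00 : 0 < Num.sqrt theta0.2 by rewrite sqrtr_gt0.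
have [r r0 hr] := dpd_obs_near alpha_gt0 s00 dl0.
have [r1 r10 hr1] := sqrt_near theta0_gt0 r0.
have [r2 r20 hr2] := lin_near M_ge0 r0 tM.
exists (Num.min r1 r2); first by rewrite lt_min r10.
move=> n x theta v0 hb hv; rewrite /q_n -sum_ord_const -sumrB; apply: ler_sum => i _.
rewrite !q_alphaE// addrAC lerD2r (lin_sub t theta0 i theta) opprD addrA.
have hs : `|Num.sqrt theta.2 - Num.sqrt theta0.2| < r.
  by apply: hr1 => //; apply: lt_le_trans hv _; rewrite ge_min lexx.
have hl : `|(t i *m (theta.1 - theta0.1)^T) ord0 ord0| < r.
  by apply: hr2 => j; apply: lt_le_trans (hb j) _; rewrite ge_min lexx orbT.
have sgt0 : 0 < Num.sqrt theta.2 by rewrite sqrtr_gt0.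
exact: (hr _ _ (x i - (t i *m theta0.1^T) ord0 ord0) sgt0 hl hs).
Qed.

End dpd_near_truth.

(* [w] is the ratio of the variance to the true one, and [1 - e' + q] bounds the
   mean squared residual from below, in units of the true variance. *)
Lemma loglik_gap {R : realType} (r g0 : R) : 0 < r -> 0 < g0 ->
  exists h kp : R, [/\ 0 < h, 0 < kp & forall e e' q w,
    0 <= e <= h -> 0 <= e' <= h -> 0 <= q -> 0 < w ->
    [/\ 0 < 1 - e' + q, - (ln (1 - e' + q) / 2) + e / 2 <= 1 &
     g0 <= q \/ r <= `|w - 1| ->
     - (ln (1 - e' + q) / 2) - Num.min (ln (w / (1 - e' + q)) ^+ 2 / 4) 1 / 2 + e / 2
       <= - kp]].
Proof.
move=> r0 g00.
(* Let [a = 1 - e' + q]. If [q >= g], then [ln a >= l], a gain of [l / 2]. Otherwise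
   [|ln a| <= z / 4], while [|w - 1| >= r] forces [|ln w| >= z], so the minimum is at least
   [z^2 / 16], a gain of [z^2 / 32]. The bounds on [h] keep the losses below half of either gain. *)
have [z zE] : exists z, z = Num.min (1 / 2) (r / 2) by eexists.
have z0 : 0 < z by rewrite zE lt_min !divr_gt0.
have z12 : z <= 1 / 2 by rewrite zE ge_min lexx.
have zr : z <= r / 2 by rewrite zE ge_min lexx orbT.
have [g gE] : exists g, g = Num.min g0 (z / 4) by eexists.
have ggt0 : 0 < g by rewrite gE lt_min g00 divr_gt0.
have gg0 : g <= g0 by rewrite gE ge_min lexx.
have gz : g <= z / 4 by rewrite gE ge_min lexx orbT.
have [l lE] : exists l, l = ln (1 + g / 2) by eexists.
have l0 : 0 < l by rewrite lE ln_gt0// ltrDl divr_gt0.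
have z20 : 0 < z ^+ 2 by rewrite exprn_gt0.
have [h hE] : exists h, h = Num.min (g / 2) (Num.min (l / 2) (z ^+ 2 / 96)) by eexists.
have h0 : 0 < h by rewrite hE !lt_min !divr_gt0.
have hg : h <= g / 2 by rewrite hE ge_min lexx.
have hl : h <= l / 2 by rewrite hE !ge_min lexx orbT.
have hz : h <= z ^+ 2 / 96 by rewrite hE !ge_min lexx !orbT.
have [kp kpE] : exists kp, kp = Num.min (l / 4) (z ^+ 2 / 64) by eexists.
have kp0 : 0 < kp by rewrite kpE !lt_min !divr_gt0.
have kpl : kp <= l / 4 by rewrite kpE ge_min lexx.
have kpz : kp <= z ^+ 2 / 64 by rewrite kpE ge_min lexx orbT.
exists h, kp; split => // e e' q w /andP[e0 eh] /andP[e'0 e'h] q0 w0.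
clear zE gE hE kpE.
have h12 : h <= 1 / 2 by clear - z12 gz hg; lra.
have [a aE] : exists a, a = 1 - e' + q by eexists.
rewrite -aE; have a0 : 0 < a by rewrite aE; clear - q0 e'h h12; lra.
have a_ge : - (2 * h) <= ln a.
  apply: le_trans (ln_1B_ge (ltW h0) h12) _.
  by rewrite ler_ln ?posrE// ?aE; clear - q0 e'h h12; lra.
have mpos : 0 <= Num.min (ln (w / a) ^+ 2 / 4) 1.
  by rewrite le_min ler01 andbT divr_ge0// sqr_ge0.
split => //; first by clear - a_ge h12 eh; lra.
have [qg _|qg [|wr]] := leP g q.
- have la : l <= ln a.
    by rewrite lE ler_ln ?posrE ?aE//; clear - ggt0 qg e'h hg h0 h12 e'0; lra.
  by clear - la mpos kpl hl eh l0; lra.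
- by clear - qg gg0; lra.
have lwz : z <= `|ln w|.
  rewrite leNgt; apply/negP => lwz.
  have := norm_expRB1_le (le_trans (ltW lwz) z12); rewrite lnK ?posrE//.
  by clear - lwz wr zr; lra.
have la : `|ln a| <= z / 4.
  have := ln_le_subr1 a0; rewrite ler_norml aE => la; apply/andP; split.
    by rewrite -aE; clear - a_ge hg gz; lra.
  by clear - la qg gz e'0; lra.
have zz : z / 2 <= `|ln (w / a)|.
  rewrite ln_div ?posrE//; have := lerB_dist (ln w) (ln a).
  by clear - lwz la z0; lra.
have m1 : z ^+ 2 / 16 <= Num.min (ln (w / a) ^+ 2 / 4) 1.
  have zs : z ^+ 2 <= 1 / 4.
    have := ler_wpM2l (ltW z0) z12; rewrite expr2.
    by clear - z12; lra.
  rewrite le_min; apply/andP; split; last by clear - zs; lra.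
  have : (z / 2) ^+ 2 <= `|ln (w / a)| ^+ 2.
    by rewrite lerXn2r ?nnegrE ?normr_ge0 ?divr_ge0 ?(ltW z0).
  by rewrite real_normK ?num_real//; clear; lra.
by clear - m1 a_ge hz eh kpz z20; lra.
Qed.

(** In the application [S] and [W] are the sums of squared errors and residuals over the true
    variance, and [y] is the ratio of the true variance to the other one. *)
Lemma near_arith {R : realType} (n dl kp S W y : R) :
    0 <= n -> 0 < dl -> 0 < kp -> kp <= 1 / 2 -> kp <= dl / 10 ->
    0 <= S -> S <= 2 * n -> W <= (1 + kp) * S + n * (dl / 2) ->
    0 < y -> y <= 1 + 2 * kp ->
  W * (y / 2) - S / 2 + n * (kp / 4) <= n * dl.
Proof.
move=> n0 dl0 kp0 kp12 kpd S0 Sn WS y0 yle.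
have nd0 := mulr_ge0 n0 (ltW dl0).
have W1 : W * (y / 2) <= ((1 + kp) * S + n * (dl / 2)) * (y / 2).
  by rewrite ler_wpM2r// divr_ge0// ltW.
have W2 : ((1 + kp) * S + n * (dl / 2)) * (y / 2) <=
    ((1 + kp) * S + n * (dl / 2)) * ((1 + 2 * kp) / 2).
  rewrite ler_wpM2l//; last by clear - yle; lra.
  by have := mulr_ge0 (ltW kp0) S0; clear - S0 nd0; lra.
have W3 : (3 * kp + 2 * kp ^+ 2) * S <= 4 * kp * (2 * n).
  apply: (@le_trans _ _ (4 * kp * S)).
    by rewrite ler_wpM2r//; have := ler_wpM2l (ltW kp0) kp12; clear; lra.
  by rewrite ler_wpM2l// mulr_ge0// ltW.
have W4 : n * kp <= n * (dl / 10) by rewrite ler_wpM2l.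
have W5 : n * (dl / 2) * (1 + 2 * kp) <= n * (dl / 2) * 2.
  by rewrite ler_wpM2l// ?mulr_ge0 ?divr_ge0 ?(ltW dl0)//; clear - kp12; lra.
by clear - W1 W2 W3 W4 W5 nd0; lra.
Qed.

(** * The log-likelihood: separation and continuity *)

Section loglikelihood_regression.
Context {R : realType} d (T : measurableType d) (P : probability T R).
Variables (X : nat -> {RV P >-> R}) (k : nat) (t : nat -> 'rV[R]_k).
Variables (theta0 : 'rV[R]_k * R) (M c : R) (n0 : nat).
Hypothesis indX : mutually_independent X.
Hypothesis theta0_gt0 : 0 < theta0.2.
Hypothesis Xdens : forall i, has_density (X i) (reg_density t i theta0).
Hypothesis M_ge0 : 0 <= M.
Hypothesis tM : forall i j, `|t i ord0 j| <= M.
Hypothesis c_gt0 : 0 < c.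
Hypothesis gram_ge : forall n, (n0 <= n)%N -> forall b : 'rV[R]_k,
  n%:R * (c * \sum_j b ord0 j ^+ 2) <= \sum_(i < n) (t i *m b^T) ord0 ord0 ^+ 2.
Implicit Types (theta : 'rV[R]_k * R) (b : 'rV[R]_k).

Local Notation v0 := theta0.2.
Local Notation s0 := (Num.sqrt theta0.2).
Local Notation lin i b := ((t i *m b^T) ord0 ord0).
Let m i : R := lin i theta0.1.

Let s0_gt0 : 0 < s0. Proof. by rewrite sqrtr_gt0. Qed.

Let Xm i : has_density (X i) (normal_pdf (m i) s0). Proof. exact: Xdens. Qed.

Lemma q_n0E n (x : nat -> R) theta : 0 < theta.2 ->
  q_n (reg_density t) 0 n x theta =
  n%:R * (ln (Num.sqrt (pi *+ 2))^-1 - 1) - n%:R * (ln theta.2 / 2) -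
  (\sum_(i < n) (x i - m i - lin i (theta.1 - theta0.1)) ^+ 2) / (2 * theta.2).
Proof.
move=> vgt0; have sgt0 : 0 < Num.sqrt theta.2 by rewrite sqrtr_gt0.
have ln_s : ln (Num.sqrt theta.2) = ln theta.2 / 2.
  rewrite -[in RHS](sqr_sqrtr (ltW vgt0)) lnXn// mulr2n; lra.
rewrite /q_n mulr_suml -2!(sum_ord_const n) -!sumrB; apply: eq_bigr => i _.
rewrite /q_alpha eqxx /reg_density normal_pdfE_gt0//.
have k0 := @k2pi_gt0 R.
rewrite lnM ?posrE ?divr_gt0 ?expR_gt0// expRK ln_div ?posrE// ln_s.
rewrite sqr_sqrtr ?(ltW vgt0)// (lin_sub t theta0 i theta) opprD addrA.
rewrite -/(m i); set A := ln _; set B := ln _; set E := _ ^+ 2.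
by field; rewrite gt_eqF.
Qed.

(** Write [v = v0 a exp z]. In [z] the bound is [- (z + exp (- z)) / 2] per observation, maximal at
    [z = 0], and [expR_sub_ge] measures the loss. *)
Let loglik_bound (n S W v a eta : R) : 0 <= n -> 0 < v -> 0 < a ->
  S <= n * (v0 * (1 + eta)) -> n * (v0 * a) <= W ->
  - (n * (ln v / 2)) - W / (2 * v) <= - (n * (ln v0 / 2)) - S / (2 * v0) +
    n * (- (ln a / 2) - Num.min (ln (v / v0 / a) ^+ 2 / 4) 1 / 2 + eta / 2).
Proof.
move=> n_ge0 vgt0 a0 SE WE.
have w0 : 0 < v / v0 by rewrite divr_gt0.
have [z ze] : exists z, z = ln (v / v0 / a) by eexists.
have lnE : ln v = ln v0 + ln a + z.
  rewrite ze ln_div ?posrE ?divr_gt0// ln_div ?posrE//; lra.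
have ezE : expR (- z) = a * v0 / v.
  by rewrite ze expRN lnK ?posrE ?divr_gt0//; field; rewrite !gt_eqF.
have := expR_sub_ge (- z); rewrite sqrrN opprK -ze ezE => h.
have h1 : n * (v0 * a) / (2 * v) <= W / (2 * v) by rewrite ler_pM2r ?invr_gt0 ?mulr_gt0.
have h2 : S / (2 * v0) <= n * (v0 * (1 + eta)) / (2 * v0).
  by rewrite ler_pM2r ?invr_gt0 ?mulr_gt0.
have h3 := ler_wpM2l n_ge0 h.
have h4 : n * (v0 * a) / (2 * v) = n * (a * v0 / v) / 2 by field; rewrite gt_eqF.
have h5 : n * (v0 * (1 + eta)) / (2 * v0) = n * (1 + eta) / 2 by field; rewrite gt_eqF.
rewrite h4 in h1; rewrite h5 in h2; rewrite lnE.
move: h1 h2 h3; set A := a * v0 / v; set m0 := Num.min _ _.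
set W' := W / _; set S' := S / _; move=> *; lra.
Qed.

Let good (eta : R) n w :=
  `|\sum_(i < n) (X i w - m i) ^+ 2 - n%:R * s0 ^+ 2| <= n%:R * (eta * s0 ^+ 2) /\
  forall j : 'I_k, `|\sum_(i < n) t i ord0 j * (X i w - m i)| <= n%:R * eta.

Let whp_good (eta : R) : 0 < eta -> whp P (good eta).
Proof.
move=> eta0; apply: whpI; first exact: (whp_mean_sqr_error indX s0_gt0 Xm).
apply: whp_forall => j.
exact: (whp_mean_linear_error indX s0_gt0 Xm eta0 (fun i => tM i j)).
Qed.

(** Expand the square. The cross term is at most [n eta (k + |b|^2)], and for [eta <= c / 2] half of
    the coercivity absorbs its growth, so one event serves all [b] at once. *)
Let residual_ge (eta : R) n w b : 0 < eta -> eta <= c / 2 -> (n0 <= n)%N ->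
  good eta n w ->
  n%:R * (v0 - eta * (v0 + k%:R) + c / 2 * \sum_j b ord0 j ^+ 2) <=
  \sum_(i < n) (X i w - m i - lin i b) ^+ 2.
Proof.
move=> eta0 etac nn0 [gS gL].
have -> : \sum_(i < n) (X i w - m i - lin i b) ^+ 2 =
    \sum_(i < n) (X i w - m i) ^+ 2 -
    2 * \sum_(i < n) (X i w - m i) * lin i b + \sum_(i < n) lin i b ^+ 2.
  rewrite mulr_sumr -sumrB -big_split/=; apply: eq_bigr => i _; ring.
have gram := gram_ge nn0 b.
have LE : \sum_(i < n) (X i w - m i) * lin i b =
    \sum_j b ord0 j * \sum_(i < n) t i ord0 j * (X i w - m i).
  under [RHS]eq_bigr do rewrite mulr_sumr.
  rewrite exchange_big/=; apply: eq_bigr => i _.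
  by rewrite mxE mulr_sumr; apply: eq_bigr => j _; rewrite mxE; ring.
have LB : 2 * \sum_(i < n) (X i w - m i) * lin i b <=
    n%:R * eta * (k%:R + \sum_j b ord0 j ^+ 2).
  rewrite LE mulr_sumr -[k%:R]mulr1 -(sum_ord_const k) -big_split/= mulr_sumr.
  apply: ler_sum => j _; set L := \sum_(i < n) _.
  have L1 : `|b ord0 j * L| <= `|b ord0 j| * (n%:R * eta) by rewrite normrM; apply: ler_wpM2l => //; exact: gL.
  have L2 := ler_norm (b ord0 j * L).
  have ne0 : 0 <= n%:R * eta by rewrite mulr_ge0// ltW.
  have b2 : 2 * `|b ord0 j| <= 1 + b ord0 j ^+ 2.
    by rewrite -(real_normK (num_real (b ord0 j))); have := sqr_ge0 (`|b ord0 j| - 1); lra.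
  by have := ler_wpM2l ne0 b2; lra.
have n_ge0 : 0 <= n%:R :> R by [].
have N20 : 0 <= \sum_j b ord0 j ^+ 2 by rewrite sumr_ge0// => j _; rewrite sqr_ge0.
move: gS; rewrite sqr_sqrtr ?(ltW theta0_gt0)// ler_norml => /andP[gS _].
have := ler_wpM2l n_ge0 (ler_wpM2r N20 etac).
move: gS LB gram; set S := \sum_(i < n) (_ - _) ^+ 2; set L := \sum_(i < n) _ * _.
set G := \sum_(i < n) _ ^+ 2; set N2 := \sum_(j < k) _ in N20 *; move=> *; lra.
Qed.

(** The contrapositive of the continuity of the distance, phrased in the squared norm and the
    variance ratio that feed [loglik_gap]. *)
Let far_from_truth (eps : R) : 0 < eps -> exists2 r, 0 < r &
  forall n theta, (0 < n)%N -> 0 < theta.2 ->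
    n%:R * eps <= \sum_(i < n) L1_dist (reg_density t i theta0) (reg_density t i theta) ->
    r <= \sum_j (theta.1 - theta0.1) ord0 j ^+ 2 \/ r <= `|theta.2 / v0 - 1|.
Proof.
move=> eps0.
have [rho rho0 hrho] := L1_dist_normal_near s0_gt0 eps0.
have [r1 r10 hr1] := lin_near M_ge0 rho0 tM.
have [r2 r20 hr2] := sqrt_near theta0_gt0 rho0.
exists (Num.min (r1 ^+ 2) (r2 / v0)); first by rewrite lt_min exprn_gt0// divr_gt0.
move=> n theta n0' vgt0 far.
have [N1|N1] := leP (r1 ^+ 2) (\sum_j (theta.1 - theta0.1) ord0 j ^+ 2).
  by left; rewrite ge_min N1.
have [N2|N2] := leP (r2 / v0) `|theta.2 / v0 - 1|.
  by right; rewrite ge_min N2 orbT.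
have vv : `|theta.2 - v0| < r2.
  rewrite -(ltr_pM2r (_ : 0 < v0^-1)) ?invr_gt0//; apply: le_lt_trans N2.
  have -> : theta.2 / v0 - 1 = (theta.2 - v0) / v0 by field; rewrite gt_eqF.
  by rewrite normrM (@ger0_norm _ v0^-1)// invr_ge0 ltW.
have bb j : `|(theta.1 - theta0.1) ord0 j| < r1.
  rewrite -(@ltr_pXn2r _ 2)// ?nnegrE ?normr_ge0 ?(ltW r10)//.
  rewrite real_normK ?num_real//; apply: le_lt_trans N1.
  by rewrite (bigD1 j)//= lerDl sumr_ge0// => l _; rewrite sqr_ge0.
have : \sum_(i < n) L1_dist (reg_density t i theta0) (reg_density t i theta) <
    \sum_(i < n) eps.
  apply: ltr_sum => [|i _]; first by apply/hasP; exists (Ordinal n0'); rewrite ?mem_index_enum.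
  have := hrho (m i) (lin i (theta.1 - theta0.1)) (Num.sqrt theta.2).
  rewrite sqrtr_gt0 => /(_ vgt0 (hr1 _ bb i) (hr2 _ vgt0 vv)).
  rewrite /reg_density (_ : m i + _ = lin i theta.1)//.
  by rewrite [RHS](lin_sub t theta0 i theta).
by rewrite sum_ord_const; lra.
Qed.

Lemma loglik_separation (eps : R) : 0 < eps ->
  exists dl, 0 < dl /\ whp P (fun n w => forall theta, 0 < theta.2 ->
    q_n (reg_density t) 0 n (fun i => X i w) theta <=
      q_n (reg_density t) 0 n (fun i => X i w) theta0 + n%:R /\
    (n%:R * eps <= \sum_(i < n) L1_dist (reg_density t i theta0) (reg_density t i theta) ->
     q_n (reg_density t) 0 n (fun i => X i w) theta <=
      q_n (reg_density t) 0 n (fun i => X i w) theta0 - n%:R * (2 * dl))).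
Proof.
move=> eps0; have [r r0 far] := far_from_truth eps0.
have cv0 : 0 < c / (2 * v0) by rewrite divr_gt0// mulr_gt0.
have [h [kp [h0 kp0 gap]]] := loglik_gap r0 (mulr_gt0 cv0 r0).
have vk0 : 0 < v0 + k%:R by rewrite ltr_wpDr.
(* [eta] has to be small for the gap, for the coercivity, and after rescaling to
   [eta (v0 + k) / v0], the possible deficit of the mean squared residual relative to [v0]. *)
have [eta etaE] : exists eta, eta = Num.min h (Num.min (c / 2) (h * v0 / (v0 + k%:R))) by eexists.
have eta0 : 0 < eta by rewrite etaE !lt_min h0 !divr_gt0// mulr_gt0.
have etah : eta <= h by rewrite etaE ge_min lexx.
have etac : eta <= c / 2 by rewrite etaE !ge_min lexx orbT.
have eta' : eta * (v0 + k%:R) / v0 <= h.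
  rewrite ler_pdivrMr// -ler_pdivlMr//.
  by rewrite etaE !ge_min lexx !orbT.
have eta'0 : 0 <= eta * (v0 + k%:R) / v0.
  by rewrite divr_ge0 ?(ltW theta0_gt0)// mulr_ge0 ?(ltW eta0)// ltW.
exists (kp / 2); split; first by rewrite divr_gt0.
apply: whpS (whp_good eta0).
near=> n => w gd theta vgt0.
have n_gt0 : (0 < n)%N by near: n; exact: nbhs_infty_gt.
have n_ge : (n0 <= n)%N by near: n; exact: nbhs_infty_ge.
have n_ge0 : 0 <= n%:R :> R by [].
rewrite !q_n0E//.
have RE : \sum_(i < n) (X i w - m i - lin i (theta0.1 - theta0.1)) ^+ 2 =
    \sum_(i < n) (X i w - m i) ^+ 2.
  by apply: eq_bigr => i _; rewrite subrr linear0 mulmx0 mxE subr0.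
have Wge := residual_ge (theta.1 - theta0.1) eta0 etac n_ge gd.
have [gS _] := gd; rewrite sqr_sqrtr ?(ltW theta0_gt0)// in gS.
rewrite RE; clear RE.
set S := \sum_(i < n) (X i w - m i) ^+ 2 in gS *.
set W := \sum_(i < n) _ ^+ 2 in Wge *.
set N2 := \sum_(j < k) _ in Wge.
have N20 : 0 <= N2 by rewrite sumr_ge0// => j _; rewrite sqr_ge0.
have q0 : 0 <= c / (2 * v0) * N2 by rewrite mulr_ge0// ltW.
(* In units of [v0] the lower bound of [residual_ge] reads [1 - e' + q] with these values of [e']
   and [q]. *)
have := gap eta (eta * (v0 + k%:R) / v0) (c / (2 * v0) * N2) (theta.2 / v0).
rewrite (ltW eta0) etah eta'0 eta' q0 => /(_ isT isT isT (divr_gt0 vgt0 theta0_gt0)).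
set a := 1 - _ + _ => -[a0 up low].
have SE : S <= n%:R * (v0 * (1 + eta)).
  by have := ler_norm (S - n%:R * v0); clear gap up low Wge etaE eta0 etah etac eta' eta'0 q0 N20; lra.
have WE : n%:R * (v0 * a) <= W.
  apply: le_trans Wge; rewrite le_eqVlt; apply/orP; left; apply/eqP; rewrite /a.
  by field; rewrite gt_eqF.
have bnd := loglik_bound n_ge0 vgt0 a0 SE WE.
have mpos : 0 <= Num.min (ln (theta.2 / v0 / a) ^+ 2 / 4) 1.
  by rewrite le_min ler01 andbT divr_ge0// sqr_ge0.
split=> [|L1far].
  have : n%:R * (- (ln a / 2) - Num.min (ln (theta.2 / v0 / a) ^+ 2 / 4) 1 / 2 + eta / 2) <= n%:R * 1.
    by apply: ler_wpM2l => //; clear bnd WE SE Wge gS etaE etac etah eta' eta'0 cv0 q0 N20; lra.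
  by clear WE SE Wge gS etaE etac etah eta' eta'0 cv0 q0 N20 up mpos low; lra.
have : n%:R * (- (ln a / 2) - Num.min (ln (theta.2 / v0 / a) ^+ 2 / 4) 1 / 2 + eta / 2) <= n%:R * - kp.
  apply: ler_wpM2l => //; apply: low.
  have [H|H] := far n theta n_gt0 vgt0 L1far; [left|by right].
  by rewrite ler_pM2l.
by clear WE SE Wge gS etaE etac etah eta' eta'0 cv0 q0 N20 up mpos low; lra.
Unshelve. all: by end_near.
Qed.

(** Squared residuals are unbounded, so the estimate relies on the event that the mean squared error
    is at most [2 v0]. *)
Lemma loglik_near (dl : R) : 0 < dl -> exists2 rho, 0 < rho &
  whp P (fun n w => forall theta, 0 < theta.2 ->
    (forall j, `|(theta.1 - theta0.1) ord0 j| < rho) -> `|theta.2 - theta0.2| < rho ->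
    q_n (reg_density t) 0 n (fun i => X i w) theta0 - n%:R * dl <=
    q_n (reg_density t) 0 n (fun i => X i w) theta).
Proof.
move=> dl0.
have [kp kpE] : exists kp, kp = Num.min (1 / 2) (dl / 10) by eexists.
have kp0 : 0 < kp by rewrite kpE lt_min !divr_gt0.
have kp12 : kp <= 1 / 2 by rewrite kpE ge_min lexx.
have kpd : kp <= dl / 10 by rewrite kpE ge_min lexx orbT.
(* [r] bounds the squared shifts; its factor [kp] compensates the [1 / kp] in [(e - u)^2 <= (1 + kp)
   e^2 + (1 + 1 / kp) u^2]. *)
have [r rE] : exists r, r = kp * dl / 4 * v0 by eexists.
have r_gt0 : 0 < r by rewrite rE !mulr_gt0.
have sr0 : 0 < Num.sqrt r by rewrite sqrtr_gt0.
have [r1 r10 hr1] := lin_near M_ge0 sr0 tM.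
have kv0 : 0 < kp * v0 by rewrite mulr_gt0.
exists (Num.min r1 (kp / 2 * v0)); first by rewrite lt_min r10 mulr_gt0// divr_gt0.
apply: whpS (whp_good ltr01).
near=> n => w [gS _] theta vgt0 bb vv.
have n_ge0 : 0 <= n%:R :> R by [].
rewrite !q_n0E//.
have RE : \sum_(i < n) (X i w - m i - lin i (theta0.1 - theta0.1)) ^+ 2 =
    \sum_(i < n) (X i w - m i) ^+ 2.
  by apply: eq_bigr => i _; rewrite subrr linear0 mulmx0 mxE subr0.
rewrite RE; clear RE.
rewrite sqr_sqrtr ?(ltW theta0_gt0)// in gS.
set S := \sum_(i < n) (X i w - m i) ^+ 2 in gS *.
have S0 : 0 <= S by rewrite sumr_ge0// => j _; rewrite sqr_ge0.
have SE : S <= 2 * n%:R * v0.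
  by have := ler_norm (S - n%:R * v0); lra.
have WE : \sum_(i < n) (X i w - m i - lin i (theta.1 - theta0.1)) ^+ 2 <=
    (1 + kp) * S + n%:R * (dl / 2 * v0).
  rewrite mulr_sumr -(sum_ord_const n) -big_split/=; apply: ler_sum => i _.
  have ui : lin i (theta.1 - theta0.1) ^+ 2 <= r.
    rewrite -(sqr_sqrtr (ltW r_gt0)) -(real_normK (num_real (lin i _))).
    rewrite lerXn2r ?nnegrE ?normr_ge0 ?(ltW sr0)// ltW//; apply: hr1 => j.
    by apply: lt_le_trans (bb j) _; rewrite ge_min lexx.
  set e := X i w - m i; set u := lin i _ in ui *.
  have uk : u ^+ 2 / kp <= dl / 4 * v0.
    by rewrite ler_pdivrMr//; apply: le_trans ui _; rewrite rE; lra.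
  have ur : u ^+ 2 <= dl / 4 * v0.
    apply: le_trans ui _; rewrite rE -!mulrA ler_piMl ?mulr_ge0 ?(ltW theta0_gt0) ?invr_ge0 ?(ltW dl0)//.
    by lra.
  have uu : u ^+ 2 = kp * (u / kp) * u by field; rewrite gt_eqF.
  have -> : (e - u) ^+ 2 = (1 + kp) * e ^+ 2 + u ^+ 2 + u ^+ 2 / kp - kp * (e + u / kp) ^+ 2.
    by field; rewrite gt_eqF.
  by have := mulr_ge0 (ltW kp0) (sqr_ge0 (e + u / kp)); lra.
set W := \sum_(i < n) _ ^+ 2 in WE *.
have vr : `|theta.2 - v0| <= kp / 2 * v0.
  by apply: le_trans (ltW vv) _; rewrite ge_min lexx orbT.
have y_gt0 : 0 < v0 / theta.2 by rewrite divr_gt0.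
have yle : v0 / theta.2 <= 1 + 2 * kp.
  rewrite ler_pdivrMr//.
  have : v0 - kp / 2 * v0 <= theta.2 by move: vr; rewrite ler_norml => /andP[]; lra.
  have k12 : 0 <= 1 + 2 * kp by lra.
  move=> /(ler_wpM2l k12); have : 0 <= v0 * (kp * (1 / 2 - kp)).
    by rewrite !mulr_ge0 ?(ltW kp0) ?(ltW theta0_gt0)//; lra.
  by have := mulr_gt0 theta0_gt0 kp0; lra.
have lnle : ln theta.2 <= ln v0 + kp / 2.
  have x0 : 0 < theta.2 / v0 by rewrite divr_gt0.
  have h1 : theta.2 / v0 <= 1 + kp / 2.
    by rewrite ler_pdivrMr//; have := ler_norm (theta.2 - v0); lra.
  by have := ln_le_subr1 x0; rewrite ln_div ?posrE//; lra.
have -> : W / (2 * theta.2) = W / v0 * (v0 / theta.2 / 2).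
  by field; rewrite !gt_eqF.
have -> : S / (2 * v0) = S / v0 / 2 by field; rewrite gt_eqF.
have S1 : S / v0 <= 2 * n%:R by rewrite ler_pdivrMr.
have S2 : 0 <= S / v0 by rewrite divr_ge0// ltW.
have W1 : W / v0 <= (1 + kp) * (S / v0) + n%:R * (dl / 2).
  rewrite ler_pdivrMr//; apply: le_trans WE _; rewrite le_eqVlt; apply/orP; left.
  by apply/eqP; field; rewrite gt_eqF.
have arith := near_arith n_ge0 dl0 kp0 kp12 kpd S2 S1 W1 y_gt0 yle.
have lnle' := ler_wpM2l n_ge0 lnle.
clear W1 S1 S2 yle y_gt0 WE vr SE S0 gS r_gt0 kpE rE sr0 r10 kv0 kp0 kp12 kpd lnle; lra.
Unshelve. all: by end_near.
Qed.

End loglikelihood_regression.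

(* The library's canonical structure on [m1 \x m2] is only found for
   subprobabilities. *)
Lemma sigma_finite_product_measure d1 d2 (T1 : measurableType d1)
    (T2 : measurableType d2) (R : realType)
    (m1 : {sigma_finite_measure set T1 -> \bar R})
    (m2 : {sigma_finite_measure set T2 -> \bar R}) :
  sigma_finite setT (m1 \x m2)%E.
Proof.
have /sigma_finiteP[F [FT ndF Foo]] := sigma_finiteT m1.
have /sigma_finiteP[G [GT ndG Goo]] := sigma_finiteT m2.
exists (fun n => F n `*` G n) => [|n].
  apply/esym; rewrite -subTset => -[x y] _.
  have [i _ Fix] : (\bigcup_i F i) x by rewrite -FT.
  have [j _ Gjy] : (\bigcup_i G i) y by rewrite -GT.
  exists (maxn i j) => //; split => /=.
    exact: (subsetPset _ _ (ndF _ _ (leq_maxl i j))).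
  exact: (subsetPset _ _ (ndG _ _ (leq_maxr i j))).
have [mF Fn] := Foo n; have [mG Gn] := Goo n; split; first exact: measurableX.
by rewrite product_measure1E// lte_mul_pinfty// ge0_fin_numE.
Qed.

HB.instance Definition _ (R : realType) k :=
  Measure_isSigmaFinite.Build _ _ _ (reg_lebesgue R k)
    (sigma_finite_product_measure (lebesgue_rV k) (@lebesgue_measure R)).

Lemma lte_pdivre (R : realType) (x y : \bar R) (r : R) : (0 < y < +oo)%E ->
  (x / y < r%:E)%E = (x < r%:E * y)%E.
Proof.
case: y => [y| |] /andP[//]; rewrite lte_fin => y0 _.
by rewrite inver gt_eqF// lte_pdivrMr.
Qed.

(** * From separation to posterior decay *)

Section posterior_decay.
Context {R : realType} d (T : measurableType d) (P : probability T R).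
Context d' (Par : measurableType d') (nu : {sigma_finite_measure set Par -> \bar R}).
Variables (Theta : set Par) (f : nat -> Par -> R -> R) (prior : Par -> R).
Variables (alpha : R) (X : nat -> T -> R) (Q : nat -> T * Par -> R).
Hypothesis mTheta : measurable Theta.
Hypothesis prior_density : is_prior_density nu Theta prior.
Hypothesis mQ : forall n, measurable_fun setT (Q n).
Hypothesis QE : forall n w theta, Theta theta ->
  q_n f alpha n (fun i => X i w) theta = Q n (w, theta).

Local Notation W n w B := (R_weight nu f prior alpha n (fun i => X i w) B).

Let prior_ge0 theta : Theta theta -> 0 <= prior theta.
Proof. by case: prior_density => _ + _; exact. Qed.

Let mprior : measurable_fun setT (prior \_ Theta).
Proof. by apply/(measurable_restrictT prior mTheta); case: prior_density. Qed.

Let weightE n w B : measurable B -> B `<=` Theta ->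
  W n w B = (\int[nu]_theta
     (expR (Q n (w, theta)) * (prior \_ Theta) theta * \1_B theta)%:E)%E.
Proof.
move=> mB BT; rewrite /R_weight [LHS]integral_mkcond; apply: eq_integral => th _.
rewrite /patch indicE; case: ifPn => [/set_mem Bth|_]; last by rewrite mulr0.
by rewrite mem_set ?mulr1 ?QE//; exact: BT.
Qed.

(** Tonelli's theorem asks for an integrand jointly measurable in the sample and the parameter,
    which is the role of [Q] and of the extension of the prior by [0]. *)
Let measurable_weight n B : measurable B -> B `<=` Theta ->
  measurable_fun setT (fun w => W n w B).
Proof.
move=> mB BT; under eq_fun do rewrite weightE//.
pose H (z : T * Par) : \bar R :=
  (expR (Q n z) * (prior \_ Theta) z.2 * \1_B z.2)%:E.
apply: (@measurable_fun_fubini_tonelli_F _ _ _ _ _ nu H).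
  apply/measurable_EFinP; apply: measurable_funM; first apply: measurable_funM.
  - exact: measurableT_comp.
  - exact: (measurableT_comp mprior measurable_snd).
  - exact: (measurableT_comp (measurable_indic mB) measurable_snd).
move=> [w th]; rewrite lee_fin !mulr_ge0 ?expR_ge0//.
by rewrite /patch; case: ifPn => // /set_mem; exact: prior_ge0.
Qed.

Let measurable_integrand n w B : measurable B -> B `<=` Theta ->
  measurable_fun B (fun th => (expR (q_n f alpha n (fun i => X i w) th) * prior th)%:E).
Proof.
move=> mB BT; apply/measurable_EFinP; apply: measurable_funM.
  apply: (eq_measurable_fun (fun th => expR (Q n (w, th)))).
    by move=> th /set_mem Bth; rewrite QE//; exact: BT.
  apply: measurable_funTS; apply: measurableT_comp => //.
  by apply: measurableT_comp => //; exact: pair1_measurable.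
by apply: measurable_funS BT _ => //; case: prior_density.
Qed.

(** Makes [whp_cvg1] applicable. The event splits according to whether the normaliser is positive
    and finite; otherwise the posterior does not depend on the sample. *)
Lemma measurable_posterior_lt n B (r : R) : measurable B -> B `<=` Theta ->
  measurable [set w | (R_posterior nu Theta f prior alpha n (fun i => X i w) B < r%:E)%E].
Proof.
move=> mB BT.
have mW := measurable_weight n mB BT.
have mWT := measurable_weight n mTheta (@subset_refl _ Theta).
pose D := [set w | (0 < W n w Theta)%E] `&` [set w | (W n w Theta < +oo)%E].
have mD : measurable D.
  apply: measurableI; rewrite -[X in measurable X]setTI; apply: measurable_lte => //;
  exact: measurable_cst.
rewrite (_ : [set w | _] = (D `&` [set w | (W n w B < r%:E * W n w Theta)%E]) `|`
    (~` D `&` [set w | (\int[nu]_(theta in B) (prior theta)%:E < r%:E)%E])).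
  apply: measurableU; apply: measurableI => //.
  - rewrite -[X in measurable X]setTI; apply: measurable_lte => //.
    by apply: emeasurable_funM => //; exact: measurable_cst.
  - exact: measurableC.
  - rewrite -[X in measurable X]setTI; apply: measurable_lte => //;
    exact: measurable_cst.
apply/seteqP; split=> w; rewrite /R_posterior /=.
  case: ifPn => [/andP[W0 Woo] lt_r|Wn lt_r].
    left; split; first by split.
    by move: lt_r; rewrite lte_pdivre ?W0.
  by right; split => // -[W0 Woo]; rewrite W0 Woo in Wn.
case=> -[Dw lt_r].
  have [W0 Woo] := Dw; rewrite W0 Woo/=.
  by rewrite lte_pdivre ?W0.
case: ifPn => // /andP[W0 Woo]; exfalso; exact: Dw.
Qed.

Let prior_mass_le1 B : measurable B -> B `<=` Theta ->
  (\int[nu]_(th in B) (prior th)%:E <= 1)%E.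
Proof.
move=> mB BT; have [mp p0 p1] := prior_density.
apply: le_trans p1; apply: ge0_subset_integral => //.
by apply/measurable_EFinP.
Qed.

Let mpriorS B : B `<=` Theta -> measurable_fun B (fun th => (prior th)%:E).
Proof.
move=> BT; apply/measurable_EFinP; apply: measurable_funS BT _ => //.
by case: prior_density.
Qed.

Let weight_le n w B (b : R) : measurable B -> B `<=` Theta ->
  (forall th, B th -> q_n f alpha n (fun i => X i w) th <= b) ->
  (W n w B <= (expR b)%:E)%E.
Proof.
move=> mB BT qb.
apply: (@le_trans _ _ (\int[nu]_(th in B) ((expR b)%:E * (prior th)%:E))%E).
  apply: ge0_le_integral => //.
  - by move=> th /BT Tth; rewrite lee_fin mulr_ge0 ?expR_ge0// prior_ge0.
  - exact: measurable_integrand.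
  - by apply: emeasurable_funM; [exact: measurable_cst|exact: mpriorS].
  - move=> th Bth; rewrite -EFinM lee_fin ler_wpM2r ?ler_expR ?qb//.
    by apply: prior_ge0; exact: BT.
rewrite ge0_integralZl_EFin ?expR_ge0//.
- by rewrite -[leRHS]mule1 lee_wpmul2l ?lee_fin ?expR_ge0// prior_mass_le1.
- by move=> th /BT Tth; rewrite lee_fin prior_ge0.
- exact: mpriorS.
Qed.

Let weight_ge n w B (b : R) : measurable B -> B `<=` Theta ->
  (forall th, B th -> b <= q_n f alpha n (fun i => X i w) th) ->
  ((expR b)%:E * \int[nu]_(th in B) (prior th)%:E <= W n w Theta)%E.
Proof.
move=> mB BT qb.
apply: (@le_trans _ _ (W n w B)); last first.
  apply: ge0_subset_integral => //; first exact: measurable_integrand.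
  by move=> th Tth; rewrite lee_fin mulr_ge0 ?expR_ge0// prior_ge0.
rewrite -ge0_integralZl_EFin ?expR_ge0//; last 2 first.
- by move=> th /BT Tth; rewrite lee_fin prior_ge0.
- exact: mpriorS.
apply: ge0_le_integral => //.
- by move=> th /BT Tth; rewrite mule_ge0// lee_fin ?expR_ge0// prior_ge0.
- by apply: emeasurable_funM; [exact: measurable_cst|exact: mpriorS].
- exact: measurable_integrand.
- move=> th Bth; rewrite -EFinM lee_fin ler_wpM2r ?ler_expR ?qb//.
  by apply: prior_ge0; exact: BT.
Qed.

Lemma posterior_decay (A : nat -> set Par) (U : set Par) (theta0 : Par) (dl : R) :
  0 < dl -> (forall n, measurable (A n)) -> (forall n, A n `<=` Theta) ->
  measurable U -> U `<=` Theta -> (0 < \int[nu]_(th in U) (prior th)%:E)%E ->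
  whp P (fun n w => (forall th, Theta th ->
      q_n f alpha n (fun i => X i w) th <= q_n f alpha n (fun i => X i w) theta0 + n%:R /\
      (A n th -> q_n f alpha n (fun i => X i w) th <=
         q_n f alpha n (fun i => X i w) theta0 - n%:R * (2 * dl))) /\
    (forall th, U th -> q_n f alpha n (fun i => X i w) theta0 - n%:R * dl <=
      q_n f alpha n (fun i => X i w) th)) ->
  P [set w | (R_posterior nu Theta f prior alpha n (fun i => X i w) (A n) <
              (expR (- (n%:R * (dl / 2))))%:E)%E] @[n --> \oo] --> 1%E.
Proof.
move=> dl0 mA AT mU UT U0 good; apply: whp_cvg1 => [n|].
  exact: measurable_posterior_lt.
have [p pE] : exists p, (\int[nu]_(th in U) (prior th)%:E = p%:E)%E.
  exists (fine (\int[nu]_(th in U) (prior th)%:E)%E); rewrite fineK//.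
  by rewrite ge0_fin_numE ?(ltW U0)// (le_lt_trans (prior_mass_le1 mU UT))// ltry.
rewrite pE lte_fin in U0.
have d20 : 0 < dl / 2 by rewrite divr_gt0.
apply: whpS good; near=> n => w [up low].
(* The quotient is at most [exp (- n dl) / p]; eventually half of the exponent absorbs [1 / p]. *)
have lt_p : expR (- (n%:R * (dl / 2))) < p.
  near: n; exact: (cvgr_lt _ (cvg_expR_mulrn d20) _ U0).
have WA : (W n w (A n) <= (expR (q_n f alpha n (fun i => X i w) theta0 - n%:R * (2 * dl)))%:E)%E.
  by apply: weight_le => // th Ath; apply: (up th _).2 => //; exact: AT Ath.
(* From this bound only the finiteness of the normaliser is drawn. *)
have WT : (W n w Theta <= (expR (q_n f alpha n (fun i => X i w) theta0 + n%:R))%:E)%E.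
  by apply: weight_le => // th /up[].
have WU := weight_ge mU UT low; rewrite pE -EFinM in WU.
set q0 := q_n f alpha n (fun i => X i w) theta0 in WA WT WU.
have W0 : (0 < W n w Theta)%E.
  by apply: lt_le_trans WU; rewrite lte_fin mulr_gt0 ?expR_gt0.
have Woo : (W n w Theta < +oo)%E by rewrite (le_lt_trans WT)// ltry.
rewrite /= /R_posterior W0 Woo/= lte_pdivre ?W0//.
apply: (le_lt_trans WA).
apply: (@lt_le_trans _ _ ((expR (- (n%:R * (dl / 2))))%:E * (expR (q0 - n%:R * dl) * p)%:E)%E).
  rewrite -EFinM lte_fin [ltRHS]mulrA -expRD.
  have -> : q0 - n%:R * (2 * dl) = (- (n%:R * (dl / 2)) + (q0 - n%:R * dl)) + - (n%:R * (dl / 2)).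
    by lra.
  by rewrite [ltLHS]expRD ltr_pM2l ?expR_gt0.
by rewrite lee_wpmul2l// lee_fin expR_ge0.
Unshelve. all: by end_near.
Qed.

End posterior_decay.

(** * Measurability in the regression model *)

Section regression_measurability.
Context {R : realType} (k : nat) (t : nat -> 'rV[R]_k).
Local Notation Par := ('rV[measurableTypeR R]_k * measurableTypeR R)%type.
Local Notation mu := (@lebesgue_measure R).

Lemma measurable_reg_par : measurable (reg_par R k : set Par).
Proof.
rewrite (_ : reg_par R k = snd @^-1` `]0, +oo[%classic).
  rewrite -[X in measurable X]setTI; apply: measurable_snd => //.
by apply/seteqP; split=> th; rewrite /reg_par /= in_itv/= andbT.
Qed.

Let measurable_lin i : measurable_fun setT (fun th : Par => (t i *m th.1^T) ord0 ord0 : R).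
Proof.
under eq_fun do rewrite mxE; apply: measurable_sum => j.
under eq_fun do rewrite mxE; apply: measurable_funM; first exact: measurable_cst.
exact: (measurableT_comp (@measurable_coord _ (measurableTypeR R) k j) measurable_fst).
Qed.

Lemma reg_densityE i : exists2 F : Par * R -> R, measurable_fun setT F &
  forall th y, 0 < th.2 -> reg_density t i th y = F (th, y).
Proof.
(* The powers of the variance are written with [expR] and [ln], which makes measurability immediate;
   the formulas agree for a positive variance. *)
exists (fun z => (Num.sqrt (pi *+ 2))^-1 * expR (- (ln (z.1.2 : R) / 2)) *
   expR (- ((z.2 - (t i *m z.1.1^T) ord0 ord0) ^+ 2 * (expR (- ln (z.1.2 : R)) / 2)))).
  have mv : measurable_fun setT (fun z : Par * R => ln (z.1.2 : R)).
    apply: (measurableT_comp (@measurable_ln R)).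
    exact: (measurableT_comp measurable_snd measurable_fst).
  apply: measurable_funM.
    apply: measurable_funM; first exact: measurable_cst.
    apply: measurableT_comp => //; apply: measurableT_comp => //.
    by apply: measurable_funM => //; exact: measurable_cst.
  apply: measurableT_comp => //; apply: measurableT_comp => //.
  apply: measurable_funM.
    apply: measurable_funX; apply: measurable_funB; first exact: measurable_snd.
    exact: (measurableT_comp (measurable_lin i) measurable_fst).
  apply: measurable_funM; last exact: measurable_cst.
  by apply: measurableT_comp => //; exact: measurableT_comp.
move=> th y v0; rewrite /reg_density normal_pdfE_gt0 ?sqrtr_gt0//=.
have s0 : 0 < Num.sqrt th.2 by rewrite sqrtr_gt0.
have -> : ln th.2 / 2 = ln (Num.sqrt th.2).
  rewrite -[in LHS](sqr_sqrtr (ltW v0)) lnXn// mulr2n; lra.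
rewrite (expRN (ln (Num.sqrt th.2))) (expRN (ln th.2)) !lnK ?posrE// sqr_sqrtr ?(ltW v0)//; congr (_ * expR (- _)).
by rewrite -mulr_natr invfM.
Qed.


(** As an integral over [y] of a jointly measurable function, each distance is measurable in the
    parameter by Tonelli's theorem. *)
Lemma measurable_L1_dist_ge theta0 (eps : R) n : 0 < theta0.2 ->
  measurable ([set th | reg_par R k th /\ (eps <= n%:R^-1 *
    \sum_(i < n) L1_dist (reg_density t i theta0) (reg_density t i th))%R] : set Par).
Proof.
move=> v0.
have /choice[L LE] : forall i, exists L : Par -> R, measurable_fun setT L /\
    forall th, 0 < th.2 -> L1_dist (reg_density t i theta0) (reg_density t i th) = L th.
  move=> i; have [F mF FE] := reg_densityE i.
  pose H (z : Par * R) : \bar R := `|F (theta0, z.2) - F z|%:E.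
  exists (fun th => fine (fubini_F mu H th)); split.
    apply: measurableT_comp; first exact: fine_measurable.
    apply: (@measurable_fun_fubini_tonelli_F _ _ _ _ _ mu H) => [|z]; last by rewrite lee_fin.
    apply/measurable_EFinP; apply: measurableT_comp => //.
    apply: measurable_funB => //.
    apply: (measurableT_comp mF); by apply/measurable_fun_pair.
  move=> th vgt0; rewrite /L1_dist /Rintegral /fubini_F /H; congr fine.
  by apply: eq_integral => y _; rewrite !FE.
have sumE th : 0 < th.2 -> \sum_(i < n) L1_dist (reg_density t i theta0) (reg_density t i th) =
    \sum_(i < n) L i th by move=> vgt0; apply: eq_bigr => i _; exact: (LE i).2.
rewrite (_ : [set th | _] = reg_par R k `&` [set th | eps <= n%:R^-1 * \sum_(i < n) L i th]).
  apply: measurable_fun_le => //; first exact: measurable_reg_par.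
  apply: measurable_funTS; apply: measurable_funM => //.
  by apply: measurable_sum => i; exact: (LE i).1.
by apply/seteqP; split=> th [vgt0] /=; rewrite sumE.
Qed.

Lemma reg_q_nE d (T : measurableType d) (X : nat -> {mfun T >-> R}) alpha n : 0 <= alpha ->
  exists2 Q : T * Par -> R, measurable_fun setT Q & forall w th, reg_par R k th ->
    q_n (reg_density t) alpha n (fun i => X i w) th = Q (w, th).
Proof.
move=> alpha_ge0.
have /choice[Q QE] : forall i, exists Q : T * Par -> R, measurable_fun setT Q /\ forall w th, 0 < th.2 ->
    q_alpha alpha (reg_density t i th) (X i w) = Q (w, th).
  move=> i; have [F mF FE] := reg_densityE i.
  have mFX : measurable_fun setT (fun z : T * Par => F (z.2, X i z.1)).
    apply: (measurableT_comp mF); apply/measurable_fun_pair => //=.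
    exact: measurableT_comp.
  have [a0|an0] := eqVneq alpha 0.
    exists (fun z => ln (F (z.2, X i z.1)) - 1); split.
      by apply: measurable_funB; [exact: measurableT_comp|exact: measurable_cst].
    by move=> w th vgt0; rewrite /q_alpha a0 eqxx FE.
  (* The integral of the power [1 + alpha] of the density is replaced by its closed form. *)
  exists (fun z => alpha^-1 * (F (z.2, X i z.1) `^ alpha - 1) -
      (1 + alpha)^-1 * ((Num.sqrt (pi *+ 2))^-1 * expR (- (ln (z.2.2 : R) / 2))) `^ alpha /
      Num.sqrt (1 + alpha)); split.
    apply: measurable_funB.
      apply: measurable_funM; first exact: measurable_cst.
      apply: measurable_funB; last exact: measurable_cst.
      exact: (measurableT_comp (measurable_powR alpha) mFX).
    apply: measurable_funM; last exact: measurable_cst.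
    apply: measurable_funM; first exact: measurable_cst.
    apply: (measurableT_comp (measurable_powR alpha)).
    apply: measurable_funM; first exact: measurable_cst.
    apply: measurableT_comp => //; apply: measurableT_comp => //.
    apply: measurable_funM; last exact: measurable_cst.
    apply: (measurableT_comp (@measurable_ln R)).
    exact: (measurableT_comp measurable_snd measurable_snd).
  move=> w th vgt0; rewrite /q_alpha (negbTE an0) FE//; congr (_ - _).
  rewrite -mulrA; congr (_ * _).
  have s0 : 0 < Num.sqrt th.2 by rewrite sqrtr_gt0.
  rewrite /Rintegral /reg_density integral_normal_pdf_powR//=; congr (_ `^ _ / _).
  have -> : ln th.2 / 2 = ln (Num.sqrt th.2).
    rewrite -[in LHS](sqr_sqrtr (ltW vgt0)) lnXn// mulr2n; lra.
  by rewrite expRN lnK.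
exists (fun z => \sum_(i < n) Q i z).
  by apply: measurable_sum => i; exact: (QE i).1.
by move=> w th vgt0; apply: eq_bigr => i _; exact: (QE i).2.
Qed.

End regression_measurability.

(** * Prior mass near the truth *)

Section prior_mass.
Context {R : realType} (k : nat).
Local Notation Par := ('rV[measurableTypeR R]_k * measurableTypeR R)%type.
Local Notation mu := (@lebesgue_measure R).

Lemma measurable_rV_box (A : 'I_k -> set (measurableTypeR R)) :
  (forall j, measurable (A j)) ->
  measurable [set v : 'rV[measurableTypeR R]_k | forall j, A j (v ord0 j)].
Proof.
move=> mA; rewrite [X in measurable X](_ : _ = \bigcap_(j in [set: 'I_k])
    (fun v : 'rV[measurableTypeR R]_k => v ord0 j) @^-1` A j).
  apply: fin_bigcap_measurable => [|j _]; first exact: finite_finset.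
  by rewrite -[X in measurable X]setTI; exact: measurable_coord.
by apply/seteqP; split=> [v /= Av j _|v /= Av j]; exact: Av.
Qed.

(** [U] is a box, whose measure is a product of positive lengths, inside a neighbourhood where the
    prior exceeds half of its value at [theta0]. *)
Lemma prior_mass_near (theta0 : 'rV[R]_k * R) (prior : 'rV[R]_k * R -> R) (rho : R) :
  0 < theta0.2 -> is_prior_density (reg_lebesgue R k) (reg_par R k) prior ->
  {for theta0, continuous prior} -> 0 < prior theta0 -> 0 < rho ->
  exists U : set Par, [/\ measurable U, U `<=` reg_par R k,
    (0 < \int[reg_lebesgue R k]_(th in U) (prior th)%:E)%E &
    forall th, U th -> (forall j, `|(th.1 - theta0.1) ord0 j| < rho) /\
      `|th.2 - theta0.2| < rho].
Proof.
move=> v0 [mp p_ge0 _] cp p0 rho0.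
have ph : prior theta0 / 2 < prior theta0 by lra.
have hn : nbhs theta0 [set th | prior theta0 / 2 < prior th] by exact: (cvgr_gt _ cp _ ph).
have /(nbhs_ballP theta0)[e /= e0 he] := hn.
(* [r <= theta0.2] keeps the variances in [U] positive. *)
have [r [r0 re rr rv]] : exists r, [/\ 0 < r, r <= e, r <= rho & r <= theta0.2].
  exists (Num.min e (Num.min rho theta0.2)).
  by rewrite !lt_min e0 rho0 v0 !ge_min !lexx !orbT.
pose U1 := [set v : 'rV[measurableTypeR R]_k | forall j,
  (ball (theta0.1 ord0 j) r : set (measurableTypeR R)) (v ord0 j)].
pose U2 : set (measurableTypeR R) := ball theta0.2 r.
have mU1 : measurable U1.
  by apply: (@measurable_rV_box (fun j => ball (theta0.1 ord0 j) r)) => j; exact: measurable_ball.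
have mU2 : measurable U2 by exact: measurable_ball.
have mU : measurable (U1 `*` U2) by exact: measurableX.
have UT : U1 `*` U2 `<=` reg_par R k.
  move=> -[b v] [_]; rewrite /U2 /reg_par /ball/= => h.
  by have := ler_norm (theta0.2 - v); lra.
exists (U1 `*` U2); split => //.
- apply: (@lt_le_trans _ _ (\int[reg_lebesgue R k]_(th in U1 `*` U2) (cst (prior theta0 / 2)%:E th))%E).
    rewrite integral_cst// mule_gt0 ?lte_fin ?divr_gt0//.
    have nuU : reg_lebesgue R k (U1 `*` U2) = (lebesgue_rV k U1 * mu U2)%E.
      exact: product_measure1E.
    rewrite -[X in (0 < X)%E]/(reg_lebesgue R k (U1 `*` U2)) nuU mule_gt0//; last first.
      by rewrite lebesgue_measure_ball ?(ltW r0)// lte_fin mulrn_wgt0.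
    rewrite (lebesgue_rV_box (A := fun j => ball (theta0.1 ord0 j) r)) => [|j]; last first.
      exact: measurable_ball.
    apply: (big_ind (fun x => 0 < x)%E) => [|x y|j _]; [exact: lte01|exact: mule_gt0|].
    by rewrite lebesgue_measure_ball ?(ltW r0)// lte_fin mulrn_wgt0.
  apply: ge0_le_integral => //.
  + by move=> th _; rewrite lee_fin divr_ge0// ltW.
  + by apply/measurable_EFinP; apply: measurable_funS UT mp; exact: measurable_reg_par.
  move=> -[b v] [Ub Uv]; rewrite lee_fin; apply/ltW/he; split => /=.
    split=> // i j; rewrite ord1; exact: le_ball re _ (Ub j).
  exact: le_ball re _ Uv.
- move=> -[b v] [Ub Uv]; split=> [j|] /=.
    by have := le_ball rr (Ub j); rewrite /ball/= !mxE distrC.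
  by have := le_ball rr Uv; rewrite /ball/= distrC.
Qed.

End prior_mass.

(** * Exponential decay of the posterior in the regression model *)

Unset Implicit Arguments.
Set Strict Implicit.

Theorem theorem5p4 (R : realType) (d : measure_display) (T : measurableType d)
    (P : probability T R) (X : nat -> {RV P >-> R}) (g : nat -> R -> R)
    (k : nat) (t : nat -> 'rV[R]_k) (theta0 : 'rV[R]_k * R)
    (prior : 'rV[R]_k * R -> R) (alpha : R) :
  mutually_independent X ->
  (forall i, has_density (X i) (g i)) ->
  reg_par R k theta0 ->
  (forall i, g i = reg_density t i theta0) ->
  is_prior_density (reg_lebesgue R k) (reg_par R k) prior ->
  {for theta0, continuous prior} ->
  0 < prior theta0 ->
  0 <= alpha ->
  R1_condition t ->
  R2_condition t ->
  forall eps : R, 0 < eps ->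
  exists r : R, 0 < r /\
    P [set w | (R_posterior (reg_lebesgue R k) (reg_par R k) (reg_density t)
                  prior alpha n (fun i => X i w)
                  [set theta | reg_par R k theta /\
                     (eps <= n%:R^-1 *
                        \sum_(i < n) L1_dist (g i) (reg_density t i theta))%R]
                < (expR (- (n%:R * r)))%:E)%E] @[n --> \oo] --> 1%E.
Proof.
move=> indX dens v0 gE pd cp p0 a_ge0 R1 R2 eps eps0.
have Xdens i : has_density (X i) (reg_density t i theta0) by rewrite -gE.
have gE' : g = fun i => reg_density t i theta0 by apply/funext.
rewrite {}gE'.
have [M M0 tM] := bounded_design R1.
have [c c0 [n0 gram_ge]] := R2_gram_lower_bound R2.
have [dl [dl0 sep]] : exists dl, 0 < dl /\ whp P (fun n w => forall theta, 0 < theta.2 ->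
    q_n (reg_density t) alpha n (fun i => X i w) theta <=
      q_n (reg_density t) alpha n (fun i => X i w) theta0 + n%:R /\
    (n%:R * eps <= \sum_(i < n) L1_dist (reg_density t i theta0) (reg_density t i theta) ->
     q_n (reg_density t) alpha n (fun i => X i w) theta <=
      q_n (reg_density t) alpha n (fun i => X i w) theta0 - n%:R * (2 * dl))).
  have [a0|an0] := eqVneq alpha 0.
    by rewrite a0; exact: (loglik_separation indX v0 Xdens M0 tM c0 gram_ge eps0).
  have agt0 : 0 < alpha by rewrite lt_def an0.
  exact: (dpd_separation indX v0 Xdens agt0 eps0).
have [rho rho0 near_q] : exists2 rho, 0 < rho &
  whp P (fun n w => forall theta, 0 < theta.2 ->
    (forall j, `|(theta.1 - theta0.1) ord0 j| < rho) -> `|theta.2 - theta0.2| < rho ->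
    q_n (reg_density t) alpha n (fun i => X i w) theta0 - n%:R * dl <=
    q_n (reg_density t) alpha n (fun i => X i w) theta).
  have [a0|an0] := eqVneq alpha 0.
    by rewrite a0; exact: (loglik_near indX v0 Xdens M0 tM dl0).
  have agt0 : 0 < alpha by rewrite lt_def an0.
  have [rho rho0 H] := dpd_near_truth v0 agt0 M0 tM dl0; exists rho => //.
  by apply: whpT => n w theta; exact: H.
have [U [mU UT U0 Unear]] := prior_mass_near v0 pd cp p0 rho0.
exists (dl / 2); split; first by rewrite divr_gt0.
have /choice[Q QP] : forall n, exists Q : T * ('rV[measurableTypeR R]_k * measurableTypeR R) -> R,
    measurable_fun setT Q /\ forall w th, reg_par R k th ->
    q_n (reg_density t) alpha n (fun i => X i w) th = Q (w, th).
  by move=> n; have [Q] := reg_q_nE t X n a_ge0; exists Q.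
apply: (posterior_decay (@measurable_reg_par R k) pd (fun n => (QP n).1)
  (fun n => (QP n).2) dl0 _ _ mU UT U0).
- by move=> n; exact: measurable_L1_dist_ge.
- by move=> n th [].
apply: whpS (whpI sep near_q); near=> n => w [sepw nearw].
have n_gt0 : (0 < n)%N by near: n; exact: nbhs_infty_gt.
split=> [th vgt0|th Uth]; last first.
  by have [u1 u2] := Unear th Uth; apply: nearw => //; exact: UT.
have [h1 h2] := sepw th vgt0; split=> // -[_ L1ge]; apply: h2.
by rewrite mulrC -ler_pdivlMr ?ltr0n// mulrC.
Unshelve. all: by end_near.
Qed.
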